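(* Let $U:\mathbb R\to\mathbb R$ be continuously differentiable and $\lambda_{\mathrm{refr}}:\mathbb R\to[0,\infty)$ continuous, and let $(L,\mathcal D(L))$ be the associated zigzag operator on $L^2(\mu)$. Then $L$ is a closed dissipative operator which generates a strongly continuous contraction semigroup $(P(t))_{t\ge0}$ in $L^2(\mu)$. The adjoint of $L$ is given by $L^\star=FLF$, i.e. $\mathcal D(L^\star)=\{Ff:f\in\mathcal D(L)\}$ and $L^\star g=FLFg$ for $g\in\mathcal D(L^\star)$. The adjoint semigroup $(P^\star(t))_{t\ge0}$ is given by $P^\star(t)=FP(t)F$ for $t\ge0$.
   Context: $E=\mathbb R\times\{-1,+1\}$; for $f:E\to\mathbb C$ write $f^{\pm}(x)=f(x,\pm1)$. $\lambda(x,\theta)=\max(\theta U'(x),0)+\lambda_{\mathrm{refr}}(x)$ for $(x,\theta)\in E$. The measure $\nu$ on $\mathbb R$ is $\nu(dx)=e^{-U(x)}dx$ and $\mu$ on $E$ is $\mu(A\times\{\theta\})=\nu(A)$ (not necessarily finite). $L^2(\mu)$ is the complex Hilbert space with $\langle f,g\rangle=\sum_{\theta=\pm1}\int_{\mathbb R}f(x,\theta)\overline{g(x,\theta)}e^{-U(x)}dx$. $W^{1,2}_{\mathrm{loc}}(E)$ is the set of $f$ with $f^{\pm}\in W^{1,2}_{\mathrm{loc}}(\mathbb R)$. The operator $L$ is $Lf(x,\theta)=\theta\,\partial_xf(x,\theta)+\lambda(x,\theta)(f(x,-\theta)-f(x,\theta))$ with domain $\mathcal D(L)=\{f\in L^2(\mu)\cap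 W^{1,2}_{\mathrm{loc}}(E): Lf\in L^2(\mu)\}$ (where $Lf$ is the displayed expression). The flipping operator is $Ff(x,\theta)=f(x,-\theta)$. *)

(* Defs.v *)
From HB Require Import structures.
From mathcomp Require Import all_boot all_order all_algebra.
From mathcomp Require Import all_classical all_reals all_analysis.
From mathcomp Require Import measurable_realfun.
From mathcomp Require Import complex sesquilinear ring lra.

Set Implicit Arguments.
Unset Strict Implicit.
Unset Printing Implicit Defensive.

Import Order.TTheory GRing.Theory Num.Theory.
Import numFieldNormedType.Exports.

Local Open Scope classical_set_scope.
Local Open Scope complex_scope.
Local Open Scope ring_scope.
Local Open Scope quotient_scope.

Section dot_norm.
Context (C : numClosedFieldType) (U : lmodType C) (dot : {dot U for Num.conj}).
Implicit Types u v : U.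

Lemma dot_ge0 u : 0 <= dot u u.
Proof.
have [->|u0] := eqVneq u 0; last exact/ltW/neq0_dnorm_gt0.
by rewrite linear0r.
Qed.

Lemma dotDD u v : dot (u + v) (u + v) =
  dot u u + dot v v + (dot u v + (dot u v)^*).
Proof. by rewrite hnormD mul1r. Qed.

Lemma dotZZ (a : C) u : dot (a *: u) (a *: u) = `|a| ^+ 2 * dot u u.
Proof. by rewrite linearZl_LR linearZr_LR/= mulrA normCK. Qed.

Lemma dot_CauchySchwarz u v : `|dot u v| ^+ 2 <= dot u u * dot v v.
Proof.
have [->|v0] := eqVneq v 0.
  by rewrite linear0r normr0 expr0n mulr_ge0 ?dot_ge0.
have vv0 : 0 < dot v v by exact: neq0_dnorm_gt0.
pose a := dot u v / dot v v.
have uv : dot (u - a *: v) v = 0.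
  by rewrite linearBl/= linearZl_LR/= divfK ?gt_eqF// subrr.
have -> : dot u u = dot (u - a *: v) (u - a *: v) + `|a| ^+ 2 * dot v v.
  rewrite -[in LHS](subrK (a *: v) u) (dotDD (u - a *: v)) dotZZ linearZr_LR.
  by rewrite /= uv mulr0 conjC0 !addr0.
have -> : dot u v = a * dot v v by rewrite /a divfK ?gt_eqF.
rewrite normrM exprMn (ger0_norm (dot_ge0 v)) expr2 mulrA mulrDl lerDr.
by rewrite mulr_ge0 ?dot_ge0.
Qed.

Definition dot_norm u : C := sqrtC (dot u u).

Lemma dot_normD u v : dot_norm (u + v) <= dot_norm u + dot_norm v.
Proof.
have n0 w : 0 <= dot_norm w by rewrite sqrtC_ge0 dot_ge0.
rewrite -ler_sqr ?nnegrE ?addr_ge0// sqrrD !sqrtCK dotDD [leRHS]addrAC lerD2l.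
have -> : dot u v + (dot u v)^* = 'Re (dot u v) *+ 2.
  by rewrite -mulr_natr ReE divfK// pnatr_eq0.
rewrite lerMn2r/=; apply: le_trans (leif_Re_Creal _).1 _.
rewrite -ler_sqr ?nnegrE ?mulr_ge0// exprMn !sqrtCK.
exact: dot_CauchySchwarz.
Qed.

Lemma dot_normZ (a : C) u : dot_norm (a *: u) = `|a| * dot_norm u.
Proof. by rewrite /dot_norm dotZZ sqrtCM ?nnegrE ?exprn_ge0 ?dot_ge0// sqrCK. Qed.

Lemma dot_norm0_eq0 u : dot_norm u = 0 -> u = 0.
Proof.
move/eqP; rewrite sqrtC_eq0; have [//|u0] := eqVneq u 0.
by rewrite gt_eqF// neq0_dnorm_gt0.
Qed.

End dot_norm.

(* A function into R[i] is measurable (integrable) when its real and imaginary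
   parts are; its integral is taken componentwise. *)
Section complex_integration.
Context d (T : measurableType d) (R : realType).
Variable mu : {measure set T -> \bar R}.
Local Notation cRe := (@complex.Re R).
Local Notation cIm := (@complex.Im R).
Implicit Types (f g h : T -> R[i]) (a z : R[i]).

Definition measurable_funC f :=
  measurable_fun setT (cRe \o f) /\ measurable_fun setT (cIm \o f).

Definition Cintegral (D : set T) f : R[i] :=
  (\int[mu]_(x in D) cRe (f x)) +i* (\int[mu]_(x in D) cIm (f x)).

(* the squared modulus, as an element of R *)
Definition sqn (z : R[i]) : R := Normc.normc z ^+ 2.

Definition sq_integrable f :=
  measurable_funC f /\ (\int[mu]_x (sqn (f x))%:E < +oo)%E.

Definition integrableC f := mu.-integrable setT (EFin \o (cRe \o f)) /\
  mu.-integrable setT (EFin \o (cIm \o f)).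

Lemma sqnE z : sqn z = cRe z ^+ 2 + cIm z ^+ 2.
Proof. by case: z => x y /=; rewrite /sqn/= sqr_sqrtr// addr_ge0 ?sqr_ge0. Qed.

Lemma sqn_ge0 z : 0 <= sqn z. Proof. exact: sqr_ge0. Qed.

Lemma measurable_sqn f : measurable_funC f -> measurable_fun setT (sqn \o f).
Proof.
move=> [mr mi]; under [_ \o _]eq_fun do rewrite /= sqnE.
by apply: measurable_funD; apply: measurable_funX.
Qed.

Lemma measurable_funCD f g :
  measurable_funC f -> measurable_funC g -> measurable_funC (f + g).
Proof.
move=> [fr fi] [gr gi]; split.
  rewrite (_ : _ \o _ = (cRe \o f) \+ (cRe \o g)).
    exact: measurable_funD.
  by apply/funext => x /=; rewrite fctE; case: (f x) (g x) => ? ? [].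
rewrite (_ : _ \o _ = (cIm \o f) \+ (cIm \o g)).
  exact: measurable_funD.
by apply/funext => x /=; rewrite fctE; case: (f x) (g x) => ? ? [].
Qed.

Lemma measurable_funCM f g :
  measurable_funC f -> measurable_funC g -> measurable_funC (f \* g).
Proof.
move=> [fr fi] [gr gi]; split.
  rewrite (_ : _ \o _ = (cRe \o f) \* (cRe \o g) \-
                        (cIm \o f) \* (cIm \o g)).
    by apply: measurable_funB; apply: measurable_funM.
  by apply/funext => x /=; case: (f x) (g x) => ? ? [].
rewrite (_ : _ \o _ = (cRe \o f) \* (cIm \o g) \+
                      (cIm \o f) \* (cRe \o g)).
  by apply: measurable_funD; apply: measurable_funM.
by apply/funext => x /=; case: (f x) (g x) => ? ? [].
Qed.

Lemma measurable_funC_cst a : measurable_funC (cst a).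
Proof. by split; exact: measurable_cst. Qed.

Lemma measurable_funC_conj f :
  measurable_funC f -> measurable_funC (fun x => (f x)^*).
Proof.
move=> [fr fi]; split.
  rewrite (_ : _ \o _ = cRe \o f)//.
  by apply/funext => x /=; case: (f x).
rewrite (_ : _ \o _ = \- (cIm \o f)).
  exact: measurableT_comp.
by apply/funext => x /=; case: (f x).
Qed.

Lemma sq_integrableP f : sq_integrable f <->
  measurable_funC f /\ mu.-integrable setT (EFin \o (sqn \o f)).
Proof.
split=> -[mf fi]; split=> //.
  apply/integrableP; split; first exact/measurable_EFinP/measurable_sqn.
  by under eq_integral do rewrite gee0_abs ?lee_fin ?sqn_ge0//.
move/integrableP: fi => [_].
by under eq_integral do rewrite gee0_abs ?lee_fin ?sqn_ge0//.
Qed.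

Lemma sq_integrable_le f g h : measurable_funC h ->
    sq_integrable f -> sq_integrable g ->
    (forall x, sqn (h x) <= 2 * sqn (f x) + 2 * sqn (g x)) -> sq_integrable h.
Proof.
move=> mh /sq_integrableP[mf fi] /sq_integrableP[mg gi] hfg.
apply/sq_integrableP; split=> //.
apply: (@le_integrable _ _ _ _ _ _ _
  (fun x => (2%:E * (EFin \o (sqn \o f)) x + 2%:E * (EFin \o (sqn \o g)) x)%E)) => //.
- exact/measurable_EFinP/measurable_sqn.
- move=> x _; rewrite /= lee_fin !ger0_norm ?sqn_ge0 ?hfg//.
  by rewrite addr_ge0// mulr_ge0 ?sqn_ge0.
- by apply: integrableD => //; apply: integrableZl.
Qed.

Lemma sqnD z a : sqn (z + a) <= 2 * sqn z + 2 * sqn a.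
Proof.
rewrite !sqnE; case: z a => [x y] [x' y'] /=; rewrite -subr_ge0.
rewrite (_ : _ - _ = (x - x') ^+ 2 + (y - y') ^+ 2) ?addr_ge0 ?sqr_ge0//.
by ring.
Qed.

Lemma sqnM z a : sqn (z * a) = sqn z * sqn a.
Proof. by rewrite /sqn Normc.normcM exprMn. Qed.

Lemma sq_integrableD f g : sq_integrable f -> sq_integrable g ->
  sq_integrable (f + g).
Proof.
move=> fi gi; apply: (sq_integrable_le _ fi gi).
  by apply: measurable_funCD; [case: fi|case: gi].
by move=> x; exact: sqnD.
Qed.

Lemma sq_integrable0 : sq_integrable 0.
Proof.
split; first exact: (measurable_funC_cst 0).
by under eq_integral do rewrite sqnE/= expr0n addr0/=; rewrite integral0 ltry.
Qed.

Lemma sq_integrableZ a f : sq_integrable f -> sq_integrable (a *: f).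
Proof.
move=> /sq_integrableP[mf fi]; apply/sq_integrableP; split.
  by apply: measurable_funCM => //; exact: measurable_funC_cst.
rewrite (_ : _ \o _ = fun x => ((sqn a)%:E * (EFin \o (sqn \o f)) x)%E).
  exact: integrableZl.
by apply/funext => x; rewrite /= sqnM EFinM.
Qed.

Lemma integrableCM f g : sq_integrable f -> sq_integrable g ->
  integrableC (fun x => f x * (g x)^*).
Proof.
move=> /sq_integrableP[mf fi] /sq_integrableP[mg gi].
have [mr mi] := measurable_funCM mf (measurable_funC_conj mg).
have I : mu.-integrable setT
    (fun x => ((EFin \o (sqn \o f)) x + (EFin \o (sqn \o g)) x)%E).
  exact: integrableD.
have ineq (x y x' y' : R) : `|x * x' + y * y'| <= x ^+ 2 + y ^+ 2 + (x' ^+ 2 + y' ^+ 2).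
  rewrite ler_norml; apply/andP; split; rewrite -subr_ge0.
    rewrite (_ : _ - _ = 2^-1 * (x ^+ 2 + y ^+ 2 + x' ^+ 2 + y' ^+ 2 +
      (x + x') ^+ 2 + (y + y') ^+ 2)); last by field.
    by rewrite mulr_ge0 ?addr_ge0 ?sqr_ge0.
  rewrite (_ : _ - _ = 2^-1 * (x ^+ 2 + y ^+ 2 + x' ^+ 2 + y' ^+ 2 +
      (x - x') ^+ 2 + (y - y') ^+ 2)); last by field.
  by rewrite mulr_ge0 ?addr_ge0 ?sqr_ge0.
split; apply: le_integrable I => //.
- exact/measurable_EFinP.
- move=> x _; rewrite /= lee_fin [leRHS]ger0_norm ?addr_ge0 ?sqn_ge0//.
  rewrite !sqnE; case: (f x) (g x) => [a b] [a' b'] /=.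
  by have := ineq a b a' b'; rewrite mulrN opprK.
- exact/measurable_EFinP.
- move=> x _; rewrite /= lee_fin [leRHS]ger0_norm ?addr_ge0 ?sqn_ge0//.
  rewrite !sqnE; case: (f x) (g x) => [a b] [a' b'] /=.
  have := ineq a b (- b') a'.
  by rewrite sqrrN [b' ^+ 2 + _]addrC [b * a']mulrC.
Qed.

Lemma eq_Cintegral f g : measurable_funC f -> measurable_funC g ->
  f = g %[ae mu] -> Cintegral setT f = Cintegral setT g.
Proof.
move=> [fr fi] [gr gi] fg; rewrite /Cintegral; congr (_ +i* _).
  congr fine; apply: ae_eq_integral => //; first exact/measurable_EFinP.
    exact/measurable_EFinP.
  exact: (ae_eq_comp (fun z => (cRe z)%:E) fg).
congr fine; apply: ae_eq_integral => //; first exact/measurable_EFinP.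
  exact/measurable_EFinP.
exact: (ae_eq_comp (fun z => (cIm z)%:E) fg).
Qed.

Lemma CintegralD f g : integrableC f -> integrableC g ->
  Cintegral setT (fun x => f x + g x) = Cintegral setT f + Cintegral setT g.
Proof.
move=> [fr fi] [gr gi]; rewrite /Cintegral.
transitivity ((\int[mu]_x (cRe (f x) + cRe (g x))) +i*
              (\int[mu]_x (cIm (f x) + cIm (g x)))).
  by congr (_ +i* _); apply: eq_Rintegral => x _; case: (f x) (g x) => ? ? [].
by rewrite !RintegralD.
Qed.

Lemma CintegralZ a f : integrableC f ->
  Cintegral setT (fun x => a * f x) = a * Cintegral setT f.
Proof.
move=> [fr fi]; rewrite /Cintegral.
transitivity ((\int[mu]_x (cRe a * cRe (f x) - cIm a * cIm (f x))) +i*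
              (\int[mu]_x (cRe a * cIm (f x) + cIm a * cRe (f x)))).
  by congr (_ +i* _); apply: eq_Rintegral => x _; case: a (f x) => ? ? [].
have Z r (h : T -> R) : mu.-integrable setT (EFin \o h) ->
    mu.-integrable setT (EFin \o (fun x => r * h x)).
  by move=> hi; have := integrableZl measurableT r hi.
rewrite RintegralB ?RintegralD//; do ?exact: Z.
by rewrite !RintegralZl//; case: a.
Qed.

Lemma Cintegral_conj f : integrableC f ->
  Cintegral setT (fun x => (f x)^*) = (Cintegral setT f)^*.
Proof.
move=> [_ fi]; rewrite /Cintegral; congr (_ +i* _).
  by apply: eq_Rintegral => x _; case: (f x).
transitivity (\int[mu]_x (- 1 * cIm (f x))).
  by apply: eq_Rintegral => x _; case: (f x) => ? ?; rewrite mulN1r.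
by rewrite RintegralZl// mulN1r.
Qed.
End complex_integration.

(* L2 mu is the space of square integrable functions T -> R[i] modulo equality
   mu-almost everywhere. Its norm, which makes it a normed module over R[i],
   is the (R[i]-valued) norm of the inner product L2_dot, linear in its first
   and conjugate linear in its second argument. *)
Section L2_functions.
Context d (T : measurableType d) (R : realType).
Variable mu : {measure set T -> \bar R}.

Definition L2fun : {pred T -> R[i]} := mem [set f | sq_integrable mu f].

Lemma L2funP (f : T -> R[i]) : f \in L2fun -> sq_integrable mu f.
Proof. by rewrite inE. Qed.

Lemma L2fun_submod_closed : submod_closed L2fun.
Proof.
split=> [|a f g /L2funP fi /L2funP gi]; rewrite inE; first exact: sq_integrable0.
by apply: sq_integrableD => //; exact: sq_integrableZ.
Qed.

HB.instance Definition _ :=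
  GRing.isSubmodClosed.Build _ _ L2fun L2fun_submod_closed.

Record L2funType := L2Fun {
  L2fun_val :> T -> R[i] ;
  L2fun_valP : L2fun_val \in L2fun }.

HB.instance Definition _ := [isSub of L2funType for L2fun_val].
HB.instance Definition _ := [Choice of L2funType by <:].
HB.instance Definition _ := [SubChoice_isSubLmodule of L2funType by <:].

Lemma L2fun_sq_integrable (f : L2funType) : sq_integrable mu f.
Proof. exact/L2funP/L2fun_valP. Qed.

Definition L2fun_eq (f g : L2funType) : bool := `[< f = g %[ae mu] >].

Let L2fun_eq_refl : reflexive L2fun_eq.
Proof. by move=> f; apply/asboolP; exact: ae_eq_refl. Qed.

Let L2fun_eq_sym : symmetric L2fun_eq.
Proof.
by move=> f g; apply/idP/idP => /asboolP fg; apply/asboolP; exact: ae_eq_sym.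
Qed.

Let L2fun_eq_trans : transitive L2fun_eq.
Proof.
move=> g f h /asboolP fg /asboolP gh; apply/asboolP.
exact: ae_eq_trans fg gh.
Qed.

Canonical L2fun_eq_equiv :=
  EquivRel L2fun_eq L2fun_eq_refl L2fun_eq_sym L2fun_eq_trans.

Definition L2 : Type := {eq_quot L2fun_eq}.
HB.instance Definition _ := Choice.on L2.
HB.instance Definition _ := EqQuotient.on L2.

End L2_functions.

Section L2_lmodule.
Context d (T : measurableType d) (R : realType).
Variable mu : {measure set T -> \bar R}.
Local Notation L2 := (L2 mu).
Implicit Types (f g : L2funType mu) (u v w : L2) (a b : R[i]).

Definition L2_rep (u : L2) : L2funType mu := repr u.
Coercion L2_rep : L2 >-> L2funType.

Definition L2_class f : L2 := \pi_L2 f.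

Lemma L2_classP f g : L2_class f = L2_class g <-> f = g %[ae mu].
Proof.
rewrite /L2_class; split=> [/eqquotP/asboolP//|fg].
by apply/eqquotP/asboolP.
Qed.

Lemma L2_repK u : L2_class u = u. Proof. exact: reprK. Qed.

Lemma L2_classK f : L2_class f = f %[ae mu].
Proof. by apply/L2_classP; rewrite L2_repK. Qed.

Definition L2_add u v := L2_class (L2_rep u + L2_rep v).
Definition L2_opp u := L2_class (- L2_rep u).
Definition L2_scale a u := L2_class (a *: L2_rep u).

Lemma L2_addE f g : L2_add (L2_class f) (L2_class g) = L2_class (f + g).
Proof.
apply/L2_classP; have := L2_classK f; have := L2_classK g.
by apply: filterS2 => x /= gx fx _; rewrite /= !fctE gx// fx.
Qed.

Lemma L2_oppE f : L2_opp (L2_class f) = L2_class (- f).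
Proof.
by apply/L2_classP; have := L2_classK f; apply: filterS => x /= fx _; rewrite /= !fctE fx.
Qed.

Lemma L2_scaleE a f : L2_scale a (L2_class f) = L2_class (a *: f).
Proof.
apply/L2_classP; have := L2_classK f; apply: filterS => x /= fx _.
by rewrite /= !fctE fx.
Qed.

Let addA : associative L2_add.
Proof.
move=> u v w; rewrite -(L2_repK u) -(L2_repK v) -(L2_repK w) !L2_addE.
by rewrite addrA.
Qed.

Let addC : commutative L2_add.
Proof. by move=> u v; rewrite /L2_add addrC. Qed.

Let add0 : left_id (L2_class 0) L2_add.
Proof. by move=> u; rewrite -[in LHS](L2_repK u) L2_addE add0r L2_repK. Qed.

Let addN : left_inverse (L2_class 0) L2_opp L2_add.
Proof. by move=> u; rewrite -(L2_repK u) L2_oppE L2_addE addNr. Qed.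

HB.instance Definition _ := GRing.isZmodule.Build L2 addA addC add0 addN.

Let scaleA a b u : L2_scale a (L2_scale b u) = L2_scale (a * b) u.
Proof. by rewrite -(L2_repK u) !L2_scaleE scalerA. Qed.

Let scale1 : left_id 1 L2_scale.
Proof. by move=> u; rewrite /L2_scale scale1r L2_repK. Qed.

Let scaleDr : right_distributive L2_scale +%R.
Proof.
move=> a u v; rewrite -(L2_repK u) -(L2_repK v) /GRing.add/=.
by rewrite L2_addE !L2_scaleE scalerDr L2_addE.
Qed.

Let scaleDl u : {morph L2_scale^~ u : a b / a + b}.
Proof.
move=> a b; rewrite -(L2_repK u) !L2_scaleE scalerDl.
by rewrite [RHS]L2_addE.
Qed.

HB.instance Definition _ :=
  GRing.Zmodule_isLmodule.Build R[i] L2 scaleA scale1 scaleDr scaleDl.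

Lemma L2_addP u v : (u + v : L2) = (fun x => u x + v x) %[ae mu].
Proof. by have := L2_classK (L2_rep u + L2_rep v); exact. Qed.

Lemma L2_scaleP a u : (a *: u : L2) = (fun x => a * u x) %[ae mu].
Proof. by have := L2_classK (a *: L2_rep u); exact. Qed.

Definition L2_dot u v : R[i] := Cintegral mu setT (fun x => u x * (v x)^*).

Lemma L2_measurable u : measurable_funC u.
Proof. by have [] := L2fun_sq_integrable u. Qed.

Lemma L2_dot_integrable u v : integrableC mu (fun x => u x * (v x)^*).
Proof. exact: integrableCM (L2fun_sq_integrable _) (L2fun_sq_integrable _). Qed.

Lemma L2_dotE f g : L2_dot (L2_class f) (L2_class g) =
  Cintegral mu setT (fun x => f x * (g x)^*).
Proof.
have m (h k : L2funType mu) : measurable_funC (fun x => h x * (k x)^*).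
  apply: measurable_funCM; last apply: measurable_funC_conj.
    by have [] := L2fun_sq_integrable h.
  by have [] := L2fun_sq_integrable k.
apply: eq_Cintegral => //; have := L2_classK f; have := L2_classK g.
by apply: filterS2 => x /= gx fx _; rewrite gx// fx.
Qed.

Let dotC u v : L2_dot u v = (-1) ^+ false * (L2_dot v u)^*.
Proof.
rewrite expr0 mul1r /L2_dot -Cintegral_conj; last exact: L2_dot_integrable.
by congr Cintegral; apply/funext => x; rewrite rmorphM/= conjCK mulrC.
Qed.

Let dotl v : GRing.linear_for *%R (L2_dot^~ v).
Proof.
move=> a u w; rewrite -(L2_repK u) -(L2_repK v) -(L2_repK w).
rewrite {1}/GRing.scale {1}/GRing.add/= L2_scaleE L2_addE !L2_dotE.
rewrite -CintegralZ; last exact: L2_dot_integrable.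
rewrite -CintegralD; last exact: L2_dot_integrable; last first.
  rewrite (_ : (fun x => _) = fun x => (a *: (L2_rep u : T -> R[i])) x * (v x)^*).
    by apply: integrableCM; [apply: sq_integrableZ|]; exact: L2fun_sq_integrable.
  by apply/funext => x; rewrite !fctE mulrA.
by congr Cintegral; apply/funext => x /=; rewrite !fctE mulrDl mulrA.
Qed.

Let dotr u : GRing.linear_for (Num.conj \; *%R) (L2_dot u).
Proof.
move=> a v w; rewrite dotC [in RHS]dotC [X in _ = _ + X]dotC !mul1r dotl.
by rewrite rmorphD rmorphM.
Qed.

HB.instance Definition _ :=
  bilinear_isBilinear.Build R[i] L2 L2 R[i] *%R (Num.conj \; *%R) L2_dot (dotl, dotr).
HB.instance Definition _ :=
  isHermitianSesquilinear.Build R[i] L2 false Num.conj L2_dot dotC.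

Lemma L2_dot_self u : L2_dot u u = (\int[mu]_x sqn (u x))%:C.
Proof.
rewrite /L2_dot /Cintegral; congr (_ +i* _).
  apply: eq_Rintegral => x _; rewrite sqnE; case: (u x) => a b /=.
  by rewrite mulrN opprK.
transitivity (\int[mu]_x (0 : R)); last by rewrite Rintegral_cst// mul0r.
apply: eq_Rintegral => x _; case: (u x) => a b /=.
by rewrite mulrN [b * a]mulrC addNr.
Qed.

Let dot_gt0 u : u != 0 -> 0 < L2_dot u u.
Proof.
rewrite L2_dot_self ltcR => u0; rewrite lt0r Rintegral_ge0 ?andbT; last first.
  by move=> x _; exact: sqn_ge0.
apply: contra u0 => /eqP I0; apply/eqP; rewrite -(L2_repK u).
apply/L2_classP.
have [mu_ fin_] := L2fun_sq_integrable u.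
have : (\int[mu]_x `|(sqn (u x))%:E| = 0)%E.
  under eq_integral do rewrite gee0_abs ?lee_fin ?sqn_ge0//.
  rewrite -[LHS]fineK; first by congr EFin.
  rewrite ge0_fin_numE//; apply: integral_ge0 => x _.
  by rewrite lee_fin sqn_ge0.
have ms : measurable_fun setT (fun x => (sqn (u x))%:E).
  exact/measurable_EFinP/measurable_sqn.
move/(ae_eq_integral_abs mu measurableT ms).
apply: filterS => x /= /(_ I) [] + _.
rewrite sqnE => /eqP; rewrite paddr_eq0 ?sqr_ge0// !sqrf_eq0.
by case: (u x) => a b /= /andP[/eqP -> /eqP ->].
Qed.
HB.instance Definition _ := isDotProduct.Build R[i] L2 L2_dot dot_gt0.

HB.instance Definition _ := @Lmodule_isNormed.Build R[i] L2 (dot_norm L2_dot)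
  (@dot_normD _ _ L2_dot) (@dot_normZ _ _ L2_dot) (@dot_norm0_eq0 _ _ L2_dot).

(* The class of f when f is square integrable; the value 0 is junk. *)
Definition to_L2 (f : T -> R[i]) : L2 :=
  if pselect (sq_integrable mu f) is left fi then L2_class (L2Fun (mem_set fi))
  else 0.

End L2_lmodule.

Arguments L2_dot {d T R} mu u v.
Arguments to_L2 {d T R} mu f.

Section operators.
Context (R : realType) (H : normedModType R[i]) (dot : {dot H for Num.conj}).

(* A possibly unbounded operator: only the values of [op] on [dom] matter *)
Record operator := Operator { dom : set H ; op :> H -> H }.

Implicit Types (A B : operator) (P : R -> H -> H).

Definition linear_operator A :=
  [/\ dom A 0,
      forall (a : R[i]) f g, dom A f -> dom A g -> dom A (a *: f + g) &
      forall (a : R[i]) f g, dom A f -> dom A g ->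
        A (a *: f + g) = a *: A f + A g].

Definition closed_operator A :=
  linear_operator A /\ closed [set p : H * H | dom A p.1 /\ A p.1 = p.2].

Definition dissipative A := forall f, dom A f -> complex.Re (dot (A f) f) <= 0.

(* B is the adjoint of the densely defined operator A: <A f, g> = <f, h> for all
   f in dom A holds exactly when g is in dom B and h = B g. *)
Definition is_adjoint A B := dense (dom A) /\
  forall g h, (dom B g /\ B g = h) <->
              (forall f, dom A f -> dot (A f) g = dot f h).

(* strongly continuous; only the P t with 0 <= t matter *)
Definition contraction_semigroup P :=
  [/\ forall t, 0 <= t -> linear (P t),
      forall t f, 0 <= t -> `|P t f| <= `|f|,
      forall f, P 0 f = f,
      forall s t f, 0 <= s -> 0 <= t -> P (s + t) f = P s (P t f) &
      forall f, {within `[0, +oo[, continuous (fun t => P t f)}].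

Definition generates A P := contraction_semigroup P /\
  forall f g, (dom A f /\ A f = g) <->
    (fun t : R => (t^-1)%:C *: (P t f - f)) @ 0^'+ --> g.

End operators.

Section weak_derivative.
Context (R : realType).
Implicit Types (f g : R -> R[i]) (phi : R -> R).
Local Notation leb := (@lebesgue_measure R).

Definition L2loc f :=
  measurable_funC (f : measurableTypeR R -> R[i]) /\
  forall K : set R, compact K -> (\int[leb]_(x in K) (sqn (f x))%:E < +oo)%E.

Definition test_function phi := (forall n x, derivable (derive1n n phi) x 1) /\
  compact (closure [set x | phi x != 0]).

(* Real test functions suffice: both sides are complex linear in phi. *)
Definition weak_derivative f g := forall phi, test_function phi ->
  Cintegral leb setT (fun x => f x * (derive1 phi x)%:C) =
  - Cintegral leb setT (fun x => g x * (phi x)%:C).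

Definition W12loc f := L2loc f /\ exists2 g, L2loc g & weak_derivative f g.

(* a chosen weak derivative of f in L^2_loc when f is in W^{1,2}_loc *)
Definition wderiv f : R -> R[i] :=
  xget (fun=> 0) [set g | L2loc g /\ weak_derivative f g].

End weak_derivative.

Section zigzag.
Context (R : realType).
Implicit Types (U lrefr : R -> R).

Definition C1 U := (forall x, derivable U x 1) /\ continuous (derive1 U).

Lemma C1_measurable U : C1 U -> measurable_fun setT (U : measurableTypeR R -> R).
Proof.
move=> [dU _]; apply: continuous_measurable_fun => x.
by apply: differentiable_continuous; apply/derivable1_diffP.
Qed.

Definition nu U (hU : C1 U) (A : set (measurableTypeR R)) : \bar R :=
  (\int[lebesgue_measure]_(x in A) (expR (- U x))%:E)%E.

Section nu_measure.
Context (U : R -> R) (hU : C1 U).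

Let nu0 : nu hU set0 = 0%E. Proof. exact: integral_set0. Qed.

Let nu_ge0 A : (0 <= nu hU A)%E.
Proof. by apply: integral_ge0 => x _; rewrite lee_fin expR_ge0. Qed.

Let nu_sigma_additive : semi_sigma_additive (nu hU).
Proof.
apply: semi_sigma_additive_nng_induced; last by move=> x; rewrite lee_fin expR_ge0.
apply/measurable_EFinP; apply: measurableT_comp => //; apply: measurableT_comp => //.
exact: C1_measurable.
Qed.

HB.instance Definition _ := isMeasure.Build _ _ _ (nu hU)
  nu0 nu_ge0 nu_sigma_additive.

End nu_measure.

(* The velocities +1 and -1 are encoded by true and false. *)
Local Notation E := (measurableTypeR R * bool)%type.

Definition velocity (theta : bool) : R := if theta then 1 else -1.

Definition zz_measure U (hU : C1 U) (A : set E) : \bar R :=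
  (nu hU [set x | A (x, true)] + nu hU [set x | A (x, false)])%E.

Section zz_measure_measure.
Context (U : R -> R) (hU : C1 U).

Let slice theta : {measure set E -> \bar R} :=
  measure_function_pushforward__canonical__measure_function_Measure
    (nu hU) (pair2_measurable theta).

Let zz_measureE : zz_measure hU = measure_add (slice true) (slice false).
Proof. by apply/funext => A; rewrite measure_addE. Qed.

Let zz_measure0 : zz_measure hU set0 = 0%E.
Proof. by rewrite zz_measureE; exact: (measure0 (measure_add (slice true) (slice false))). Qed.

Let zz_measure_ge0 A : (0 <= zz_measure hU A)%E.
Proof. by rewrite zz_measureE; exact: (measure_ge0
  (measure_add (slice true) (slice false))). Qed.

Let zz_measure_sigma_additive : semi_sigma_additive (zz_measure hU).
Proof. rewrite zz_measureE.
exact: (@measure_semi_sigma_additive _ _ _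
  (measure_add (slice true) (slice false))). Qed.

HB.instance Definition _ := isMeasure.Build _ _ _ (zz_measure hU)
  zz_measure0 zz_measure_ge0 zz_measure_sigma_additive.

End zz_measure_measure.

Definition W12locE (f : E -> R[i]) :=
  forall theta, W12loc (fun x => f (x, theta)).

Definition rate U lrefr (e : E) : R :=
  Num.max (velocity e.2 * derive1 U e.1) 0 + lrefr e.1.

Definition zz_expr U lrefr (f : E -> R[i]) (e : E) : R[i] :=
  (velocity e.2)%:C * wderiv (fun x => f (x, e.2)) e.1
  + (rate U lrefr e)%:C * (f (e.1, ~~ e.2) - f e).

Definition zigzag U (hU : C1 U) lrefr : operator (L2 (zz_measure hU)) :=
  Operator
    [set f : L2 (zz_measure hU) |
       W12locE (L2_rep f) /\
       sq_integrable (zz_measure hU) (zz_expr U lrefr (L2_rep f))]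
    (fun f => to_L2 (zz_measure hU) (zz_expr U lrefr (L2_rep f))).

Definition flip U (hU : C1 U) (f : L2 (zz_measure hU)) : L2 (zz_measure hU) :=
  to_L2 (zz_measure hU) (fun e => f (e.1, ~~ e.2)).

End zigzag.

Arguments flip {R U} hU f.
Arguments zigzag {R U} hU lrefr.

(* Main.v *)
Require Import Defs.
From mathcomp Require Import all_boot all_order all_algebra.
From mathcomp Require Import all_classical all_reals all_analysis.
From mathcomp Require Import measurable_realfun.
From mathcomp Require Import complex sesquilinear ring lra.

Set Implicit Arguments.
Unset Strict Implicit.
Unset Printing Implicit Defensive.

Import Order.TTheory GRing.Theory Num.Theory.
Import numFieldNormedType.Exports.

Local Open Scope classical_set_scope.
Local Open Scope complex_scope.
Local Open Scope ring_scope.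

(* Write ' for d/dx. For f in dom L and Fv in dom L,
     sum_theta Re (Lf conj v - f conj (FLFv)) e^{-U} = Re ((f^+ conj v^+ - f^- conj v^-) e^{-U})'
   almost everywhere, because lambda^+ - lambda^- = U'. The flux under the
   derivative is integrable and locally absolutely continuous, so its derivative
   has integral zero even when mu is infinite. Likewise
     sum_theta Re (Lf conj f) e^{-U} = ((|f^+|^2 - |f^-|^2) e^{-U})' / 2
                             - (lambda^+ + lambda^-) |f^+ - f^-|^2 e^{-U} / 2.
   Hence L is dissipative and L* extends FLF. Conversely <Lf, g> = <f, h> for
   all f in dom L, tested on smooth compactly supported functions carried by one
   velocity, says that g e^{-U} has a weak derivative, whence Fg is in dom L: so
   L* = FLF. Then L = F L* F is closed. A vector orthogonal to the range of
   1 - hL is an eigenvector of FLF with eigenvalue 1/h > 0, so it vanishes by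
   dissipativity, and L generates a contraction semigroup, the limit of the
   implicit Euler scheme. The adjoint of (1 - hL)^-1 is F (1 - hL)^-1 F, and
   this passes to the limit. *)

(** * Orthogonal projection in complex Hilbert spaces *)

(** The growth of [U] and of the rates is unrestricted, so the flux identity is proved on the whole
    maximal domain rather than by approximation with compactly supported functions. Elements of the
    domain are classes with a chosen weak derivative; they are traded for locally absolutely
    continuous representatives, which obey a product rule. Boundary terms at infinity are excluded
    as follows: if the derivative of the flux had a positive integral, the flux far to the right
    would exceed the flux far to the left by a fixed amount, hence stay away from 0 on a half-line,
    against its integrability.

    The functional analysis is done for an abstract linear dissipative [L] and a symmetric
    involution [F] such that the adjoint of [L] is [F L F] and the domain has trivial orthogonal
    complement: density, closedness and the range condition follow. The Euler scheme converges
    because resolvents are commuting contractions and, on the domain of [L^2], a step of length h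
    errs by O(h^2), so that n steps of length t/n err by O(t^2/n). *)

Lemma ler_eps (R : realType) (a b : R) : (forall e : R, 0 < e -> a <= b + e) -> a <= b.
Proof. by move=> h; apply/ler_addgt0Pr. Qed.

Section rnorm.
Context (R : realType) (H : normedModType R[i]).
Implicit Types (u v w : H).

(** The norm of [H] takes values in [R[i]], which is only partially ordered. Its real part loses
    nothing, by [normE], and brings estimates into [R], where [lra] and [nra] apply. *)
Definition rnorm u : R := complex.Re `|u|.

Lemma normE u : `|u| = (rnorm u)%:C.
Proof.
by rewrite /rnorm; have := normr_ge0 u; case: `|u| => a b; rewrite lecE /= => /andP[/eqP -> _].
Qed.

Lemma rnorm_ge0 u : 0 <= rnorm u.
Proof. by rewrite -lecR -normE normr_ge0. Qed.

Lemma rnormD u v : rnorm (u + v) <= rnorm u + rnorm v.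
Proof. by rewrite -lecR rmorphD/= -!normE ler_normD. Qed.

Lemma rnormN u : rnorm (- u) = rnorm u.
Proof. by rewrite /rnorm normrN. Qed.

Lemma rnormB u v : rnorm (u - v) <= rnorm u + rnorm v.
Proof. by rewrite -(rnormN v) rnormD. Qed.

Lemma rdistC u v : rnorm (u - v) = rnorm (v - u).
Proof. by rewrite /rnorm distrC. Qed.

Lemma rnorm0 : rnorm 0 = 0.
Proof. by rewrite /rnorm normr0. Qed.

Lemma rnorm0_eq0 u : rnorm u = 0 -> u = 0.
Proof. by move=> u0; apply/normr0_eq0; rewrite normE u0. Qed.

Lemma rnormZ (r : R) u : rnorm (r%:C *: u) = `|r| * rnorm u.
Proof.
rewrite {1}/rnorm normrZ normE normc_def /= expr0n /= addr0 sqrtr_sqr.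
by rewrite mulr0 subr0.
Qed.

Lemma rdist_triangle w u v : rnorm (u - v) <= rnorm (u - w) + rnorm (w - v).
Proof. by apply: le_trans (rnormD _ _); rewrite addrA subrK. Qed.

Lemma rnorm_cvgP (T : Type) (F : set_system T) (FF : Filter F) (f : T -> H) (l : H) :
  (f @ F --> l) <-> forall e : R, 0 < e -> \forall t \near F, rnorm (f t - l) < e.
Proof.
split=> [/cvgrPdistC_lt fl e e0|fl].
  have /fl : 0 < e%:C :> R[i] by rewrite ltcR.
  by apply: filterS => t; rewrite normE ltcR.
(* A positive element of [R[i]] has imaginary part 0, so real tolerances suffice. *)
apply/cvgrPdistC_lt => -[e b]; rewrite ltcE /= => /andP[/eqP -> e0].
by apply: filterS (fl _ e0) => t; rewrite normE ltcR.
Qed.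

Lemma rnorm_cvg_le (f : nat -> H) l v c : f @ \oo --> l ->
  (forall n, rnorm (f n - v) <= c) -> rnorm (l - v) <= c.
Proof.
move=> /rnorm_cvgP fl fc; apply: ler_eps => e e0.
have [N _ /(_ N (leqnn N)) /= fN] := fl _ e0.
apply: le_trans (rdist_triangle (f N) _ _) _.
by rewrite rdistC addrC lerD// ltW.
Qed.

Definition cauchy_complete := forall u : nat -> H,
  (forall e : R, 0 < e -> exists N, forall m n, (N <= m)%N -> (N <= n)%N ->
     rnorm (u m - u n) < e) ->
  exists l : H, u @ \oo --> l.

End rnorm.

Section projection.
Context (R : realType) (H : normedModType R[i]) (dot : {dot H for Num.conj}).
Hypothesis norm_dot : forall u : H, `|u| = dot_norm dot u.
Implicit Types (u v w : H).

Lemma dot_rnorm u : dot u u = (rnorm u ^+ 2)%:C.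
Proof. by rewrite rmorphXn/= -normE norm_dot sqrtCK. Qed.

Lemma Re_dotC u v : complex.Re (dot u v) = complex.Re (dot v u).
Proof. by rewrite [dot u v]hermC/= expr0 mul1r; case: (dot v u). Qed.

Lemma dotZr_real (r : R) u v : dot u (r%:C *: v) = r%:C * dot u v.
Proof.
rewrite linearZr_LR/=; congr (_ * _).
by apply/eqP; rewrite eq_complex/= oppr0 !eqxx.
Qed.

Lemma Re_dotZr (r : R) u v :
  complex.Re (dot u (r%:C *: v)) = r * complex.Re (dot u v).
Proof. by rewrite dotZr_real; case: (dot u v) => a b /=; ring. Qed.

(** The second argument is conjugate linear: multiplying it by ['i] turns the imaginary part of the
    product into the real part. Orthogonality arguments can thus be confined to real parts. *)
Lemma Re_doti u v : complex.Re (dot u ('i *: v)) = complex.Im (dot u v).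
Proof. by rewrite linearZr_LR/=; case: (dot u v) => a b /=; ring. Qed.

Lemma rnormD_sqr u v :
  rnorm (u + v) ^+ 2 = rnorm u ^+ 2 + rnorm v ^+ 2 + 2 * complex.Re (dot u v).
Proof.
have := dotDD dot u v; rewrite !dot_rnorm => /(congr1 (@complex.Re R)).
rewrite !raddfD/= => ->; congr (_ + _).
by case: (dot u v) => a b /=; ring.
Qed.

Lemma rnormB_sqr u v :
  rnorm (u - v) ^+ 2 = rnorm u ^+ 2 + rnorm v ^+ 2 - 2 * complex.Re (dot u v).
Proof. by rewrite rnormD_sqr rnormN linearNr raddfN/= mulrN. Qed.

Lemma normcE (z : R[i]) : `|z| = (Normc.normc z)%:C.
Proof. by rewrite normc_def; case: z. Qed.

Lemma dot_le u v : Normc.normc (dot u v) <= rnorm u * rnorm v.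
Proof.
have nn (z : R[i]) : 0 <= Normc.normc z by case: z => a b /=; exact: sqrtr_ge0.
rewrite -(@ler_pXn2r _ 2)// ?nnegrE ?mulr_ge0 ?rnorm_ge0 ?nn//.
rewrite -lecR exprMn [X in _ <= X]rmorphM/= -!dot_rnorm.
by rewrite rmorphXn/= -normcE; exact: dot_CauchySchwarz.
Qed.

Lemma dot_nondegenerate u v : (forall w, dot w u = dot w v) -> u = v.
Proof.
move=> uv; apply/eqP; rewrite -subr_eq0; apply/eqP/rnorm0_eq0/eqP.
have : dot (u - v) (u - v) = 0 by rewrite linearBr /= uv subrr.
by rewrite dot_rnorm => -[] /eqP; rewrite sqrf_eq0.
Qed.

Lemma dot_cvgl (T : Type) (F : set_system T) (FF : Filter F) (f : T -> H) (u a : H) :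
  f @ F --> u -> forall e : R, 0 < e ->
  \forall t \near F, Normc.normc (dot (f t) a - dot u a) < e.
Proof.
move=> /rnorm_cvgP fu e e0.
have a0 : 0 < rnorm a + 1 by rewrite ltr_wpDl ?rnorm_ge0.
apply: filterS (fu _ (divr_gt0 e0 a0)) => t; rewrite ltr_pdivlMr// => ft.
rewrite -linearBl/=; apply: le_lt_trans (dot_le _ _) _; apply: le_lt_trans ft.
by rewrite ler_wpM2l ?rnorm_ge0// lerDl.
Qed.

Lemma dot_cvgr (T : Type) (F : set_system T) (FF : Filter F) (f : T -> H) (u a : H) :
  f @ F --> u -> forall e : R, 0 < e ->
  \forall t \near F, Normc.normc (dot a (f t) - dot a u) < e.
Proof.
move=> fu e e0; apply: filterS (dot_cvgl _ a fu e0) => t.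
rewrite -!linearBl -!linearBr/= [in X in _ -> X]hermC/= expr0 mul1r.
by case: (dot _ _) => x y /=; rewrite sqrrN.
Qed.

(** Carries an identity between inner products to the limit; it serves for the closedness of the
    graph and for the adjoint of the semigroup. *)
Lemma normc_cvg_unique (T : Type) (F : set_system T) (FF : ProperFilter F)
    (f g : T -> R[i]) (z w : R[i]) :
  (forall e : R, 0 < e -> \forall t \near F, Normc.normc (f t - z) < e) ->
  (forall e : R, 0 < e -> \forall t \near F, Normc.normc (g t - w) < e) ->
  (\forall t \near F, f t = g t) -> z = w.
Proof.
move=> fz gw fg.
suff : Normc.normc (z - w) <= 0.
  by move=> h; apply/eqP; rewrite -subr_eq0 -normr_le0 normcE lecR; exact: h.
apply: ler_eps => e e0; rewrite add0r.
have d0 : 0 < e / 2 by rewrite divr_gt0.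
have [t [/= [ft gt] fgt]] := filter_ex (filterI (filterI (fz _ d0) (gw _ d0)) fg).
have -> : z - w = (g t - w) - (f t - z) by rewrite fgt opprB [RHS]addrC addrA subrK.
rewrite -lecR -normcE; apply: le_trans (ler_normB _ _) _.
rewrite !normcE -rmorphD lecR; apply: ltW.
by rewrite [ltRHS]splitr ltrD.
Qed.

(** Projection on the closure of [S]: a minimizing sequence for the distance to [x] is Cauchy, [x]
    minus its limit is orthogonal to [S], hence zero, and so the sequence itself approximates
    [x]. *)
Lemma dense_orthogonal (S : set H) : cauchy_complete H -> S 0 ->
  (forall (a : R[i]) u v, S u -> S v -> S (a *: u + v)) ->
  (forall g, (forall f, S f -> dot f g = 0) -> g = 0) ->
  forall x (e : R), 0 < e -> exists2 s, S s & rnorm (x - s) < e.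
Proof.
move=> HC S0 SD Sg x.
pose D := [set rnorm (x - s) | s in S].
have D0 : D !=set0 by exists (rnorm (x - 0)), 0.
have lbD : has_lbound D by exists 0 => _ [s _ <-]; rewrite rnorm_ge0.
pose d := inf D.
have d0 : 0 <= d by apply: lb_le_inf => // _ [s _ <-]; rewrite rnorm_ge0.
have dS s : S s -> d <= rnorm (x - s) by move=> Ss; apply: ge_inf => //; exists s.
have /choice [s sP] : forall n, exists t, S t /\ rnorm (x - t) < d + n.+1%:R^-1.
  move=> n.
  have n0 : 0 < n.+1%:R^-1 :> R by rewrite invr_gt0.
  by have [_ [t St <-] td] := inf_adherent n0 (conj D0 lbD); exists t.
have small (e : R) : 0 < e -> exists N, forall n, (N <= n)%N -> n.+1%:R^-1 < e.
  move=> e0; have [N _ NP] := near_infty_natSinv_lt (PosNum e0).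
  by exists N => n /NP.
(* Parallelogram law for [x - s n] and [x - s m], half of whose sum is [x] minus a point of [S], of
   norm at least [d]. The constant comes from (d + q)^2 <= d^2 + (2 d + 1) q for 0 <= q <= 1. *)
have cauchy m n : rnorm (s m - s n) ^+ 2 <= 2 * (2 * d + 1) * (m.+1%:R^-1 + n.+1%:R^-1).
  have Sh : S (2^-1%:C *: s m + 2^-1%:C *: s n).
    by apply: (SD); [exact: (sP m).1|rewrite -[_ *: _]addr0; apply: (SD) => //; exact: (sP n).1].
  have := dS _ Sh.
  have e1 : s m - s n = (x - s n) - (x - s m) by rewrite opprB [RHS]addrC addrA subrK.
  have e2 : (x - s n) + (x - s m) = 2%:C *: (x - (2^-1%:C *: s m + 2^-1%:C *: s n)).
    have h2 : 2%:C * 2^-1%:C = 1 :> R[i] by rewrite -rmorphM/= divff.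
    rewrite scalerBr scalerDr !scalerA h2 !scale1r rmorphD/= scalerDl !scale1r.
    by rewrite opprD addrACA [- s n - s m]addrC.
  have := rnormD_sqr (x - s n) (x - s m); rewrite e2 rnormZ exprMn real_normK ?num_real//.
  rewrite e1 [rnorm (x - s n - _) ^+ 2]rnormB_sqr.
  have := (sP m).2; have := (sP n).2.
  have p1 k : 0 <= k.+1%:R^-1 :> R /\ k.+1%:R^-1 <= 1 :> R by split; rewrite ?invr_ge0 ?ler0n// invf_le1// ler1n.
  have := p1 m; have := p1 n; have := rnorm_ge0 (x - s m); have := rnorm_ge0 (x - s n).
  move: (m.+1%:R^-1) (n.+1%:R^-1) => p q a0 b0 [q0 q1] [p0 p1'] aq bp h dh.
  have aa : rnorm (x - s n) ^+ 2 <= d ^+ 2 + (2 * d + 1) * q by nra.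
  have bb : rnorm (x - s m) ^+ 2 <= d ^+ 2 + (2 * d + 1) * p by nra.
  have dd : d ^+ 2 <= rnorm (x - (2^-1%:C *: s m + 2^-1%:C *: s n)) ^+ 2 by nra.
  lra.
have [l sl] : exists l : H, s @ \oo --> l.
  apply: HC => e e0.
  have c0 : 0 < 4 * (2 * d + 1) by rewrite mulr_gt0// ltr_wpDl// mulr_ge0.
  have [N NP] := small (e ^+ 2 / (4 * (2 * d + 1))) (divr_gt0 (exprn_gt0 2 e0) c0).
  exists N => m n /NP mN /NP nN.
  rewrite -(@ltr_pXn2r _ 2)// ?nnegrE ?rnorm_ge0 ?(ltW e0)//.
  apply: le_lt_trans (cauchy _ _) _; move: mN nN.
  rewrite !ltr_pdivlMr//; move: (m.+1%:R^-1) (n.+1%:R^-1) (e ^+ 2) => p q r; lra.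
have /rnorm_cvgP sl' := sl.
have g0 : x - l = 0.
  apply: Sg.
  have xld : rnorm (x - l) <= d.
    apply: ler_eps => e e0; have e2 : 0 < e / 2 by rewrite divr_gt0.
    have [N1 N1P] := small _ e2; have [N2 _ N2P] := sl' _ e2.
    pose n := maxn N1 N2.
    have h1 : rnorm (s n - l) < e / 2 by apply: N2P; exact: leq_maxr.
    have h2 : n.+1%:R^-1 < e / 2 by apply: N1P; exact: leq_maxl.
    apply: le_trans (rdist_triangle (s n) _ _) _.
    by move: h1 h2 (sP n).2; move: (n.+1%:R^-1) => p; lra.
  (* The limit [l] is only adherent to [S]; the lower bound [d] passes to [x - l - t] by replacing
     [l] with a nearby [s N]. *)
  have ldS t : S t -> d <= rnorm (x - l - t).
    move=> St; apply: ler_eps => e e0; have [N _ NP] := sl' _ e0.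
    have h1 : rnorm (s N - l) < e by apply: NP => /=.
    have /dS : S (1 *: s N + t) by apply: (SD) => //; exact: (sP N).1.
    rewrite scale1r => h; apply: (le_trans h).
    rewrite opprD addrA [x - s N](_ : _ = x - l + (l - s N)); last by rewrite addrA subrK.
    rewrite addrAC; apply: le_trans (rnormD _ _) _.
    by rewrite lerD2l rdistC ltW.
  have Re0 t : S t -> complex.Re (dot (x - l) t) = 0.
    move=> St.
    have Q (r : R) : 0 <= r ^+ 2 * rnorm t ^+ 2 - 2 * r * complex.Re (dot (x - l) t).
      have /ldS : S (r%:C *: t + 0) by exact: SD.
      rewrite addr0 -(@ler_pXn2r _ 2)// ?nnegrE ?rnorm_ge0// rnormB_sqr rnormZ exprMn.
      rewrite real_normK ?num_real// Re_dotZr.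
      have : rnorm (x - l) ^+ 2 <= d ^+ 2 by rewrite ler_pXn2r ?nnegrE ?rnorm_ge0.
      lra.
    move: Q; set T := rnorm t ^+ 2; set z := complex.Re _ => Q.
    have T0 : 0 <= T by rewrite sqr_ge0.
    (* The minimizer of the quadratic [Q] would be z / T; z / (T + 1) also makes it negative unless
       z = 0, and spares the case T = 0. *)
    have := Q (z / (T + 1)).
    have -> : (z / (T + 1)) ^+ 2 * T - 2 * (z / (T + 1)) * z = - (z ^+ 2 * (T + 2) / (T + 1) ^+ 2).
      by field; lra.
    rewrite oppr_ge0 pmulr_lle0 ?invr_gt0 ?exprn_gt0//; last lra.
    rewrite pmulr_lle0; last lra.
    by move=> h; apply/eqP; rewrite -sqrf_eq0 eq_le h sqr_ge0.
  move=> t St; rewrite hermC/= expr0 mul1r.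
  have := Re0 _ St; have : S ('i *: t + 0) by exact: SD.
  move=> /Re0; rewrite addr0 Re_doti.
  by case: (dot _ _) => a b /= -> ->; rewrite conjC0.
move=> e e0; have [N _ NP] := sl' _ e0.
exists (s N); first exact: (sP N).1.
by rewrite (subr0_eq g0) rdistC; apply: NP => /=.
Qed.

End projection.

(** * Hille-Yosida theorem for dissipative operators *)

Section hille_yosida.
Context (R : realType) (H : normedModType R[i]) (dot : {dot H for Num.conj}).
Hypothesis norm_dot : forall u : H, `|u| = dot_norm dot u.
Hypothesis H_complete : cauchy_complete H.
Variable L : operator H.
Hypothesis L_linear : linear_operator L.
Hypothesis L_dissipative : dissipative dot L.
Hypothesis L_dense : forall x (e : R), 0 < e ->
  exists2 s, dom L s & rnorm (x - s) < e.
Hypothesis L_range : forall (h : R) f, 0 < h ->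
  exists u, dom L u /\ u - h%:C *: L u = f.
Implicit Types (f g u v : H) (h k t s : R).

Let domZD (a : R[i]) f g : dom L f -> dom L g -> dom L (a *: f + g).
Proof. by case: L_linear => _ + _; exact. Qed.

Let LZD (a : R[i]) f g : dom L f -> dom L g -> L (a *: f + g) = a *: L f + L g.
Proof. by case: L_linear => _ _; exact. Qed.

Let dom0 : dom L 0. Proof. by case: L_linear. Qed.

Let L0 : L 0 = 0.
Proof.
have := LZD 1 dom0 dom0; rewrite !scale1r addr0 => /esym/eqP.
by rewrite -subr_eq0 addrK => /eqP.
Qed.

Let domB f g : dom L f -> dom L g -> dom L (f - g).
Proof. by move=> df dg; rewrite addrC -scaleN1r; exact: domZD. Qed.

Let LB f g : dom L f -> dom L g -> L (f - g) = L f - L g.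
Proof. by move=> df dg; rewrite addrC -scaleN1r LZD// scaleN1r addrC. Qed.

(** The cross term - 2 h Re <L u, u> of the squared norm is nonnegative. This estimate yields the
    injectivity of [1 - h L], the contractivity of its inverse and, later, the closedness of its
    range. *)
Lemma dissipative_le h u : 0 <= h -> dom L u ->
  rnorm u <= rnorm (u - h%:C *: L u).
Proof.
move=> h0 du; rewrite -(@ler_pXn2r _ 2)// ?nnegrE ?rnorm_ge0//.
rewrite (rnormB_sqr norm_dot) Re_dotZr (Re_dotC _ u) -addrA lerDl.
rewrite subr_ge0 (le_trans _ (sqr_ge0 _))// pmulr_rle0// mulr_ge0_le0//.
exact: L_dissipative.
Qed.

Lemma resolvent_inj h u v : 0 <= h -> dom L u -> dom L v ->
  u - h%:C *: L u = v - h%:C *: L v -> u = v.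
Proof.
move=> h0 du dv uv; apply/eqP; rewrite -subr_eq0; apply/eqP/rnorm0_eq0/le_anti.
rewrite rnorm_ge0 andbT -(@rnorm0 _ H).
apply: le_trans (dissipative_le h0 (domB du dv)) _.
have -> : u - v - h%:C *: L (u - v) = (u - h%:C *: L u) - (v - h%:C *: L v).
  by rewrite LB// scalerBr !opprB addrACA [RHS]addrACA [in RHS](addrC (- _)).
by rewrite uv subrr.
Qed.

(* (1 - h L)^-1, extended by the identity at h = 0 *)
Definition resolvent h f : H :=
  if pselect (0 < h) is left h0 then projT1 (cid (L_range f h0)) else f.

Local Notation J := resolvent.

Lemma resolvent_dom h f : 0 < h -> dom L (J h f).
Proof.
by move=> h0; rewrite /J; case: pselect => // h0'; case: cid => u [].
Qed.

Lemma resolventE h f : 0 < h -> J h f - h%:C *: L (J h f) = f.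
Proof.
by move=> h0; rewrite /J; case: pselect => // h0'; case: cid => u [].
Qed.

Lemma resolvent0 f : J 0 f = f.
Proof. by rewrite /J; case: pselect => // h0; exfalso; move: h0; rewrite ltxx. Qed.

Lemma resolventP h f u : 0 <= h -> dom L u -> u - h%:C *: L u = f -> u = J h f.
Proof.
rewrite le_eqVlt => /predU1P[<- _|h0 du uf]; first by rewrite scale0r subr0 resolvent0.
by apply: (@resolvent_inj h) => //; [exact: ltW|exact: resolvent_dom|rewrite resolventE].
Qed.

Lemma resolvent_domW h f : 0 <= h -> dom L f -> dom L (J h f).
Proof.
rewrite le_eqVlt => /predU1P[<-|h0 _]; [by rewrite resolvent0|exact: resolvent_dom].
Qed.

Lemma resolventZD h : 0 <= h -> forall (a : R[i]) f g,
  J h (a *: f + g) = a *: J h f + J h g.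
Proof.
rewrite le_eqVlt => /predU1P[<- a f g|h0 a f g]; first by rewrite !resolvent0.
have [df dg] := (resolvent_dom f h0, resolvent_dom g h0).
apply/esym/resolventP; [exact: ltW|exact: domZD|].
rewrite LZD// scalerDr opprD addrACA resolventE// scalerA mulrC -scalerA.
by rewrite -scalerBr resolventE.
Qed.

Lemma resolventB h f g : 0 <= h -> J h (f - g) = J h f - J h g.
Proof. by move=> h0; rewrite addrC -scaleN1r resolventZD// scaleN1r addrC. Qed.

Lemma resolvent_le h f : 0 <= h -> rnorm (J h f) <= rnorm f.
Proof.
rewrite le_eqVlt => /predU1P[<-|h0]; first by rewrite resolvent0.
rewrite -[in leRHS](resolventE f h0); apply: dissipative_le; first exact: ltW.
exact: resolvent_dom.
Qed.

Lemma resolvent_comm h f : 0 <= h -> dom L f -> L (J h f) = J h (L f).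
Proof.
rewrite le_eqVlt => /predU1P[<-|h0 df]; first by rewrite !resolvent0.
have h0' : h%:C != 0 :> R[i] by rewrite eq_complex /= gt_eqF.
apply: (scalerI h0').
have -> : h%:C *: L (J h f) = J h f - f by rewrite -[X in _ = _ - X](resolventE f h0) opprB addrC subrK.
have Jlin := resolventZD (ltW h0) (- h%:C) (L f) f.
have {Jlin} : J h (- h%:C *: L f + f) = f.
  by apply/esym/resolventP => //; [exact: ltW|rewrite scaleNr addrC].
rewrite resolventZD ?ltW// scaleNr => {2}<-.
by rewrite opprD opprK addrCA subrr addr0.
Qed.

Lemma resolvent_sub h f : 0 <= h -> dom L f -> J h f - f = h%:C *: J h (L f).
Proof.
rewrite le_eqVlt => /predU1P[<- _|h0 df].
  by rewrite !resolvent0 subrr scale0r.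
by rewrite -resolvent_comm ?ltW// -[X in _ - X](resolventE f h0) opprB addrC subrK.
Qed.

(** Since J_h commutes with [L] on the domain, J_h J_k f solves the equation that characterizes J_k
    J_h f. *)
Lemma resolvent_commute h k f : 0 <= h -> 0 <= k -> J h (J k f) = J k (J h f).
Proof.
move=> h0; rewrite le_eqVlt => /predU1P[<-|k0]; first by rewrite !resolvent0.
have dk := resolvent_dom f k0.
apply: resolventP; [exact: ltW|exact: resolvent_domW|].
rewrite resolvent_comm// addrC -scaleNr -resolventZD//; congr (J h _).
by rewrite scaleNr addrC resolventE.
Qed.

Lemma iter_resolventZD h n : 0 <= h -> forall (a : R[i]) f g,
  iter n (J h) (a *: f + g) = a *: iter n (J h) f + iter n (J h) g.
Proof.
by move=> h0 a f g; elim: n => //= n ->; exact: resolventZD.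
Qed.

Lemma iter_resolventB h n f g : 0 <= h ->
  iter n (J h) (f - g) = iter n (J h) f - iter n (J h) g.
Proof. by move=> h0; elim: n => //= n ->; exact: resolventB. Qed.

Lemma iter_resolvent_le h n f : 0 <= h -> rnorm (iter n (J h) f) <= rnorm f.
Proof.
by move=> h0; elim: n => //= n; apply: le_trans; exact: resolvent_le.
Qed.

(** Each step displaces by at most [h * rnorm (L f)], because J_h f - f = h J_h L f. *)
Lemma iter_resolvent_near h n f : 0 <= h -> dom L f ->
  rnorm (iter n (J h) f - f) <= n%:R * h * rnorm (L f).
Proof.
move=> h0 df; elim: n => [|n IH]; first by rewrite subrr rnorm0 !mul0r.
rewrite iterSr; apply: le_trans (rdist_triangle (iter n (J h) f) _ _) _.
rewrite -natr1 !mulrDl mul1r addrC lerD//.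
rewrite -iter_resolventB// resolvent_sub//.
apply: le_trans (iter_resolvent_le _ _ h0) _.
by rewrite rnormZ ger0_norm// ler_wpM2l// resolvent_le.
Qed.

(** [g] stands for an element of the domain close to [L f]. With [g = L f], when that lies in the
    domain, the remainder is of second order in n h; for a general [f] in the domain, density makes
    it o(n h), which is what differentiability at 0 asks. *)
Lemma iter_resolvent_taylor h n f g : 0 <= h -> dom L f -> dom L g ->
  rnorm (iter n (J h) f - f - (n%:R * h)%:C *: L f) <=
    n%:R * h * (2 * rnorm (L f - g) + n%:R * h * rnorm (L g)).
Proof.
move=> h0 df dg; elim: n => [|n IH].
  by rewrite subrr !mul0r scale0r subr0 rnorm0.
(* One more step adds h J^(n+1) L f to J^n f. This is [h L f] up to [h] times the displacement of
   [L f] under J^(n+1), which is then estimated through [g]. *)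
have -> : iter n.+1 (J h) f - f - (n.+1%:R * h)%:C *: L f =
    h%:C *: (iter n.+1 (J h) (L f) - L f) +
    (iter n (J h) f - f - (n%:R * h)%:C *: L f).
  have -> : iter n.+1 (J h) f = iter n (J h) f + h%:C *: iter n.+1 (J h) (L f).
    rewrite 2!iterSr -{1}(subrK f (J h f)) resolvent_sub// iter_resolventZD//.
    by rewrite addrC.
  rewrite -natr1 mulrDl mul1r rmorphD/= scalerDl scalerBr.
  by rewrite opprD !addrA [RHS](ACl (3*1*4*5*2)).
apply: le_trans (rnormD _ _) _; rewrite rnormZ ger0_norm//.
have IL : rnorm (iter n.+1 (J h) (L f) - L f) <= 2 * rnorm (L f - g) + n.+1%:R * h * rnorm (L g).
  apply: le_trans (rdist_triangle (iter n.+1 (J h) g) _ _) _.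
  rewrite mulr2n mulrDl mul1r -addrA lerD//.
    by rewrite -iter_resolventB// iter_resolvent_le.
  apply: le_trans (rdist_triangle g _ _) _; rewrite [leLHS]addrC (rdistC g) lerD//.
  exact: iter_resolvent_near.
move: IL IH (rnorm_ge0 (L f - g)) (rnorm_ge0 (L g)).
move: (rnorm (L f - g)) (rnorm (L g)) (rnorm (iter n.+1 _ _ - _)) (rnorm (iter n _ _ - _ - _)) => a b c d.
have -> : n.+1%:R = n%:R + 1 :> R by rewrite natr1.
move: (ler0n R n); move: (n%:R) => m m0 ca da a0 b0.
have hh : 0 <= h * h by rewrite mulr_ge0.
have : h * c <= h * (2 * a + (m + 1) * h * b) by rewrite ler_wpM2l.
have mb : 0 <= m * (h * h * b) by rewrite mulr_ge0// mulr_ge0.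
lra.
Qed.

(** Telescoping: one [A] is exchanged for [B] next to [f], at the cost of [rnorm (A f - B f)];
    commutation brings this [B] outside, where it can be discarded as a contraction, and induction
    applies. *)
Lemma iter_contraction_dist (A B : H -> H) n f :
  (forall u v, rnorm (A u - A v) <= rnorm (u - v)) ->
  (forall u v, rnorm (B u - B v) <= rnorm (u - v)) ->
  (forall u, A (B u) = B (A u)) ->
  rnorm (iter n A f - iter n B f) <= n%:R * rnorm (A f - B f).
Proof.
move=> cA cB AB; elim: n => [|n IH]; first by rewrite subrr rnorm0 mul0r.
have cAn u v : rnorm (iter n A u - iter n A v) <= rnorm (u - v).
  by elim: n {IH} => //= n; exact: le_trans.
have ABn u : iter n A (B u) = B (iter n A u).
  by elim: n {IH cAn} => //= n ->; rewrite AB.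
rewrite iterSr; apply: le_trans (rdist_triangle (iter n A (B f)) _ _) _.
rewrite -natr1 mulrDl mul1r addrC lerD//.
by rewrite ABn iterS; apply: le_trans IH.
Qed.

(** * Convergence of the implicit Euler scheme *)

Let dom2 f := dom L f /\ dom L (L f).

(** Resolvents regularize: for [g] in the domain, L J_h g = J_h L g lies in the domain again, and
    J_h g tends to [g] as [h] decreases to 0. *)
Lemma dom2_dense f (e : R) : 0 < e -> exists2 g, dom2 g & rnorm (f - g) < e.
Proof.
move=> e0; have e2 : 0 < e / 2 by rewrite divr_gt0.
have [g dg fg] := L_dense f e2.
have b0 : 0 < rnorm (L g) + 1 by rewrite ltr_wpDl ?rnorm_ge0.
pose h := e / 2 / (rnorm (L g) + 1).
have h0 : 0 < h by rewrite divr_gt0.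
exists (J h g).
  split; first exact: resolvent_dom.
  by rewrite resolvent_comm ?ltW//; exact: resolvent_dom.
apply: le_lt_trans (rdist_triangle g _ _) _.
rewrite [ltRHS]splitr ltr_leD// rdistC.
have := @iter_resolvent_near h 1 g (ltW h0) dg; rewrite mul1r => /le_trans; apply.
apply: (@le_trans _ _ (h * (rnorm (L g) + 1))); last by rewrite /h divfK ?gt_eqF.
by rewrite ler_wpM2l ?lerDl// ltW.
Qed.

(* Implicit Euler approximation of the semigroup with [N.+1] steps *)
Definition euler t N f := iter N.+1 (J (t / N.+1%:R)) f.

Let step_ge0 t N : 0 <= t -> 0 <= t / N.+1%:R.
Proof. by move=> t0; rewrite divr_ge0. Qed.

Let stepE t N : N.+1%:R * (t / N.+1%:R) = t.
Proof. by rewrite mulrC divfK// pnatr_eq0. Qed.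

Lemma eulerZD t N (a : R[i]) f g : 0 <= t ->
  euler t N (a *: f + g) = a *: euler t N f + euler t N g.
Proof. by move=> t0; apply: iter_resolventZD; exact: step_ge0. Qed.

Lemma euler_le t N f : 0 <= t -> rnorm (euler t N f) <= rnorm f.
Proof. by move=> t0; apply: iter_resolvent_le; exact: step_ge0. Qed.

Lemma euler_dist t N f g : 0 <= t -> rnorm (euler t N f - euler t N g) <= rnorm (f - g).
Proof.
by move=> t0; rewrite -iter_resolventB ?step_ge0//; exact: euler_le.
Qed.

Lemma euler_taylor t N f g : 0 <= t -> dom L f -> dom L g ->
  rnorm (euler t N f - f - t%:C *: L f) <=
    t * (2 * rnorm (L f - g) + t * rnorm (L g)).
Proof.
by move=> t0 df dg; have := iter_resolvent_taylor N.+1 (step_ge0 N t0) df dg; rewrite stepE.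
Qed.

(** A coarse step of length h and the [M.+1] fine steps that replace it both agree with [f + h L f]
    up to h^2 |L^2 f|; the [N.+1] errors of 2 h^2 |L^2 f| add up to the bound. The predecessor
    occurs because [euler] is indexed by the number of steps minus one. *)
Lemma euler_refine t N M f : 0 <= t -> dom2 f ->
  rnorm (euler t N f - euler t (N.+1 * M.+1).-1 f) <= 2 * t ^+ 2 * rnorm (L (L f)) / N.+1%:R.
Proof.
move=> t0 [df dLf]; rewrite /euler prednK ?muln_gt0//.
set h := t / N.+1%:R; have h0 : 0 <= h by exact: step_ge0.
pose k := h / M.+1%:R; have k0 : 0 <= k by exact: step_ge0.
rewrite natrM invfM mulrA -/h -/k.
have -> : iter (N.+1 * M.+1) (J k) f = iter N.+1 (iter M.+1 (J k)) f.
  by elim: (N.+1) => // n IH; rewrite mulSn iterD IH iterS.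
apply: le_trans (@iter_contraction_dist _ _ _ _ _ _ _) _.
- by move=> u v; rewrite -resolventB//; exact: resolvent_le.
- by move=> u v; rewrite -iter_resolventB//; exact: iter_resolvent_le.
- move=> u; elim: M.+1 => // m IH; rewrite !iterS resolvent_commute//.
  by rewrite IH.
have A1 := @iter_resolvent_taylor h 1 f (L f) h0 df dLf.
have A2 := @iter_resolvent_taylor k M.+1 f (L f) k0 df dLf.
move: A1 A2; rewrite /k stepE mul1r subrr rnorm0 mulr0 add0r /= => A1 A2.
have : rnorm (J h f - iter M.+1 (J k) f) <= 2 * h * (h * rnorm (L (L f))).
  apply: le_trans (rdist_triangle (f + h%:C *: L f) _ _) _.
  rewrite -mulrA mulr2n mulrDl mul1r lerD//; first by rewrite opprD addrA.
  by rewrite rdistC opprD addrA.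
move=> /(ler_wpM2l (ler0n R N.+1)) /le_trans; apply.
have -> : 2 * t ^+ 2 * rnorm (L (L f)) / N.+1%:R = N.+1%:R * (2 * h * (h * rnorm (L (L f)))).
  by rewrite /h; field; rewrite lt0r_neq0// ltr0Sn.
by [].
Qed.

Lemma euler_cvg t f : 0 <= t -> exists l : H, euler t N f @[N --> \oo] --> l.
Proof.
move=> t0; apply: H_complete => e e0.
have e4 : 0 < e / 4 by rewrite divr_gt0.
have [g dg fg] := dom2_dense f e4.
pose c := 2 * t ^+ 2 * rnorm (L (L g)).
have c0 : 0 <= c by rewrite !mulr_ge0// ?sqr_ge0// rnorm_ge0.
have c1 : 0 < c + 1 by rewrite ltr_wpDl.
have [N0 _ N0P] := near_infty_natSinv_lt (PosNum (divr_gt0 e4 c1)).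
exists N0 => m n /N0P /= mN /N0P /= nN.
(* Neither grid need refine the other, so both are compared with their common refinement. *)
have mn : rnorm (euler t m g - euler t n g) <= c / m.+1%:R + c / n.+1%:R.
  apply: le_trans (rdist_triangle (euler t (m.+1 * n.+1).-1 g) _ _) _.
  rewrite lerD//; first exact: euler_refine.
  by rewrite rdistC mulnC; exact: euler_refine.
have cs (k : nat) : k.+1%:R^-1 < e / 4 / (c + 1) -> c / k.+1%:R <= e / 4.
  move=> h; apply: (@le_trans _ _ ((c + 1) / k.+1%:R)).
    by rewrite ler_wpM2r ?lerDl.
  by rewrite mulrC -ler_pdivlMr// ltW.
apply: le_lt_trans (rdist_triangle (euler t m g) _ _) _.
apply: le_lt_trans (lerD (euler_dist _ _ _ t0) (rdist_triangle (euler t n g) _ _)) _.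
apply: (@le_lt_trans _ _ (rnorm (f - g) + (e / 4 + e / 4 + rnorm (g - f)))).
  rewrite lerD2l lerD//; last exact: euler_dist.
  by apply: le_trans mn _; rewrite lerD ?cs.
rewrite (rdistC g); lra.
Qed.

(** * The limit semigroup and its generator *)

Definition semigroup t f : H :=
  if pselect (0 <= t) is left t0 then projT1 (cid (euler_cvg f t0)) else f.

Local Notation P := semigroup.

Lemma semigroupP t f : 0 <= t -> euler t N f @[N --> \oo] --> P t f.
Proof. by move=> t0; rewrite /P; case: pselect => // t0'; case: cid. Qed.

Lemma semigroup_unique t f l : 0 <= t -> euler t N f @[N --> \oo] --> l -> P t f = l.
Proof.
move=> t0 /rnorm_cvgP fl; have /rnorm_cvgP fP := semigroupP (f := f) t0.
apply/eqP; rewrite -subr_eq0; apply/eqP/rnorm0_eq0/le_anti.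
rewrite rnorm_ge0 andbT; apply: ler_eps => e e0; rewrite add0r.
have e2 : 0 < e / 2 by rewrite divr_gt0.
have [N [/= h1 h2]] := filter_ex (filterI (fl _ e2) (fP _ e2)).
apply: le_trans (rdist_triangle (euler t N f) _ _) _.
rewrite rdistC; lra.
Qed.

Lemma semigroupZD t (a : R[i]) f g : 0 <= t ->
  P t (a *: f + g) = a *: P t f + P t g.
Proof.
move=> t0; apply: semigroup_unique => //.
under eq_fun do rewrite eulerZD//.
by apply: cvgD; [apply: cvgZr|]; exact: semigroupP.
Qed.

Lemma semigroupB t f g : 0 <= t -> P t (f - g) = P t f - P t g.
Proof. by move=> t0; rewrite addrC -scaleN1r semigroupZD// scaleN1r addrC. Qed.

Lemma semigroup_le t f : 0 <= t -> rnorm (P t f) <= rnorm f.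
Proof.
move=> t0; rewrite -[P t f]subr0; apply: rnorm_cvg_le (semigroupP t0) _ => N.
by rewrite subr0 euler_le.
Qed.

Lemma semigroup_dist t f g : 0 <= t -> rnorm (P t f - P t g) <= rnorm (f - g).
Proof. by move=> t0; rewrite -semigroupB//; exact: semigroup_le. Qed.

Lemma semigroup_taylor t f g : 0 <= t -> dom L f -> dom L g ->
  rnorm (P t f - f - t%:C *: L f) <= t * (2 * rnorm (L f - g) + t * rnorm (L g)).
Proof.
move=> t0 df dg; rewrite -addrA -opprD; apply: rnorm_cvg_le (semigroupP t0) _ => N.
by rewrite opprD addrA; exact: euler_taylor.
Qed.

Lemma semigroup_near t f : 0 <= t -> dom L f -> rnorm (P t f - f) <= t * rnorm (L f).
Proof.
move=> t0 df; apply: rnorm_cvg_le (semigroupP t0) _ => N.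
by have := iter_resolvent_near N.+1 (step_ge0 N t0) df; rewrite stepE.
Qed.

Lemma semigroup0 f : P 0 f = f.
Proof.
apply: semigroup_unique => //; rewrite /euler; under eq_fun do rewrite mul0r.
have -> : (fun N => iter N.+1 (J 0) f) = fun=> f.
  by apply/funext => N; elim: N.+1 => //= n ->; rewrite resolvent0.
exact: cvg_cst.
Qed.

(** By commutation the product of the two schemes is the (N+1)-st power of J_a J_b, with a and b the
    step lengths, to be compared with that of J_(a+b). Against [f + (a + b) L f] the former errs by
    (a^2 + b^2 + a b) |L^2 f| and the latter by (a + b)^2 |L^2 f|, whence the coefficients 2 and
    3. *)
Let prod_step s t N f : 0 <= s -> 0 <= t -> dom2 f ->
  rnorm (euler s N (euler t N f) - euler (s + t) N f) <=
    (2 * (s ^+ 2 + t ^+ 2) + 3 * (s * t)) * rnorm (L (L f)) / N.+1%:R.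
Proof.
move=> s0 t0 [df dLf]; rewrite /euler.
set a := s / _; set b := t / _; have a0 : 0 <= a by exact: step_ge0.
have b0 : 0 <= b by exact: step_ge0.
have -> : (s + t) / N.+1%:R = a + b by rewrite mulrDl.
have ab0 : 0 <= a + b by rewrite addr_ge0.
have -> : iter N.+1 (J a) (iter N.+1 (J b) f) = iter N.+1 (J a \o J b) f.
  elim: N.+1 => //= n <-; congr (J a _).
  elim: n (iter n (J b) f) => //= n IH u.
  by rewrite IH resolvent_commute.
apply: le_trans (@iter_contraction_dist _ _ _ _ _ _ _) _.
- move=> u v /=; rewrite -resolventB//; apply: le_trans (resolvent_le _ a0) _.
  by rewrite -resolventB//; exact: resolvent_le.
- by move=> u v; rewrite -resolventB//; exact: resolvent_le.
- by move=> u /=; rewrite [J b (J _ _)]resolvent_commute// [LHS]resolvent_commute.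
have A1 := @iter_resolvent_taylor a 1 f (L f) a0 df dLf.
have A2 := @iter_resolvent_taylor b 1 f (L f) b0 df dLf.
have A3 := @iter_resolvent_taylor (a + b) 1 f (L f) ab0 df dLf.
have A4 := @iter_resolvent_near a 1 (L f) a0 dLf.
move: A1 A2 A3 A4; rewrite !mul1r subrr rnorm0 mulr0 !add0r /= => A1 A2 A3 A4.
have B : rnorm (J a (J b f) - f - (a + b)%:C *: L f) <=
    (b ^+ 2 + a ^+ 2 + a * b) * rnorm (L (L f)).
  have -> : J a (J b f) - f - (a + b)%:C *: L f = J a (J b f - f - b%:C *: L f) +
      (J a f - f - a%:C *: L f) + b%:C *: (J a (L f) - L f).
    rewrite -[J b f - f - _]addrA -opprD resolventB// [f + _]addrC resolventZD//.
    rewrite scalerBr rmorphD scalerDl/=.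
    by rewrite !opprD !addrA [RHS](ACl (1*5*6*8*(2*7)*(3*4)))/= !addNr !addr0.
  apply: le_trans (rnormD _ _) _; rewrite mulrDl; apply: lerD.
    apply: le_trans (rnormD _ _) _; rewrite mulrDl; apply: lerD.
      by apply: le_trans (resolvent_le _ a0) _; rewrite expr2 -mulrA.
    by rewrite expr2 -mulrA.
  have -> : a * b * rnorm (L (L f)) = b * (a * rnorm (L (L f))) by ring.
  by rewrite rnormZ ger0_norm// ler_wpM2l.
have : rnorm (J a (J b f) - J (a + b) f) <=
    (b ^+ 2 + a ^+ 2 + a * b) * rnorm (L (L f)) + (a + b) * ((a + b) * rnorm (L (L f))).
  apply: le_trans (rdist_triangle (f + (a + b)%:C *: L f) _ _) _.
  by rewrite opprD addrA lerD// rdistC opprD addrA.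
move=> /(ler_wpM2l (ler0n R N.+1)) /le_trans; apply.
rewrite le_eqVlt; apply/orP; left; apply/eqP.
by rewrite /a /b; field; rewrite lt0r_neq0// ltr0Sn.
Qed.

Lemma semigroup_add s t f : 0 <= s -> 0 <= t -> P (s + t) f = P s (P t f).
Proof.
move=> s0 t0; apply/eqP; rewrite -subr_eq0; apply/eqP/rnorm0_eq0/le_anti.
rewrite rnorm_ge0 andbT; apply: ler_eps => e e0; rewrite add0r.
have e8 : 0 < e / 8 by rewrite divr_gt0.
have st0 : 0 <= s + t by rewrite addr_ge0.
have [g dg fg] := dom2_dense f e8.
pose c := (2 * (s ^+ 2 + t ^+ 2) + 3 * (s * t)) * rnorm (L (L g)).
have c0 : 0 <= c.
  by rewrite mulr_ge0 ?rnorm_ge0// addr_ge0// mulr_ge0// ?addr_ge0 ?sqr_ge0// mulr_ge0.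
have c1 : 0 < c + 1 by rewrite ltr_wpDl.
have sm := near_infty_natSinv_lt (PosNum (divr_gt0 e8 c1)).
have /rnorm_cvgP/(_ _ e8) A1 := semigroupP (f := g) st0.
have /rnorm_cvgP/(_ _ e8) A2 := semigroupP (f := g) t0.
have /rnorm_cvgP/(_ _ e8) A3 := semigroupP (f := P t g) s0.
have [N [[/= h1 h2] [h3 h4]]] := filter_ex (filterI (filterI A1 A2) (filterI A3 sm)).
have h5 : rnorm (euler s N (euler t N g) - euler (s + t) N g) <= e / 8.
  apply: le_trans (prod_step _ s0 t0 dg) _; rewrite -/c.
  apply: (@le_trans _ _ ((c + 1) / N.+1%:R)).
    by rewrite ler_wpM2r ?lerDl.
  by rewrite mulrC -ler_pdivlMr// ltW.
have h6 : rnorm (P (s + t) g - P s (P t g)) <= e / 2.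
  apply: le_trans (rdist_triangle (euler (s + t) N g) _ _) _.
  apply: le_trans (lerD (lexx _) (rdist_triangle (euler s N (euler t N g)) _ _)) _.
  apply: le_trans (lerD (lexx _) (lerD (lexx _) (rdist_triangle (euler s N (P t g)) _ _))) _.
  have := euler_dist N (euler t N g) (P t g) s0.
  rewrite (rdistC (P (s + t) g)) (rdistC (euler (s + t) N g) (euler s N _)); lra.
apply: le_trans (rdist_triangle (P (s + t) g) _ _) _.
apply: le_trans (lerD (lexx _) (rdist_triangle (P s (P t g)) _ _)) _.
have := semigroup_dist f g st0.
have : rnorm (P s (P t g) - P s (P t f)) <= rnorm (f - g).
  by apply: le_trans (semigroup_dist _ _ s0) _; rewrite (rdistC f) semigroup_dist.
lra.
Qed.

Lemma semigroup_cvg0 f (e : R) : 0 < e ->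
  exists2 d : R, 0 < d & forall t, 0 <= t < d -> rnorm (P t f - f) < e.
Proof.
move=> e0; have e3 : 0 < e / 3 by rewrite divr_gt0.
have [g dg fg] := L_dense f e3.
have c1 : 0 < rnorm (L g) + 1 by rewrite ltr_wpDl ?rnorm_ge0.
exists (e / 3 / (rnorm (L g) + 1)); first by rewrite divr_gt0.
move=> t /andP[t0]; rewrite ltr_pdivlMr// => te.
apply: le_lt_trans (rdist_triangle (P t g) _ _) _.
apply: le_lt_trans (lerD (lexx _) (rdist_triangle g _ _)) _.
have := semigroup_dist f g t0; have := semigroup_near t0 dg; rewrite (rdistC g f).
lra.
Qed.

(** Reduces continuity of an orbit at any time, from either side, to continuity at 0. *)
Lemma semigroup_equicontinuous f s t : 0 <= s -> 0 <= t ->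
  rnorm (P s f - P t f) <= rnorm (P `|s - t| f - f).
Proof.
wlog st : s t / s <= t => [hw|] s0 t0.
  by have [/hw|/ltW/hw] := leP s t; [exact|rewrite rdistC distrC; exact].
have ts : 0 <= t - s by rewrite subr_ge0.
rewrite distrC ger0_norm// rdistC.
have -> : P t f = P s (P (t - s) f) by rewrite -semigroup_add// addrC subrK.
exact: semigroup_dist.
Qed.

Lemma semigroup_contraction : contraction_semigroup P.
Proof.
split=> [t t0 a f g|t f t0|f|s t f|f].
- exact: semigroupZD.
- by rewrite !normE lecR semigroup_le.
- exact: semigroup0.
- exact: semigroup_add.
apply/subspace_continuousP => t; rewrite /= in_itv/= andbT => t0.
apply/rnorm_cvgP => e e0.
have [d d0 dP] := semigroup_cvg0 f e0.
rewrite near_withinE; near=> s => /=; rewrite in_itv/= andbT => s0.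
apply: le_lt_trans (semigroup_equicontinuous _ s0 t0) _.
apply: dP; rewrite normr_ge0/= distrC.
by near: s; apply: (@cvgr_dist_lt _ _ _ _ _ id t) => //; exact: cvg_id.
Unshelve. all: by end_near. Qed.

Lemma semigroup_derivative f : dom L f ->
  (fun t : R => (t^-1)%:C *: (P t f - f)) @ 0^'+ --> L f.
Proof.
move=> df; apply/rnorm_cvgP => e e0; have e4 : 0 < e / 4 by rewrite divr_gt0.
have [g dg fg] := L_dense (L f) e4.
have c1 : 0 < rnorm (L g) + 1 by rewrite ltr_wpDl ?rnorm_ge0.
near=> t.
have t0 : 0 < t by near: t; exact: nbhs_right_gt.
have td : t < e / 4 / (rnorm (L g) + 1).
  by near: t; apply: nbhs_right_lt; rewrite divr_gt0.
have -> : (t^-1)%:C *: (P t f - f) - L f = (t^-1)%:C *: (P t f - f - t%:C *: L f).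
  by rewrite [in RHS]scalerBr scalerA -rmorphM/= mulVf ?gt_eqF// scale1r.
rewrite rnormZ ger0_norm ?invr_ge0 ?(ltW t0)//.
have := semigroup_taylor (ltW t0) df dg.
rewrite -(@ler_pM2l _ t^-1) ?invr_gt0// mulrA mulVf ?gt_eqF// mul1r => /le_lt_trans; apply.
move: td; rewrite ltr_pdivlMr// => td; lra.
Unshelve. all: by end_near. Qed.

(** The generator of [P] extends [L] by [semigroup_derivative]. It cannot be larger: contractivity
    makes 1 minus the generator injective, whereas [1 - L] is already onto. *)
Lemma semigroup_generates : generates L P.
Proof.
split; first exact: semigroup_contraction.
move=> f g; split=> [[df <-]|fg]; first exact: semigroup_derivative.
(* (1 + 1/t) u - P_t u / t equals u - v minus the difference of the quotient and its limit [v]; its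
   norm is at least that of [u] because P_t is a contraction. *)
have gP (u v : H) : (fun t : R => (t^-1)%:C *: (P t u - u)) @ 0^'+ --> v ->
    rnorm u <= rnorm (u - v).
  move=> /rnorm_cvgP uv; apply: ler_eps => e e0.
  have [t [/= t0 tv]] := filter_ex (filterI (nbhs_right_gt (0 : R)) (uv _ e0)).
  have tp : 0 < 1 + t^-1 by rewrite addr_gt0// invr_gt0.
  have : rnorm ((1 + t^-1)%:C *: u - (t^-1)%:C *: P t u) <= rnorm (u - v) + e.
    have -> : (1 + t^-1)%:C *: u - (t^-1)%:C *: P t u =
        (u - v) - ((t^-1)%:C *: (P t u - u) - v).
      rewrite rmorphD/= scalerDl scale1r scalerBr opprB addrA subrK.
      by rewrite opprB addrA.
    by apply: le_trans (rnormB _ _) _; rewrite lerD2l ltW.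
  have : (1 + t^-1) * rnorm u - t^-1 * rnorm u <=
      rnorm ((1 + t^-1)%:C *: u - (t^-1)%:C *: P t u).
    have -> : (1 + t^-1) * rnorm u = rnorm ((1 + t^-1)%:C *: u).
      by rewrite rnormZ ger0_norm// ltW.
    rewrite lerBlDr.
    apply: le_trans (_ : _ <= rnorm ((1 + t^-1)%:C *: u - (t^-1)%:C *: P t u + (t^-1)%:C *: P t u)) _.
      by rewrite subrK.
    apply: le_trans (rnormD _ _) _; rewrite lerD2l rnormZ ger0_norm ?invr_ge0 ?(ltW t0)//.
    by rewrite ler_wpM2l ?invr_ge0 ?(ltW t0)// semigroup_le// ltW.
  by rewrite mulrDl mul1r addrK => /le_trans; exact.
(* As [u - L u = f - g], the orbit of [f - u] has derivative [g - L u = f - u] at 0, and [gP] bounds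
   the norm of [f - u] by 0. *)
have [u [du uE]] := L_range (f - g) ltr01.
have fu : f = u.
  apply/eqP; rewrite -subr_eq0; apply/eqP/rnorm0_eq0/le_anti; rewrite rnorm_ge0 andbT.
  have : (fun t : R => (t^-1)%:C *: (P t (f - u) - (f - u))) @ 0^'+ --> g - L u.
    have h : (fun t : R => (t^-1)%:C *: (P t f - f) - (t^-1)%:C *: (P t u - u))
        @ 0^'+ --> g - L u by apply: cvgB => //; exact: semigroup_derivative.
    apply: cvg_trans h; apply: near_eq_cvg; near=> t.
    rewrite semigroupB; first by rewrite -scalerBr !opprB addrACA [in RHS]addrACA [- f - _]addrC.
    by apply: ltW; near: t; exact: nbhs_right_gt.
  move=> /gP; have -> : f - u - (g - L u) = 0.
    have -> : f - u - (g - L u) = (f - g) - (u - L u).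
      by rewrite !opprD !opprK !addrA [LHS](ACl (1*3*2*4)).
    by rewrite -uE scale1r subrr.
  by rewrite rnorm0.
rewrite fu; split=> //.
have : f - g = u - L u by rewrite -uE scale1r.
by rewrite fu => /addrI/oppr_inj.
Unshelve. all: by end_near. Qed.

End hille_yosida.

(** * Adjoint of the semigroup *)

Section adjoint_semigroup.
Context (R : realType) (H : normedModType R[i]) (dot : {dot H for Num.conj}).
Hypothesis norm_dot : forall u : H, `|u| = dot_norm dot u.
Hypothesis H_complete : cauchy_complete H.
Variables (L : operator H) (F : H -> H).
Hypothesis L_linear : linear_operator L.
Hypothesis L_dissipative : dissipative dot L.
Hypothesis F_sym : forall u v, dot (F u) v = dot u (F v).
Hypothesis FK : involutive F.
Hypothesis L_nondegenerate : forall g, (forall f, dom L f -> dot f g = 0) -> g = 0.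
Hypothesis L_adjoint : forall g h, (dom L (F g) /\ F (L (F g)) = h) <->
  (forall f, dom L f -> dot (L f) g = dot f h).
Implicit Types (f g u v : H).

Let domZD (a : R[i]) f g : dom L f -> dom L g -> dom L (a *: f + g).
Proof. by case: L_linear => _ + _; exact. Qed.

Let LZD (a : R[i]) f g : dom L f -> dom L g -> L (a *: f + g) = a *: L f + L g.
Proof. by case: L_linear => _ _; exact. Qed.

Let dom0 : dom L 0. Proof. by case: L_linear. Qed.

Let dot_flip u v u' v' : dot u v = dot u' v' -> dot v u = dot v' u'.
Proof.
by rewrite hermC/= expr0 mul1r [RHS]hermC/= expr0 mul1r => /(congr1 Num.conj); rewrite !conjCK.
Qed.

(** By [L_adjoint] and the symmetry of [F], the graph is cut out by the conditions <p.1, F L f> =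
    <p.2, F f> for [f] in the domain, each of which passes to limits. *)
Lemma graph_closed : closed [set p : H * H | dom L p.1 /\ L p.1 = p.2].
Proof.
have graphE (p : H * H) : (dom L p.1 /\ L p.1 = p.2) <->
    (forall f, dom L f -> dot p.1 (F (L f)) = dot p.2 (F f)).
  have := L_adjoint (F p.1) (F p.2); rewrite FK => -[h1 h2]; split.
    move=> [dp Lp] f df; apply: dot_flip; rewrite F_sym [RHS]F_sym.
    exact: h1 (conj dp (congr1 F Lp)) f df.
  move=> h; have [|dp /(congr1 F)] := h2; last by rewrite !FK.
  by move=> f /h/dot_flip; rewrite !F_sym.
move=> p clp; apply/graphE => f df.
pose S := [set p : H * H | dom L p.1 /\ L p.1 = p.2].
(* Limits are taken along the trace on the graph of the neighbourhoods of [p], a proper filter since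
   [p] is adherent to the graph. *)
have FF : ProperFilter (within S (nbhs p)).
  by apply: Build_ProperFilter_ex => B /clp[q [Sq]]; exists q; exact: (b Sq).
apply: (normc_cvg_unique FF (dot_cvgl norm_dot FF (f := fst) _ _)
                             (dot_cvgl norm_dot FF (f := snd) _ _)).
- by apply: cvg_trans; [apply: cvg_app; exact: cvg_within|exact: cvg_fst].
- by apply: cvg_trans; [apply: cvg_app; exact: cvg_within|exact: cvg_snd].
- by apply: filterS (withinT _ _) => q /graphE; exact.
Qed.

Lemma L_dense : forall x (e : R), 0 < e -> exists2 s, dom L s & rnorm (x - s) < e.
Proof. exact: (dense_orthogonal norm_dot H_complete dom0 domZD). Qed.

Lemma dense_dom : dense (dom L).
Proof.
move=> O [x Ox] Oo.
have /nbhs_ballP[e /= e0 eO] : nbhs x O by exact: open_nbhs_nbhs.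
move: e0 eO; case: e => e b; rewrite ltcE /= => /andP[/eqP -> e0] eO.
have [s ds xs] := L_dense x e0; exists s; split=> //.
by apply: eO; rewrite -ball_normE /= normE ltcR.
Qed.

(** Orthogonality only gives a dense range. To solve the equation exactly, take [s n] whose images
    tend to [f]: since [1 - h L] does not decrease norms, [s] is Cauchy; then [L (s n)], a
    combination of [s n] and its image, converges as well, and the closed graph puts the limit in
    the domain. *)
Lemma L_range (h : R) f : 0 < h -> exists u, dom L u /\ u - h%:C *: L u = f.
Proof.
move=> h0; pose S := [set v | exists u, dom L u /\ u - h%:C *: L u = v].
have SZD (a : R[i]) u v : S u -> S v -> S (a *: u + v).
  move=> [u' [du <-]] [v' [dv <-]]; exists (a *: u' + v'); split; first exact: domZD.
  rewrite LZD// scalerDr opprD addrACA; congr (_ + _).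
  by rewrite scalerBr !scalerA mulrC.
have L0 : L 0 = 0.
  have := LZD 1 dom0 dom0; rewrite !scale1r addr0 => /esym/eqP.
  by rewrite -subr_eq0 addrK => /eqP.
have S0 : S 0 by exists 0; rewrite L0 scaler0 subr0.
have Sort g : (forall v, S v -> dot v g = 0) -> g = 0.
  move=> Sg.
  have hC : h%:C != 0 :> R[i] by rewrite eq_complex /= gt_eqF.
  have : forall f, dom L f -> dot (L f) g = dot f ((h^-1)%:C *: g).
    move=> u du; have := Sg _ (ex_intro _ u (conj du erefl)).
    rewrite linearBl/= linearZl_LR/= => /eqP; rewrite subr_eq0 => /eqP ug.
    rewrite dotZr_real ug.
    by rewrite mulrA -rmorphM/= mulVf ?gt_eqF// mul1r.
  move=> /L_adjoint[dFg /(congr1 F)]; rewrite FK => LFg.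
  (* The eigenvalue equation is L F g = F g / h, so dissipativity at [F g] reads |g|^2 / h <= 0. *)
  have := L_dissipative dFg; rewrite LFg F_sym FK linearZl_LR/= (dot_rnorm norm_dot).
  rewrite /= mul0r subr0 pmulr_rle0 ?invr_gt0// => g0.
  apply/rnorm0_eq0/eqP; rewrite -(@sqrf_eq0 R) eq_le g0 sqr_ge0//.
have Sdense := dense_orthogonal norm_dot H_complete S0 SZD Sort.
have /choice[s sP] : forall n, exists u, dom L u /\
    rnorm (f - (u - h%:C *: L u)) < n.+1%:R^-1.
  move=> n; have n0 : 0 < n.+1%:R^-1 :> R by rewrite invr_gt0.
  by have [_ [u [du <-]] fu] := Sdense f _ n0; exists u.
have small (e : R) : 0 < e -> exists N, forall n, (N <= n)%N -> n.+1%:R^-1 < e.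
  move=> e0; have [N _ NP] := near_infty_natSinv_lt (PosNum e0).
  by exists N => n /NP.
have sf : (fun n => s n - h%:C *: L (s n)) @ \oo --> f.
  apply/rnorm_cvgP => e /small[N NP]; exists N => // n /= /NP; apply: lt_trans.
  by rewrite rdistC; exact: (sP n).2.
have domB u v : dom L u -> dom L v -> dom L (u - v).
  by move=> du dv; rewrite addrC -scaleN1r; exact: domZD.
have LB u v : dom L u -> dom L v -> L (u - v) = L u - L v.
  by move=> du dv; rewrite addrC -scaleN1r LZD// scaleN1r addrC.
have [l sl] : exists l : H, s @ \oo --> l.
  apply: H_complete => e e0; have [N NP] := small _ (divr_gt0 e0 (ltr0n R 2)).
  exists N => m n /NP mN /NP nN.
  have := dissipative_le norm_dot L_dissipative (ltW h0) (domB _ _ (sP m).1 (sP n).1).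
  have -> : s m - s n - h%:C *: L (s m - s n) =
      (f - (s n - h%:C *: L (s n))) - (f - (s m - h%:C *: L (s m))).
    rewrite LB; [|exact: (sP m).1|exact: (sP n).1].
    rewrite scalerBr !opprD !opprK !addrA [RHS](ACl (5*2*6*3*(1*4)))/=.
    by rewrite subrr addr0.
  move=> /le_lt_trans; apply; apply: le_lt_trans (rnormB _ _) _.
  by rewrite [ltRHS]splitr ltrD//; [apply: lt_trans nN; exact: (sP n).2|apply: lt_trans mN; exact: (sP m).2].
have hC : h%:C != 0 :> R[i] by rewrite eq_complex /= gt_eqF.
have Lsl : (L \o s) @ \oo --> (h^-1)%:C *: (l - f).
  have -> : L \o s = fun n => (h^-1)%:C *: (s n - (s n - h%:C *: L (s n))).
    apply/funext => n /=; rewrite opprB addrC subrK scalerA -rmorphM/=.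
    by rewrite mulVf ?gt_eqF// scale1r.
  by apply: cvgZr; apply: cvgB.
have [dl Ll] : dom L l /\ L l = (h^-1)%:C *: (l - f).
  apply: (@closed_cvg _ _ _ eventually_filter (fun n => (s n, L (s n))) _ graph_closed _ (l, _)).
    by apply: nearW => n /=; split=> //; exact: (sP n).1.
  exact: cvg_pair sl Lsl.
exists l; split=> //; rewrite Ll scalerA -rmorphM/= mulfV ?gt_eqF// scale1r.
by rewrite opprB addrC subrK.
Qed.

Local Notation P := (semigroup norm_dot H_complete L_linear L_dissipative L_dense L_range).

(** With u = J_h f and v = J_h F g, both sides equal <u, F v> - h <u, F L v>. *)
Let resolvent_adjoint (h : R) f g : 0 <= h ->
  dot (resolvent L_range h f) g = dot f (F (resolvent L_range h (F g))).
Proof.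
rewrite le_eqVlt => /predU1P[<-|h0]; first by rewrite !resolvent0 FK.
set u := resolvent _ _ f; set v := resolvent _ _ (F g).
have du : dom L u by exact: resolvent_dom.
have dv : dom L v by exact: resolvent_dom.
have uE : u - h%:C *: L u = f by exact: resolventE.
have vE : v - h%:C *: L v = F g by exact: resolventE.
have adj : dot (L u) (F v) = dot u (F (L v)).
  by apply: (iffLR (L_adjoint (F v) (F (L v)))) => //; rewrite FK.
have -> : dot u g = dot u (F (v - h%:C *: L v)) by rewrite vE FK.
transitivity (dot u (F v) - h%:C * dot u (F (L v))).
  by rewrite -F_sym linearBr/= dotZr_real !F_sym.
by rewrite -adj -uE linearBl/= linearZl_LR.
Qed.

Lemma semigroup_adjoint (t : R) f g : 0 <= t -> dot (P t f) g = dot f (F (P t (F g))).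
Proof.
move=> t0; rewrite -F_sym.
have ft : euler L_range t N f @[N --> \oo] --> P t f by exact: semigroupP.
have gt : euler L_range t N (F g) @[N --> \oo] --> P t (F g) by exact: semigroupP.
apply: (normc_cvg_unique _ (dot_cvgl norm_dot _ g ft) (dot_cvgr norm_dot _ (F f) gt)).
apply: nearW => N; rewrite F_sym /euler.
have h0 : 0 <= t / N.+1%:R by rewrite divr_ge0.
move: (t / N.+1%:R) h0 => h h0; elim: N.+1 f g {ft gt} => [|n IH] f g; first by rewrite /= FK.
by rewrite iterSr IH resolvent_adjoint// iterS FK.
Qed.

Theorem contraction_semigroup_adjoint :
  [/\ closed_operator L,
      is_adjoint dot L (Operator (F @` dom L) (fun g => F (L (F g)))) &
      exists2 P : R -> H -> H, generates L P &
        forall t, 0 <= t ->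
          is_adjoint dot (Operator setT (P t)) (Operator setT (fun f => F (P t (F f))))].
Proof.
split.
- by split=> //; exact: graph_closed.
- split; first exact: dense_dom.
  move=> g h; rewrite -L_adjoint; split=> /= [[[f df <-]]|[dg gh]]; first by rewrite FK.
  by split=> //; exists (F g).
- exists P; first exact: semigroup_generates.
  move=> t t0; split; first by move=> O [x Ox] _; exists x.
  move=> g h; split=> /= [[_ <-] f _|gh]; first exact: semigroup_adjoint.
  split=> //; apply: (dot_nondegenerate norm_dot) => f.
  by rewrite -gh// semigroup_adjoint.
Qed.

End adjoint_semigroup.

(** * Completeness of L^2 *)

Section L2_complete.
Context d (T : measurableType d) (R : realType).
Variable mu : {measure set T -> \bar R}.
Local Notation cRe := (@complex.Re R).
Local Notation cIm := (@complex.Im R).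

Lemma cvgn_series_diff (w : nat -> R) : cvgn (series (fun k => w k.+1 - w k)) -> cvgn w.
Proof.
move=> cw.
have -> : w = fun n => w 0%N + series (fun k => w k.+1 - w k) n.
  by apply/funext => n; rewrite seriesEnat /= telescope_sumr// addrC subrK.
by apply: is_cvgD => //; exact: is_cvg_cst.
Qed.

(** The increments a_k are summable almost everywhere because |a_k| <= (4^-k + 4^k a_k^2) / 2, and
    the series of 4^k a_k^2 has integral at most that of 4^k 8^-k = 2^-k. Splitting in this way
    keeps the constant 4^-k outside the integral, as befits a measure that may be infinite. *)
Lemma ae_cvgn_sqr_diff (w : nat -> T -> R) :
  (forall k, measurable_fun setT (w k)) ->
  (forall k, (\int[mu]_x ((w k.+1 x - w k x) ^+ 2)%:E <= ((8 ^+ k)^-1)%:E)%E) ->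
  {ae mu, forall x, cvgn (w ^~ x)}.
Proof.
move=> mw wle.
pose f k x := (4 ^+ k * (w k.+1 x - w k x) ^+ 2)%:E.
have f0 k x : (0 <= f k x)%E by rewrite lee_fin mulr_ge0 ?sqr_ge0// exprn_ge0.
have mf k : measurable_fun setT (f k).
  apply/measurable_EFinP; apply: measurable_funM; first exact: measurable_cst.
  by apply: measurable_funX; apply: measurable_funB.
have sf : mu.-integrable setT (fun x => \sum_(0 <= k <oo) f k x)%E.
  apply/integrableP; split; first by apply: ge0_emeasurable_sum => // k x _ _; exact: f0.
  under eq_integral do rewrite gee0_abs ?nneseries_ge0//.
  rewrite integral_nneseries//.
  apply: (@le_lt_trans _ _ (\sum_(0 <= k <oo) (2 / (2 ^ k.+1)%:R)%:E)%E).
    apply: lee_nneseries => k *; first by apply: integral_ge0 => x _; exact: f0.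
    rewrite /f; under eq_integral do rewrite EFinM.
    rewrite ge0_integralZl//.
    + apply: (@le_trans _ _ ((4 ^+ k)%:E * ((8 ^+ k)^-1)%:E)%E).
        by apply: lee_wpmul2l => //; rewrite lee_fin exprn_ge0.
      rewrite -EFinM lee_fin natrX exprS invfM mulrA mulfV// mul1r.
      rewrite -exprVn -exprMn (_ : 4 / 8 = 2^-1) ?exprVn//.
      by field.
    + by apply/measurable_EFinP; apply: measurable_funX; apply: measurable_funB.
    + by move=> x _; rewrite lee_fin sqr_ge0.
  by apply: le_lt_trans (@epsilon_trick0 _ 2 xpredT _) _ => //; exact: ltry.
have := integrable_ae measurableT sf; apply: filterS => x /(_ I) fx.
apply: cvgn_series_diff; apply: normed_cvg.
pose v k := 2^-1 * ((4 ^+ k)^-1 + 4 ^+ k * (w k.+1 x - w k x) ^+ 2).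
have v0 k : 0 <= v k.
  by rewrite mulr_ge0// addr_ge0 ?invr_ge0 ?exprn_ge0// mulr_ge0 ?sqr_ge0 ?exprn_ge0.
apply: (@series_le_cvg _ _ v) => //; first by move=> k /=.
  move=> k; rewrite /v /=.
  have p0 : 0 < 4 ^+ k :> R by rewrite exprn_gt0.
  set a := `|_|; have -> : (w k.+1 x - w k x) ^+ 2 = a ^+ 2 by rewrite real_normK ?num_real.
  have -> : (4 ^+ k : R) = (2 ^+ k) ^+ 2 by rewrite -exprM mulnC exprM (_ : 2 ^+ 2 = 4)//; ring.
  have q0 : 0 < 2 ^+ k :> R by rewrite exprn_gt0.
  rewrite -subr_ge0 (_ : _ - _ = 2^-1 * ((2 ^+ k)^-1 - 2 ^+ k * a) ^+ 2).
    by rewrite mulr_ge0// sqr_ge0.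
  by field; rewrite lt0r_neq0.
have -> : v = (fun k => 2^-1 * ((4 ^+ k)^-1 + 4 ^+ k * (w k.+1 x - w k x) ^+ 2)) by [].
apply: is_cvg_seriesZ.
rewrite [X in cvgn (series X)](_ : _ =
  geometric 1 (4^-1) \+ (fun k => 4 ^+ k * (w k.+1 x - w k x) ^+ 2)); last first.
  by apply/funext => k /=; rewrite mul1r exprVn.
rewrite seriesD; apply: is_cvgD.
  apply: is_cvg_geometric_series; rewrite ger0_norm ?invr_ge0// invf_lt1//; lra.
apply: nondecreasing_is_cvgn.
  by apply: nondecreasing_series => k _ _; rewrite mulr_ge0 ?sqr_ge0// exprn_ge0.
exists (fine (\sum_(0 <= k <oo) f k x)%E) => _ [n _ <-].
rewrite -lee_fin fineK// /series /= -sumEFin.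
by apply: nneseries_lim_ge => *; exact: f0.
Qed.

Lemma limn_einf_le (a : nat -> \bar R) (c : \bar R) :
  (forall n, a n <= c)%E -> (limn_einf a <= c)%E.
Proof.
move=> ac; rewrite limn_einf_lim; apply: lime_le; first exact: is_cvg_einfs.
apply: nearW => n; apply: le_trans (ac n); apply: ereal_inf_lbound.
by exists n => /=.
Qed.

Lemma limn_einf_ge0 (a : nat -> \bar R) : (forall n, 0 <= a n)%E -> (0 <= limn_einf a)%E.
Proof.
move=> a0; rewrite limn_einf_lim; apply: lime_ge; first exact: is_cvg_einfs.
by apply: nearW => n; apply: le_ereal_inf_tmp => _ [k _ <-].
Qed.

Lemma measurable_limn_einf (f : nat -> T -> \bar R) :
  (forall n, measurable_fun setT (f n)) -> measurable_fun setT (fun x => limn_einf (f ^~ x)).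
Proof.
move=> mf.
have -> : (fun x => limn_einf (f ^~ x)) = -%E \o (fun x => limn_esup (fun n => - f n x)%E) by [].
apply: measurableT_comp; first exact: oppe_measurable.
by apply: measurable_fun_limn_esup => n; exact: measurableT_comp.
Qed.

Lemma L2_subP (u v : L2 mu) : (u - v : L2 mu) = (fun x => u x - v x) %[ae mu].
Proof.
have := L2_addP u (- v); rewrite -scaleN1r; have := L2_scaleP (-1) v.
by apply: filterS2 => x /= vx uvx _; rewrite uvx// vx// mulN1r.
Qed.

Lemma L2_normE (u : L2 mu) : (\int[mu]_x (sqn (u x))%:E)%E = (rnorm u ^+ 2)%:E.
Proof.
have := L2_dot_self u; rewrite (@dot_rnorm _ _ (@L2_dot _ _ _ mu))// => -[ru].
rewrite ru /Rintegral fineK// ge0_fin_numE ?integral_ge0//.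
  by have [] := L2fun_sq_integrable u.
by move=> x _; rewrite lee_fin sqn_ge0.
Qed.

Lemma measurable_funCB (f g : T -> R[i]) : measurable_funC f -> measurable_funC g ->
  measurable_funC (fun x => f x - g x).
Proof.
move=> mf mg; have -> : (fun x => f x - g x) = f + (cst (-1) \* g).
  by apply/funext => x; rewrite fctE /= mulN1r.
by apply: measurable_funCD => //; apply: measurable_funCM => //; exact: measurable_funC_cst.
Qed.

Lemma L2_distE (u : L2 mu) (v : L2 mu) (f g : T -> R[i]) :
  measurable_funC f -> measurable_funC g ->
  u = f %[ae mu] -> v = g %[ae mu] ->
  (\int[mu]_x (sqn (f x - g x))%:E)%E = (rnorm (u - v) ^+ 2)%:E.
Proof.
move=> mf mg uf vg; rewrite -L2_normE.
apply: ge0_ae_eq_integral => //.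
- by apply/measurable_EFinP/measurable_sqn/measurable_funCB.
- by apply/measurable_EFinP/measurable_sqn/L2_measurable.
- by move=> x _; rewrite lee_fin sqn_ge0.
- by move=> x _; rewrite lee_fin sqn_ge0.
have := L2_subP u v; move: uf vg; apply: filterS3 => x /= ux vx uvx _.
by rewrite uvx// ux// vx.
Qed.

Lemma sqr_Re_le (z : R[i]) : cRe z ^+ 2 <= sqn z.
Proof. by rewrite sqnE lerDl sqr_ge0. Qed.

Lemma sqr_Im_le (z : R[i]) : cIm z ^+ 2 <= sqn z.
Proof. by rewrite sqnE lerDr sqr_ge0. Qed.

(** A rapidly converging subsequence [w] converges almost everywhere, and Fatou's lemma bounds the
    distance from its limit to every late term of [u]. *)
Theorem L2_complete : cauchy_complete (L2 mu).
Proof.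
move=> u u_cauchy.
have eps k : 0 < (8 ^+ k)^-1 :> R by rewrite invr_gt0 exprn_gt0.
have /choice[N NP] : forall k, exists N, forall m n, (N <= m)%N -> (N <= n)%N ->
    rnorm (u m - u n) ^+ 2 <= (8 ^+ k)^-1.
  move=> k; have [|N NP] := u_cauchy (Num.sqrt (8 ^+ k)^-1); first by rewrite sqrtr_gt0.
  exists N => m n /NP /[apply] /ltW.
  by rewrite -(@ler_pXn2r _ 2)// ?nnegrE ?rnorm_ge0 ?sqrtr_ge0// sqr_sqrtr// ltW.
(* Summing makes [phi k] at least [N j] for every [j <= k], without arranging [N] to be monotone. *)
pose phi k := (\sum_(i < k.+1) N i)%N.
have phi_ge j k : (j <= k)%N -> (N j <= phi k)%N.
  by move=> jk; rewrite /phi (bigD1 (Ordinal (jk : j < k.+1)%N))//= leq_addr.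
pose w k : L2 mu := u (phi k).
have mr k : measurable_fun setT (cRe \o w k) by have [] := L2_measurable (w k).
have mi k : measurable_fun setT (cIm \o w k) by have [] := L2_measurable (w k).
have dist (a b : L2 mu) : (\int[mu]_x (sqn (a x - b x))%:E)%E = (rnorm (a - b) ^+ 2)%:E.
  by apply: L2_distE; [exact: L2_measurable|exact: L2_measurable|exact: ae_eq_refl|exact: ae_eq_refl].
have ww k : (\int[mu]_x (sqn (w k.+1 x - w k x))%:E <= ((8 ^+ k)^-1)%:E)%E.
  by rewrite dist lee_fin; apply: NP; apply: phi_ge.
have cr : {ae mu, forall x, cvgn (fun k => cRe (w k x))}.
  apply: (@ae_cvgn_sqr_diff (fun k => cRe \o w k)) => // k.
  apply: le_trans (ww k); apply: ge0_le_integral => //.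
  - by move=> x _; rewrite lee_fin sqr_ge0.
  - by apply/measurable_EFinP/measurable_funX/measurable_funB.
  - by apply/measurable_EFinP/measurable_sqn/measurable_funCB; exact: L2_measurable.
  - by move=> x _; rewrite lee_fin /= -raddfB; exact: sqr_Re_le.
have ci : {ae mu, forall x, cvgn (fun k => cIm (w k x))}.
  apply: (@ae_cvgn_sqr_diff (fun k => cIm \o w k)) => // k.
  apply: le_trans (ww k); apply: ge0_le_integral => //.
  - by move=> x _; rewrite lee_fin sqr_ge0.
  - by apply/measurable_EFinP/measurable_funX/measurable_funB.
  - by apply/measurable_EFinP/measurable_sqn/measurable_funCB; exact: L2_measurable.
  - by move=> x _; rewrite lee_fin /= -raddfB; exact: sqr_Im_le.
(* The upper limit is measurable in any case and coincides with the limit wherever the latter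
   exists, that is almost everywhere. *)
pose vr x := fine (limn_esup (fun k => (cRe (w k x))%:E)).
pose vi x := fine (limn_esup (fun k => (cIm (w k x))%:E)).
pose v x : R[i] := vr x +i* vi x.
have mv : measurable_funC v.
  split; apply: (measurableT_comp (fine_measurable measurableT));
    apply: measurable_fun_limn_esup => k; apply/measurable_EFinP.
    exact: mr.
  exact: mi.
have limE (a : nat -> R) : cvgn a -> a @ \oo --> fine (limn_esup (EFin \o a)).
  move=> /cvg_ex[l al].
  have /cvg_limn_einf_sup[_ ->] : (EFin \o a) @ \oo --> l%:E by apply: cvg_EFin => //; exact: nearW.
  exact: al.
have fat (b : L2 mu) (j : nat) : (forall k, (N j <= k)%N -> rnorm (u k - b) ^+ 2 <= (8 ^+ j)^-1) ->
    (\int[mu]_x (sqn (v x - b x))%:E <= ((8 ^+ j)^-1)%:E)%E.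
  move=> ub.
  pose F k x := (sqn (w (k + j)%N x - b x))%:E.
  have mF k : measurable_fun setT (F k).
    by apply/measurable_EFinP/measurable_sqn/measurable_funCB; exact: L2_measurable.
  have F0 k x : (0 <= F k x)%E by rewrite lee_fin sqn_ge0.
  apply: (@le_trans _ _ (\int[mu]_x limn_einf (F ^~ x))%E).
    rewrite le_eqVlt; apply/orP; left; apply/eqP.
    apply: ge0_ae_eq_integral => //.
    - by apply/measurable_EFinP/measurable_sqn/measurable_funCB => //; exact: L2_measurable.
    - exact: measurable_limn_einf.
    - by move=> x _; rewrite lee_fin sqn_ge0.
    - move=> x _; exact: limn_einf_ge0.
    move: cr ci; apply: filterS2 => x /limE rx /limE ix _.
    apply/esym/(fun h => (cvg_limn_einf_sup h).1)/cvg_EFin; first exact: nearW.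
    rewrite [X in _ --> X]sqnE [X in X @ _](_ : _ = fun k => cRe (w (k + j)%N x - b x) ^+ 2 +
      cIm (w (k + j)%N x - b x) ^+ 2); last by apply/funext => k; rewrite /= sqnE.
    have sh (a : nat -> R) (l : R) : a @ \oo --> l -> (fun k => a (k + j)%N) @ \oo --> l.
      by move=> al; rewrite (cvg_shiftn j).
    under eq_fun do rewrite !raddfB/=.
    have sq (a : nat -> R) (l : R) : a @ \oo --> l -> (fun k => a k ^+ 2) @ \oo --> l ^+ 2.
      by move=> al; under eq_fun do rewrite expr2; exact: cvgM.
    rewrite !raddfB/=; apply: cvgD; apply: sq; apply: cvgB; try exact: cvg_cst.
    - exact: sh rx.
    - exact: sh ix.
  apply: le_trans (fatou mu measurableT mF _) _; first by move=> *; exact: F0.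
  apply: limn_einf_le => k; rewrite dist lee_fin; apply: ub.
  by apply: phi_ge; rewrite leq_addl.
have [b bP] : exists b : L2 mu, forall k, (N 0%N <= k)%N -> rnorm (u k - b) ^+ 2 <= (8 ^+ 0)^-1.
  by exists (u (N 0%N)) => k k0; exact: NP.
(* One late term [b] at finite distance suffices: [v] is the sum of [v - b] and [b]. *)
have vL2 : sq_integrable mu v.
  have -> : v = (fun x => v x - b x) + b by apply/funext => x; rewrite fctE subrK.
  apply: sq_integrableD; last exact: L2fun_sq_integrable.
  split; first by apply: measurable_funCB => //; exact: L2_measurable.
  by apply: le_lt_trans (fat _ _ bP) _; rewrite ltry.
exists (L2_class (L2Fun (mem_set vL2))).
have small (e : R) : 0 < e -> exists j, (8 ^+ j)^-1 < e.
  move=> e0.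
  have [j _ jP] := near_infty_natSinv_lt (PosNum e0).
  exists j; apply: le_lt_trans (jP j (leqnn _)) => /=.
  rewrite lef_pV2 ?posrE ?exprn_gt0// -natrX ler_nat.
  exact: ltn_expl.
apply/rnorm_cvgP => e e0.
have [j je] := small _ (exprn_gt0 2 e0).
exists (N j) => // m /= jm.
rewrite -(@ltr_pXn2r _ 2)// ?nnegrE ?rnorm_ge0 ?(ltW e0)//.
apply: le_lt_trans je; rewrite rdistC -lee_fin.
rewrite -(@L2_distE (L2_class (L2Fun (mem_set vL2))) (u m) v (L2_rep (u m))).
- by apply: fat => k jk; exact: NP.
- exact: mv.
- exact: L2_measurable.
- exact: (L2_classK (L2Fun (mem_set vL2))).
- exact: ae_eq_refl.
Qed.

End L2_complete.

(** * Locally absolutely continuous functions *)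

Section primitive.
Context (R : realType).
Local Notation leb := (@lebesgue_measure R).
Implicit Types (F G f g h : R -> R) (a b c s t x e : R).

Definition locint f := measurable_fun setT (f : measurableTypeR R -> R) /\
  forall a b, leb.-integrable `[a, b] (EFin \o f).

(* F is locally absolutely continuous with derivative f *)
Definition primitive F f := locint f /\
  forall a b, a <= b -> F b - F a = \int[leb]_(x in `[a, b]) f x.

Let mitv (i : interval R) : measurable ([set` i] : set (measurableTypeR R)).
Proof. exact: measurable_itv. Qed.

Lemma locint_le f g : measurable_fun setT (f : measurableTypeR R -> R) -> locint g ->
  (forall x, `|f x| <= `|g x|) -> locint f.
Proof.
move=> mf [mg gi] fg; split=> // a b; apply: le_integrable (gi a b) => //.
  exact/measurable_EFinP/measurable_funTS.
by move=> x _; rewrite lee_fin.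
Qed.

Lemma locintD f g : locint f -> locint g -> locint (fun x => f x + g x).
Proof.
move=> [mf fi] [mg gi]; split=> [|a b]; first exact: measurable_funD.
by have := integrableD (mitv `[a, b]) (fi a b) (gi a b); apply: eq_integrable.
Qed.

Lemma locintZ c f : locint f -> locint (fun x => c * f x).
Proof.
move=> [mf fi]; split=> [|a b]; first exact: measurable_funM.
by have := integrableZl (mitv `[a, b]) c (fi a b); apply: eq_integrable.
Qed.

Lemma locintN f : locint f -> locint (fun x => - f x).
Proof.
move=> [mf fi]; split=> [|a b]; first exact: measurableT_comp.
by have := integrableN (fi a b); apply: eq_integrable.
Qed.

Lemma locintB f g : locint f -> locint g -> locint (fun x => f x - g x).
Proof. by move=> fi gi; apply: locintD => //; exact: locintN. Qed.

Lemma locint_norm f : locint f -> locint (fun x => `|f x|).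
Proof.
move=> fi; apply: (locint_le _ fi) => [|x]; last by rewrite normr_id.
by case: fi => mf _; exact: measurableT_comp.
Qed.

Lemma continuous_bounded_itv f a b : continuous f ->
  exists2 M, 0 < M & forall x, a <= x <= b -> `|f x| <= M.
Proof.
move=> cf.
have : compact (f @` `[a, b]).
  by apply: continuous_compact; [exact: continuous_subspaceT|exact: segment_compact].
move=> /compact_bounded/ex_strict_bound_gt0[M M0 fM]; exists M => // x axb; apply/ltW/fM.
by exists x => //=; rewrite in_itv.
Qed.

Lemma locintM_continuous f g : locint f -> continuous g -> locint (fun x => f x * g x).
Proof.
move=> [mf fi] cg; split=> [|a b].
  by apply: measurable_funM => //; exact: continuous_measurable_fun.
have : leb.-integrable `[a, b] ((EFin \o f) \* (EFin \o g))%E.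
  apply: integrableMl => //.
    by apply: measurable_funTS; exact: continuous_measurable_fun.
  have [M M0 gM] := continuous_bounded_itv a b cg.
  exists M; split; first exact: num_real.
  move=> N MN x /=; rewrite in_itv/= => xab; apply: le_trans (gM x xab) _; exact: ltW.
by apply: eq_integrable.
Qed.

Lemma locint_cst c : locint (fun=> c).
Proof.
split=> [|a b]; first exact: measurable_cst.
by apply: continuous_compact_integrable; [exact: segment_compact|move=> x; exact: cvg_cst].
Qed.

Lemma continuous_locint f : continuous f -> locint f.
Proof.
move=> cf; have := locintM_continuous (locint_cst 1) cf.
by under eq_fun do rewrite mul1r.
Qed.

Lemma locint_locally_integrable f : locint f -> locally_integrable setT f.
Proof.
move=> [mf fi]; split=> //; first exact: openT.
move=> K _ cK; have /compact_bounded/ex_strict_bound_gt0[M M0 KM] := cK.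
have /integrableP[_] := fi (- M) M; apply: le_lt_trans.
apply: ge0_subset_integral => //; first exact: compact_measurable.
  by apply/measurable_EFinP; apply: measurableT_comp => //; exact: measurable_funTS.
by move=> x /KM /ltW; rewrite /= in_itv/= ler_norml.
Qed.

Lemma Rintegral_itv_cat f a b c : locint f -> a <= b <= c ->
  \int[leb]_(x in `[a, c]) f x =
  \int[leb]_(x in `[a, b]) f x + \int[leb]_(x in `[b, c]) f x.
Proof.
move=> [mf fi] /andP[ab bc]; have := @Rintegral_itvB _ f (BLeft a) (BRight c) b (fi a c).
rewrite !bnd_simp => /(_ ab bc)/eqP; rewrite subr_eq => /eqP ->.
rewrite addrC Rintegral_itv_obnd_cbnd//.
by apply: integrableS (fi b c) => //; exact: subset_itv_oc_cc.
Qed.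

Lemma primitive_exists f : locint f -> exists F, primitive F f.
Proof.
move=> fi.
exists (fun x => \int[leb]_(t in `[0, x]) f t - \int[leb]_(t in `[x, 0]) f t).
split=> // a b ab.
have I0 u v : v < u -> \int[leb]_(t in `[u, v]) f t = 0.
  by move=> vu; rewrite set_itv_ge ?Rintegral_set0// bnd_simp -ltNge.
have I1 u : \int[leb]_(t in `[u, u]) f t = 0 by rewrite set_itv1 Rintegral_set1.
have [b0|b0] := leP b 0.
  have a0 := le_trans ab b0.
  have z u : u <= 0 -> \int[leb]_(t in `[0, u]) f t = 0.
    by rewrite le_eqVlt => /predU1P[->|/I0].
  by rewrite !z// !sub0r opprK addrC (@Rintegral_itv_cat f a b 0) ?ab// addrK.
rewrite (I0 _ _ b0) subr0; have [a0|a0] := ltP a 0.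
  by rewrite (I0 _ _ a0) sub0r opprK addrC (@Rintegral_itv_cat f a 0 b)// (ltW a0) ltW.
have -> : \int[leb]_(t in `[a, 0]) f t = 0.
  by move: a0; rewrite le_eqVlt => /predU1P[<-|/I0].
by rewrite subr0 (@Rintegral_itv_cat f 0 a b) ?a0// addrAC subrr add0r.
Qed.

Lemma primitiveD F G f g : primitive F f -> primitive G g ->
  primitive (fun x => F x + G x) (fun x => f x + g x).
Proof.
move=> [fi FE] [gi GE]; split=> [|a b ab]; first exact: locintD.
by rewrite RintegralD//; [rewrite -FE// -GE// addrACA opprD|exact: fi.2|exact: gi.2].
Qed.

Lemma primitiveZ c F f : primitive F f -> primitive (fun x => c * F x) (fun x => c * f x).
Proof.
move=> [fi FE]; split=> [|a b ab]; first exact: locintZ.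
by rewrite RintegralZl//; [rewrite -FE// mulrBr|exact: fi.2].
Qed.

Lemma primitiveN F f : primitive F f -> primitive (fun x => - F x) (fun x => - f x).
Proof.
move=> /(primitiveZ (- 1)); under eq_fun do rewrite mulN1r.
by under [X in primitive _ X -> _]eq_fun do rewrite mulN1r.
Qed.

Lemma primitiveB F G f g : primitive F f -> primitive G g ->
  primitive (fun x => F x - G x) (fun x => f x - g x).
Proof. by move=> Ff Gg; apply: primitiveD => //; exact: primitiveN. Qed.

Lemma primitive_cst c : primitive (fun=> c) (fun=> 0).
Proof.
split=> [|a b ab]; first exact: locint_cst.
by rewrite subrr Rintegral_cst// mul0r.
Qed.

Lemma primitive_continuous F f : primitive F f -> continuous F.
Proof.
move=> [fi FE] x.
have ab : x - 1 < x + 1 by lra.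
have := @parameterized_integral_continuous R (x - 1) (x + 1) f (ltW ab) (fi.2 _ _).
move=> /(continuous_within_itvP _ ab)[/(_ x) cI _ _].
have {}cI : {for x, continuous (fun y => parameterized_integral leb (x - 1) y f)}.
  by apply: cI; rewrite in_itv/= ltrBlDr ltrDl ltr01.
have FI : \forall y \near x, F (x - 1) + parameterized_integral leb (x - 1) y f = F y.
  near=> y; rewrite /parameterized_integral -FE; first by rewrite addrC subrK.
  by apply: ltW; near: y; apply: lt_nbhsr; rewrite ltrBlDr ltrDl.
rewrite /continuous_at -(nbhs_singleton FI).
apply: cvg_trans (cvgD (cvg_cst _) cI); exact: near_eq_cvg.
Unshelve. all: by end_near. Qed.

(** A supremum argument: the last point of [[a, b]] up to which [h] stays above [h a] belongs to the
    set of such points and, if less than [b], could be moved to the right. *)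
Lemma locally_nondecreasing h :
  (forall x, exists2 d : R, 0 < d & forall s t, x - d < s -> s <= x -> x <= t -> t < x + d ->
     h s <= h t) ->
  forall a b, a <= b -> h a <= h b.
Proof.
move=> hl a b ab.
pose S := [set t | a <= t <= b /\ forall u, a <= u <= t -> h a <= h u].
have Sa : S a.
  by split; [rewrite lexx ab|move=> u; rewrite -eq_le => /eqP ->].
have hS : has_sup S by split; [exists a|exists b => t [/andP[]]].
pose c := sup S.
have ac : a <= c by apply: ub_le_sup => //; case: hS.
have cb : c <= b by apply: ge_sup; [exists a|move=> t [/andP[]]].
have [d d0 hd] := hl c.
have Sc : S c.
  split; first by rewrite ac cb.
  move=> u /andP[au]; rewrite le_eqVlt => /predU1P[->|uc].
    have [t St ct] := sup_adherent d0 hS.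
    have tc : t <= c by apply: ub_le_sup => //; case: hS.
    apply: (@le_trans _ _ (h t)); first by apply: St.2; case: St => /andP[-> _] _; rewrite lexx.
    by apply: hd => //; rewrite ltrDl.
  have [t St ut] : exists2 t, S t & u < t.
    have cu : 0 < c - u by rewrite subr_gt0.
    by have [t St] := sup_adherent cu hS; rewrite -/c subKr; exists t.
  by apply: St.2; rewrite au ltW.
have [cb'|bc] := ltP c b; last by apply: Sc.2; rewrite ab.
pose t := Num.min b (c + d / 2).
have ct : c < t by rewrite lt_min cb' ltrDl divr_gt0.
have St : S t.
  split; first by rewrite (le_trans ac (ltW ct)) ge_min lexx.
  move=> u /andP[au ut]; have [uc|cu] := leP u c; first by apply: Sc.2; rewrite au.
  apply: (@le_trans _ _ (h c)); first by apply: Sc.2; rewrite ac lexx.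
  apply: hd => //; [by rewrite ltrBlDr ltrDl|exact: ltW|].
  apply: le_lt_trans ut _; rewrite gt_min; apply/orP; right.
  by rewrite ltrD2l ltr_pdivrMr// ltr_pMr// ltr1n.
by have := ub_le_sup hS.2 St; rewrite leNgt ct.
Qed.

(** Let [K] be a primitive of f G + F g and [V] one of |f| + |g|. On short intervals [F] and [G]
    vary little, so the increments of D = F G - K are at most e times those of [V]. Hence e V + D
    and e V - D are nondecreasing for every e > 0, which forces [D] to be constant. *)
Lemma primitiveM F G f g : primitive F f -> primitive G g ->
  primitive (fun x => F x * G x) (fun x => f x * G x + F x * g x).
Proof.
move=> Ff Gg; have [cF cG] := (primitive_continuous Ff, primitive_continuous Gg).
have [[fi FE] [gi GE]] := (Ff, Gg).
have fgi : locint (fun x => f x * G x + F x * g x).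
  apply: locintD; first exact: locintM_continuous.
  by under eq_fun do rewrite mulrC; exact: locintM_continuous.
split=> // a b ab.
have vi : locint (fun x => `|f x| + `|g x|) by apply: locintD; exact: locint_norm.
have [K [_ KE]] := primitive_exists fgi.
have [V [_ VE]] := primitive_exists vi.
pose D x := F x * G x - K x.
have Dloc (e : R) : 0 < e -> forall x, exists2 d : R, 0 < d &
    forall s t, x - d < s -> s <= x -> x <= t -> t < x + d ->
     `|D t - D s| <= e * (V t - V s).
  move=> e0 x; have e2 : 0 < e / 2 by rewrite divr_gt0.
  have /cvgrPdist_lt/(_ _ e2) Fx := cF x; have /cvgrPdist_lt/(_ _ e2) Gx := cG x.
  have [d /= d0 dP] : nbhs x (fun y => `|F x - F y| < e / 2 /\ `|G x - G y| < e / 2).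
    exact: filterI.
  exists d => // s t xs sx xt tx.
  have st := le_trans sx xt.
  have near_x y : s <= y <= t -> `|F x - F y| < e / 2 /\ `|G x - G y| < e / 2.
    move=> /andP[sy yt]; apply: dP => /=; rewrite ltr_distl; apply/andP; split; lra.
  have close y z : s <= y <= t -> s <= z <= t -> `|F z - F y| <= e /\ `|G z - G y| <= e.
    move=> /near_x[Fy Gy] /near_x[Fz Gz]; split.
      have -> : F z - F y = (F x - F y) - (F x - F z) by ring.
      by apply: le_trans (ler_normB _ _) _; lra.
    have -> : G z - G y = (G x - G y) - (G x - G z) by ring.
    by apply: le_trans (ler_normB _ _) _; lra.
  have i1 : locint (fun y => f y * (G s - G y)).
    apply: locintM_continuous => //; move=> y; apply: cvgB; [exact: cvg_cst|exact: cG].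
  have i2 : locint (fun y => (F t - F y) * g y).
    under eq_fun do rewrite mulrC.
    apply: locintM_continuous => //; move=> y; apply: cvgB; [exact: cvg_cst|exact: cF].
  have i3 : locint (fun y => f y * (G s - G y) + (F t - F y) * g y) by exact: locintD.
  (* The increment of F G is split as (F t - F s) G s + F t (G t - G s), so that only oscillations
     of [F] and [G] on [[s, t]] remain under the integral. *)
  have -> : D t - D s = \int[leb]_(y in `[s, t]) (f y * (G s - G y) + (F t - F y) * g y).
    have -> : D t - D s = (F t - F s) * G s + F t * (G t - G s) - (K t - K s).
      by rewrite /D; ring.
    rewrite FE// GE// KE// -RintegralZr//; last exact: fi.2.
    rewrite -RintegralZl//; last exact: gi.2.
    rewrite -RintegralD//; last 2 first.
      by have := (locintM_continuous fi (fun y => @cst_continuous _ _ (G s) y)).2; exact.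
      exact: (locintZ (F t) gi).2.
    rewrite -RintegralB//; last 2 first.
    - apply: (locintD _ (locintZ (F t) gi)).2.
      exact: (locintM_continuous fi (fun y => @cst_continuous _ _ (G s) y)).
    - exact: fgi.2.
    by apply: eq_Rintegral => y _; ring.
  apply: le_trans (le_normr_Rintegral _ _) _ => //; first exact: i3.2.
  rewrite VE// -RintegralZl//; last exact: vi.2.
  apply: le_Rintegral => //.
  - exact: (locint_norm i3).2.
  - exact: (locintZ e vi).2.
  move=> y; rewrite /= in_itv/= => yst.
  have [] := close y s yst; first by rewrite lexx.
  have [] := close y t yst; first by rewrite lexx st.
  move=> Ft _ _ Gs.
  apply: le_trans (ler_normD _ _) _; rewrite !normrM mulrDr lerD//.
    by rewrite mulrC ler_wpM2r.
  by rewrite ler_wpM2r.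
have Dab : D a = D b.
  have V0 : 0 <= V b - V a by rewrite VE// Rintegral_ge0// => y _; rewrite addr_ge0.
  suff DV e : 0 < e -> `|D b - D a| <= e * (V b - V a).
    apply/eqP; rewrite eq_sym -subr_eq0 -normr_le0; apply/ler_addgt0Pr => e e0; rewrite add0r.
    have c0 : 0 < V b - V a + 1 by rewrite ltr_wpDl.
    apply: le_trans (DV (e / (V b - V a + 1)) _) _; first by rewrite divr_gt0.
    rewrite -mulrA ger_pMr// mulrC ler_pdivrMr// mul1r lerDl//.
  move=> e0.
  have up : e * V a - D a <= e * V b - D b.
    apply: (@locally_nondecreasing (fun x => e * V x - D x)) ab => x.
    have [d d0 dP] := Dloc e e0 x; exists d => // s t h1 h2 h3 h4.
    have := dP s t h1 h2 h3 h4; rewrite ler_norml => /andP[]; lra.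
  have dn : e * V a + D a <= e * V b + D b.
    apply: (@locally_nondecreasing (fun x => e * V x + D x)) ab => x.
    have [d d0 dP] := Dloc e e0 x; exists d => // s t h1 h2 h3 h4.
    have := dP s t h1 h2 h3 h4; rewrite ler_norml => /andP[]; lra.
  rewrite ler_norml; apply/andP; split; lra.
by rewrite -KE//; move: Dab; rewrite /D; lra.
Qed.

Lemma primitive_C1 F : C1 F -> primitive F (derive1 F).
Proof.
move=> [dF cF]; split; first exact: continuous_locint.
move=> a b; rewrite le_eqVlt => /predU1P[<-|ab].
  by rewrite subrr set_itv1 Rintegral_set1.
have cF0 : continuous F.
  by move=> x; apply: differentiable_continuous; apply/derivable1_diffP.
rewrite /Rintegral.
suff -> : (\int[leb]_(x in `[a, b]) (derive1 F x)%:E = (F b)%:E - (F a)%:E)%E by [].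
apply: continuous_FTC2; [exact: ab|exact: continuous_subspaceT| |by []].
split; first by move=> x _; exact: dF.
- by apply: cvg_at_right_filter; exact: cF0.
- by apply: cvg_at_left_filter; exact: cF0.
Qed.

End primitive.

(** * Almost everywhere comparison and dominated convergence for real integrals *)

Section Rintegral_ae.
Context d (T : measurableType d) (R : realType).
Variable mu : {measure set T -> \bar R}.
Implicit Types (f g : T -> R).

Lemma ae_eq_Rintegral D f g : measurable D -> measurable_fun D f -> measurable_fun D g ->
  {ae mu, forall x, D x -> f x = g x} ->
  \int[mu]_(x in D) f x = \int[mu]_(x in D) g x.
Proof.
move=> mD mf mg fg; congr fine; apply: ae_eq_integral => //; try exact/measurable_EFinP.
by apply: filterS fg => x h /h ->.
Qed.

Lemma ae_le_Rintegral D f g : measurable D -> mu.-integrable D (EFin \o f) ->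
  mu.-integrable D (EFin \o g) -> {ae mu, forall x, D x -> f x <= g x} ->
  \int[mu]_(x in D) f x <= \int[mu]_(x in D) g x.
Proof.
move=> mD fi gi fg; rewrite -subr_ge0 -RintegralB//.
have mf : measurable_fun D f by apply/measurable_EFinP; exact: measurable_int fi.
have mg : measurable_fun D g by apply/measurable_EFinP; exact: measurable_int gi.
rewrite (@ae_eq_Rintegral _ _ (fun x => `|g x - f x|))//.
- exact: Rintegral_ge0.
- exact: measurable_funB.
- by apply: measurableT_comp => //; exact: measurable_funB.
by apply: filterS fg => x h /h fgx; rewrite ger0_norm// subr_ge0.
Qed.

Lemma ae_eq_integrable D f g : measurable D -> measurable_fun D g ->
  {ae mu, forall x, D x -> f x = g x} ->
  mu.-integrable D (EFin \o f) -> mu.-integrable D (EFin \o g).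
Proof.
move=> mD mg fg fi; apply/integrableP; split; first exact/measurable_EFinP.
have /integrableP[mf] := fi; apply: le_lt_trans.
rewrite le_eqVlt; apply/orP; left; apply/eqP; apply: ge0_ae_eq_integral => //.
- by apply: measurableT_comp => //; exact/measurable_EFinP.
- by apply: measurableT_comp.
by apply: filterS fg => x h /h /= ->.
Qed.

Lemma cvg_Rintegral D (f_ : nat -> T -> R) f g : measurable D ->
  (forall n, measurable_fun D (f_ n)) -> mu.-integrable D (EFin \o g) ->
  (forall x, D x -> f_ ^~ x @ \oo --> f x) -> (forall n x, D x -> `|f_ n x| <= g x) ->
  (fun n => \int[mu]_(x in D) f_ n x) @ \oo --> \int[mu]_(x in D) f x.
Proof.
move=> mD mf gi ff fg.
have mf0 : measurable_fun D f by exact: measurable_fun_cvg ff.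
have fi : mu.-integrable D (EFin \o f).
  apply: le_integrable gi => //; first exact/measurable_EFinP.
  move=> x Dx; rewrite lee_fin; apply: le_trans (ler_norm _).
  apply: (closed_cvg (fun y => y <= g x) (@closed_le _ _) _ _ (cvg_norm (ff x Dx))).
  by apply: nearW => n; exact: fg.
apply: fine_cvg; rewrite fineK; last exact: integrable_fin_num.
have := @dominated_cvg _ _ _ mu D mD (fun n => EFin \o f_ n) (EFin \o f) (EFin \o g).
apply => //.
- by move=> n; exact/measurable_EFinP.
- by move=> x Dx; apply: cvg_EFin; [exact: nearW|exact: ff].
Qed.

End Rintegral_ae.

#[global] Instance leb_ae_filter (R : realType) :
  Filter (nbhs (almost_everywhere (@lebesgue_measure R))).
Proof. exact: ae_filter_ringOfSetsType. Qed.

(** * Integrals over the whole line and the absence of boundary terms at infinity *)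

Section real_line.
Context (R : realType).
Local Notation leb := (@lebesgue_measure R).
Implicit Types (F G f g h q a : R -> R) (b c s t x e : R).

Lemma cvg_Rintegral_itv f : leb.-integrable setT (EFin \o f) ->
  (fun n : nat => \int[leb]_(x in `[- n%:R, n%:R]) f x) @ \oo --> \int[leb]_x f x.
Proof.
move=> fi; have mf : measurable_fun setT (f : measurableTypeR R -> R).
  by apply/measurable_EFinP; exact: measurable_int fi.
under eq_fun do rewrite Rintegral_mkcond.
apply: (@cvg_Rintegral _ _ _ leb setT _ f (fun x => `|f x|)) => //.
- by move=> n; apply: (measurable_restrictT _ _).1 => //; exact: measurable_funTS.
- exact: integrable_norm.
- move=> x _; apply: cvg_near_cst.
  have [n _ xn] := @nbhs_infty_ger R `|x|.
  exists n => // m /= nm; rewrite patchE mem_set//= in_itv/= -ler_norml.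
  exact: xn.
- move=> n x _; rewrite patchE; case: ifPn => // _; by rewrite normr0.
Qed.

Lemma integrable_lt_infinite q c (i : interval R) : 0 < c ->
  lebesgue_measure ([set` i] : set R) = +oo%E ->
  leb.-integrable setT (EFin \o q) -> ~ (forall x, x \in i -> c <= `|q x|).
Proof.
move=> c0 ioo qi qc.
have mi : measurable ([set` i] : set (measurableTypeR R)) by exact: measurable_itv.
have /integrableP[mq] : leb.-integrable [set` i] (EFin \o q).
  by apply: integrableS qi.
apply/negP; rewrite -leNgt.
apply: (@le_trans _ _ (\int[leb]_(x in [set` i]) c%:E)%E).
  by rewrite integral_cst// [X in (_ * X)%E](_ : _ = +oo%E) ?gt0_muley.
apply: ge0_le_integral => //.
- by move=> x _; rewrite lee_fin ltW.
- by apply/measurableT_comp.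
Qed.

(** If the integral I of [a] were positive, then q v - q u >= I / 2 whenever u <= - N and N <= v.
    Either some q u >= - I / 4, and q >= I / 4 on [[N, +oo[], or q < - I / 4 on all of []-oo, - N]];
    both contradict the integrability of [q]. The minorant [a] appears because the derivative [q']
    itself is only known to be locally integrable. *)
Lemma primitive_integral_le0 q q' a : primitive q q' ->
  leb.-integrable setT (EFin \o q) -> leb.-integrable setT (EFin \o a) ->
  {ae leb, forall x, a x <= q' x} -> \int[leb]_x a x <= 0.
Proof.
move=> [q'i qE] qi ai aq; rewrite leNgt; apply/negP; set I := \int[leb]_x a x => I0.
have mitv (i : interval R) : measurable ([set` i] : set (measurableTypeR R)).
  exact: measurable_itv.
have I4 : 0 < I / 4 by rewrite divr_gt0.
have [N NP] : exists N : nat, forall u v, u <= - N%:R -> N%:R <= v -> I / 2 <= q v - q u.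
  have ani := integrable_norm ai.
  have := @cvg_Rintegral_itv (fun x => `|a x|) ani.
  move=> /cvgrPdist_lt/(_ _ I4)[N _ NP].
  exists N => u v uN Nv; have N0 : 0 <= N%:R :> R by exact: ler0n.
  have uv : u <= v by apply: le_trans uN (le_trans _ Nv); rewrite lerNl (le_trans _ N0)// oppr_le0.
  rewrite qE//.
  apply: (@le_trans _ _ (\int[leb]_(x in `[u, v]) a x)); last first.
    apply: ae_le_Rintegral => //; first by apply: integrableS ai.
      exact: q'i.2.
    by apply: filterS aq => x.
  have := NP N (leqnn N); rewrite /= => Nsmall.
  have auv : leb.-integrable `[u, v] (EFin \o a) by apply: integrableS ai.
  have sub : (`[- N%:R, N%:R] : set R) `<=` `[u, v].
    by move=> y; rewrite /= !in_itv/= => /andP[y1 y2]; rewrite (le_trans uN)// (le_trans y2).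
  have tail : `|I - \int[leb]_(x in `[u, v]) a x| <= I / 4.
    have aD : leb.-integrable setT (EFin \o (a \_ `[u, v])).
      by rewrite -restrict_EFin -integrable_mkcond.
    have aE : leb.-integrable setT (EFin \o ((fun x => `|a x|) \_ `[- N%:R, N%:R])).
      rewrite -restrict_EFin -integrable_mkcond//.
      exact: integrableS ani.
    rewrite Rintegral_mkcond -RintegralB//.
    apply: le_trans (le_normr_Rintegral _ _) _ => //.
      by have := integrableB measurableT ai aD; apply: eq_integrable.
    move: Nsmall; rewrite [X in _ - X]Rintegral_mkcond -RintegralB// => /ltW; apply: le_trans.
    apply: le_trans (ler_norm _); apply: le_Rintegral => //.
    - have /integrable_norm := integrableB measurableT ai aD; exact: eq_integrable.
    - by have := integrableB measurableT ani aE; apply: eq_integrable.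
    move=> y _; rewrite !patchE; case: ifPn => [yD|yD].
      by rewrite subrr normr0; case: ifPn; rewrite ?subrr// subr0.
    rewrite ifF ?subr0//; apply: contraNF yD; rewrite !inE; exact: sub.
  move: tail; rewrite ler_norml => /andP[_]; lra.
have [[u uN qu]|nu] := pselect (exists2 u, u <= - N%:R & - (I / 4) <= q u).
  apply: (@integrable_lt_infinite q (I / 4) `[N%:R, +oo[ I4 _ qi).
    by rewrite lebesgue_measure_itv/= ltry.
  move=> v; rewrite in_itv/= andbT => /(NP _ _ uN) h.
  by apply: le_trans (ler_norm _); lra.
apply: (@integrable_lt_infinite q (I / 4) `]-oo, (- N%:R)] I4 _ qi).
  by rewrite lebesgue_measure_itv/= ltNyr.
move=> u; rewrite in_itv/= => uN.
have qu : q u < - (I / 4) by rewrite ltNge; apply/negP => qu; apply: nu; exists u.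
by rewrite -normrN; apply: le_trans (ler_norm _); lra.
Qed.

(** Lebesgue differentiation on each half-line starting at - n, where the indefinite integral
    vanishes identically; the exceptional sets are countably many. *)
Lemma locint_ae0 f : locint f ->
  (forall s t, s <= t -> \int[leb]_(x in `[s, t]) f x = 0) ->
  {ae leb, forall x, f x = 0}.
Proof.
move=> fi f0.
have ae_n (n : nat) : {ae leb, forall x, - n%:R < x -> f x = 0}.
  have := @FTC1 R f (BLeft (- n%:R)).
  move=> /(_ (fun y => fi.2 _ y) (locint_locally_integrable fi)).
  have -> : (fun x => \int[leb]_(t in [set` Interval (BLeft (- n%:R)) (BRight x)]) f t) = cst 0.
    apply/funext => x; have [|xn] := leP (- n%:R) x; first exact: f0.
    by rewrite set_itv_ge ?Rintegral_set0// bnd_simp -ltNge.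
  apply: filterS => x h nx; have [_] := h nx.
  by rewrite derive1_cst.
have : leb.-negligible (\bigcup_n ~` [set x | - n%:R < x -> f x = 0]).
  by apply: negligible_bigcup => n; exact: ae_n.
apply: negligibleS => x /= fx.
have [n _ /(_ n (leqnn n)) /= xn] := @nbhs_infty_gtr R (- x).
by exists n => //=; rewrite ltrNl => /(_ xn).
Qed.

End real_line.

(** * Test functions and weak derivatives *)

Section smooth.
Context (R : realType).
Implicit Types (f g : R -> R) (n : nat).

(** The recursion differentiates [f] first, so that stability under sums, products and affine
    substitutions is proved by induction on [n] for all functions at once. *)
Fixpoint Cn n f : Prop :=
  if n is n'.+1 then (forall x, derivable f x 1) /\ Cn n' (derive1 f) else True.

Definition smooth f := forall n, Cn n f.

Lemma CnS n f : Cn n.+1 f -> Cn n f.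
Proof.
elim: n f => // n IH f [df Cf]; split=> //.
by apply: IH.
Qed.

Lemma smoothP f : smooth f <-> forall n x, derivable (derive1n n f) x 1.
Proof.
split=> [sf n|df n].
  elim: n f sf => [|n IH] f sf x; first by have [] := sf 1%N.
  by rewrite derive1Sn; apply: IH => m; have [] := sf m.+1.
elim: n f df => // n IH f df; split; first exact: (df 0%N).
by apply: IH => m x; rewrite -derive1Sn.
Qed.

Lemma derive1D_fun f g : (forall x, derivable f x 1) -> (forall x, derivable g x 1) ->
  derive1 (fun x => f x + g x) = (fun x => derive1 f x + derive1 g x).
Proof.
by move=> df dg; apply/funext => x; rewrite !derive1E deriveD.
Qed.

Lemma derive1Z_fun (c : R) f : (forall x, derivable f x 1) ->
  derive1 (fun x => c * f x) = (fun x => c * derive1 f x).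
Proof.
by move=> df; apply/funext => x; rewrite !derive1E (@deriveZ _ _ _ f c).
Qed.

Lemma derive1M_fun f g : (forall x, derivable f x 1) -> (forall x, derivable g x 1) ->
  derive1 (fun x => f x * g x) = (fun x => derive1 f x * g x + f x * derive1 g x).
Proof.
move=> df dg; apply/funext => x; rewrite !derive1E (@deriveM _ _ f g)//.
by rewrite addrC /GRing.scale/= [g x * _]mulrC.
Qed.

Lemma CnD n f g : Cn n f -> Cn n g -> Cn n (fun x => f x + g x).
Proof.
elim: n f g => // n IH f g [df Cf] [dg Cg]; split.
  by move=> x; exact: derivableD.
by rewrite derive1D_fun//; exact: IH.
Qed.

Lemma CnZ n (c : R) f : Cn n f -> Cn n (fun x => c * f x).
Proof.
elim: n f => // n IH f [df Cf]; split.
  by move=> x; exact: (@derivableZ _ _ _ f c).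
by rewrite derive1Z_fun//; exact: IH.
Qed.

Lemma CnM n f g : Cn n f -> Cn n g -> Cn n (fun x => f x * g x).
Proof.
elim: n f g => // n IH f g Cf Cg; have [[df Cf'] [dg Cg']] := (Cf, Cg); split.
  by move=> x; exact: (@derivableM _ _ f g).
rewrite derive1M_fun//; apply: CnD; apply: IH => //; exact: CnS.
Qed.

Lemma affine_derive (b c x : R) : is_derive x 1 (fun y => b * y + c) b.
Proof.
have := is_deriveD (is_deriveZ b (is_derive_id x 1)) (is_derive_cst c x 1).
by rewrite addr0 /GRing.scale/= mulr1.
Qed.

Lemma Cn_affine n (b c : R) f : Cn n f -> Cn n (fun x => f (b * x + c)).
Proof.
elim: n f => // n IH f [df Cf].
have comp (x : R) : is_derive x 1 (fun x => f (b * x + c)) (derive1 f (b * x + c) * b).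
  apply: (is_derive1_comp (f := f) (g := fun y => b * y + c)).
    by rewrite derive1E; apply/derivableP; exact: df.
  exact: affine_derive.
split; first by move=> x; case: (comp x).
have -> : derive1 (fun x => f (b * x + c)) = (fun x => b * derive1 f (b * x + c)).
  by apply/funext => x; rewrite derive1E (@derive_val _ _ _ _ _ _ _ (comp x)) mulrC.
by apply: CnZ; exact: IH.
Qed.

(* [x^-k exp (-1/x)] for positive [x], extended by [0]: this family is stable under
   derivation, up to linear combinations. *)
Definition flat k (x : R) : R := if 0 < x then x^-1 ^+ k * expR (- x^-1) else 0.

Lemma flat_ge0 k x : 0 <= flat k x.
Proof. by rewrite /flat; case: ifP => // x0; rewrite mulr_ge0 ?expR_ge0// exprn_ge0// invr_ge0 ltW. Qed.

(** With y = 1 / x and m = k + 1, exp y = exp (y / m)^m >= (y / m)^m, because exp z >= 1 + z >=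
    z. *)
Lemma flat_le k x : 0 < x -> flat k x <= k.+1%:R ^+ k.+1 * x.
Proof.
move=> x0; rewrite /flat x0.
have y0 : 0 < x^-1 by rewrite invr_gt0.
have k0 : 0 < k.+1%:R :> R by rewrite ltr0n.
rewrite expRN -(@ler_pM2r _ (expR x^-1)) ?expR_gt0// divfK ?gt_eqF ?expR_gt0//.
have e1 : (x^-1 / k.+1%:R) ^+ k.+1 <= expR x^-1.
  have -> : expR x^-1 = expR (x^-1 / k.+1%:R) ^+ k.+1.
    by rewrite -expRM_natl mulrC divfK// gt_eqF.
  rewrite ler_pXn2r ?nnegrE ?expR_ge0 ?divr_ge0 ?(ltW y0)//.
  by apply: le_trans (expR_ge1Dx _); rewrite lerDr.
apply: le_trans (_ : k.+1%:R ^+ k.+1 * x * (x^-1 / k.+1%:R) ^+ k.+1 <= _); last first.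
  by rewrite ler_wpM2l// mulr_ge0// ?exprn_ge0// ltW.
rewrite exprMn [x^-1 ^+ k.+1]exprS [k.+1%:R^-1 ^+ _]exprVn.
have A0 : k.+1%:R ^+ k.+1 != 0 :> R by rewrite expf_neq0// gt_eqF.
have X0 : x != 0 by rewrite gt_eqF.
move: A0 (x^-1 ^+ k) => {e1}; move: (k.+1%:R ^+ k.+1) => A A0 B.
by rewrite le_eqVlt; apply/orP; left; apply/eqP; field; rewrite A0.
Qed.

Lemma flat_derive k (x : R) : is_derive x 1 (flat k) (flat k.+2 x - k%:R * flat k.+1 x).
Proof.
have [x0|x0|->] := ltgtP x 0.
- have nx : {near x, cst 0 =1 flat k}.
    near=> y; rewrite /flat /= ifN// -leNgt ltW//.
    by near: y; exact: lt_nbhsl.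
  rewrite {2 3}/flat !ifN; try by rewrite -leNgt ltW.
  rewrite mulr0 subr0; split; first exact: near_eq_derivable nx (derivable_cst _ _ _).
  by rewrite -(near_eq_derive _ nx) derive_cst.
- have nx : {near x, (fun y => y^-1 ^+ k * expR (- y^-1)) =1 flat k}.
    near=> y; rewrite /flat ifT//.
    by near: y; exact: lt_nbhsr.
  have dx : is_derive x 1 (fun y => y^-1 ^+ k * expR (- y^-1))
     (flat k.+2 x - k%:R * flat k.+1 x).
    have xn0 : x != 0 by rewrite gt_eqF.
    have dV : is_derive x 1 (fun y : R => y^-1) (- x ^- 2).
      have := @is_deriveV R id x 1 1 xn0 (is_derive_id x 1).
      by rewrite /GRing.scale/= mulr1.
    have dE : is_derive x 1 (fun y : R => expR (- y^-1)) (expR (- x^-1) * (- - x ^- 2)).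
      apply: (is_derive1_comp (f := expR) (g := fun y => - y^-1)); exact: is_deriveN.
    have -> : (fun y => y^-1 ^+ k * expR (- y^-1)) =
        (fun y : R => y^-1) ^+ k * (fun y : R => expR (- y^-1)).
      by apply/funext => y; rewrite !fctE.
    apply: (is_derive_eq (is_deriveM (is_deriveX k dV) dE)).
    rewrite !fctE /GRing.scale/= /flat x0 -exprVn.
    by case: k {nx} => [|k]; rewrite ?mul0r ?mulr0 ?addr0 ?subr0 ?mul1r/= !exprS; ring.
  split; first exact: near_eq_derivable nx (@ex_derive _ _ _ _ _ _ _ dx).
  by rewrite -(near_eq_derive _ nx) (@derive_val _ _ _ _ _ _ _ dx).
- have f0 j : flat j 0 = 0 by rewrite /flat ltxx.
  rewrite !f0 mulr0 subr0.
  have lim0 : (fun h => h^-1 *: ((flat k \o shift 0) (h *: 1) - flat k 0)) @ 0^' --> (0 : R).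
    have C0 : 0 <= k.+2%:R ^+ k.+2 :> R by rewrite exprn_ge0.
    (* At 0 the difference quotient of [flat k] is [flat k.+1], which [flat_le] squeezes to 0. *)
    apply: (@cvg_trans _ ((fun h => flat k.+1 h) @ 0^')).
      apply: near_eq_cvg; near=> h; rewrite /= f0 subr0 addr0 /GRing.scale/= mulr1.
      by rewrite /flat; case: ifP => h0; rewrite ?mulr0// exprS mulrA.
    apply: (@squeeze_cvgr _ _ _ _ (fun=> 0) (fun h => k.+2%:R ^+ k.+2 * `|h|)).
    + near=> h; rewrite flat_ge0/=; have [h0|h0] := ltP 0 h.
        by rewrite ger0_norm ?(ltW h0)// flat_le.
      by rewrite /flat ifN -?leNgt// mulr_ge0.
    + exact: cvg_cst.
    + rewrite -[X in _ --> X](mulr0 (k.+2%:R ^+ k.+2)); apply: cvgMr.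
      rewrite -[X in _ --> X](@normr0 _ R); apply: cvg_norm.
      exact: cvg_within.
  split; first by apply: cvgP lim0.
  exact: cvg_lim lim0.
Unshelve. all: by end_near. Qed.

Lemma flat_smooth k : smooth (flat k).
Proof.
move=> n; elim: n k => // n IH k; split; first by move=> x; case: (flat_derive k x).
have -> : derive1 (flat k) = fun x => flat k.+2 x + (- k%:R) * flat k.+1 x.
  by apply/funext => x; rewrite derive1E (@derive_val _ _ _ _ _ _ _ (flat_derive k x)) mulNr.
by apply: CnD; [|apply: CnZ]; exact: IH.
Qed.

End smooth.

(** * Smooth bumps, the fundamental lemma and the lemma of du Bois-Reymond *)

Section test_functions.
Context (R : realType).
Local Notation leb := (@lebesgue_measure R).
Implicit Types (f g h phi : R -> R) (a b c s t x e : R).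

Lemma closure_support_itv phi a b : (forall x, phi x != 0 -> a <= x <= b) ->
  compact (closure [set x | phi x != 0]).
Proof.
move=> phi0; apply: (@subclosed_compact _ _ `[a, b]).
- exact: closed_closure.
- exact: segment_compact.
have -> : ([set` `[a, b]] : set R) = closure [set` `[a, b]].
  by apply/closure_id; exact: itv_closed.
by apply: closureS => x /phi0; rewrite /= in_itv.
Qed.

(** When [a < b], these functions stay in [0, 1] and tend to the indicator of []a, b[] as [n] grows;
    they take the place of mollified indicators. *)
Lemma test_function_bump (n : nat) a b :
  test_function (fun x => flat 0 (n.+1%:R * (x - a)) * flat 0 (n.+1%:R * (b - x))).
Proof.
split.
  apply/smoothP => m; apply: CnM.
    have := @Cn_affine R m n.+1%:R (- (n.+1%:R * a)) (flat 0) (@flat_smooth R 0 m).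
    by congr Cn; apply/funext => x; congr flat; ring.
  have := @Cn_affine R m (- n.+1%:R) (n.+1%:R * b) (flat 0) (@flat_smooth R 0 m).
  by congr Cn; apply/funext => x; congr flat; ring.
apply: (@closure_support_itv _ a b) => x; rewrite mulf_eq0 negb_or => /andP[].
rewrite /flat pmulr_rgt0// subr_gt0; case: ifP; last by rewrite eqxx.
move=> ax _; rewrite pmulr_rgt0// subr_gt0; case: ifP; last by rewrite eqxx.
by move=> xb _; rewrite !ltW.
Qed.

Lemma test_function_C1 phi : test_function phi -> C1 phi.
Proof.
move=> [dphi _]; split; first exact: (dphi 0%N).
move=> x; apply: differentiable_continuous; apply/derivable1_diffP.
exact: (dphi 1%N).
Qed.

(** The bound on the closed support is strict, so already at |x| = M a whole neighbourhood avoids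
    the support and the derivative vanishes too. *)
Lemma test_function_support phi : test_function phi ->
  exists2 M, 0 < M & forall x, M <= `|x| -> phi x = 0 /\ derive1 phi x = 0.
Proof.
move=> [_ /compact_bounded/ex_strict_bound_gt0[M M0 MP]]; exists M => // x Mx.
have phi0 y : M <= `|y| -> phi y = 0.
  move=> My; apply/eqP/negPn/negP => py; have := MP y (@subset_closure _ _ y py).
  by rewrite /= ltNge My.
split; first exact: phi0.
have nphi0 : ~ closure [set x | phi x != 0] x.
  by move=> /MP /=; rewrite ltNge Mx.
have : nbhs x (~` closure [set x | phi x != 0]).
  by apply: open_nbhs_nbhs; split=> //; rewrite openC; exact: closed_closure.
move=> nx; rewrite derive1E.
have : {near x, cst 0 =1 phi}.
  apply: filterS nx => y ny /=; apply/esym/eqP/negPn/negP => py; apply: ny.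
  exact: subset_closure.
by move=> nx0; rewrite -(near_eq_derive _ nx0) derive_cst.
Qed.

Lemma test_functionI phi M : smooth phi -> (forall x, M <= `|x| -> phi x = 0) ->
  test_function phi.
Proof.
move=> /smoothP sphi phi0; split=> //; apply: (@closure_support_itv _ (- M) M) => x.
apply: contraR; rewrite -ler_norml -ltNge => /ltW xM; exact/eqP/phi0.
Qed.

Lemma test_functionZ c phi : test_function phi -> test_function (fun x => c * phi x).
Proof.
move=> tphi; have [M M0 MP] := test_function_support tphi.
apply: (@test_functionI _ M) => [n|x /MP[-> _]]; last by rewrite mulr0.
by apply: CnZ; move: n; apply/smoothP; case: tphi.
Qed.

Lemma test_functionD f g : test_function f -> test_function g ->
  test_function (fun x => f x + g x).
Proof.
move=> tf tg; have [M M0 MP] := test_function_support tf.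
have [N N0 NP] := test_function_support tg.
apply: (@test_functionI _ (M + N)) => [n|x xMN].
  apply: CnD.
    by move: n; apply/smoothP; case: tf.
  by move: n; apply/smoothP; case: tg.
have [-> _] : f x = 0 /\ derive1 f x = 0 by apply: MP; lra.
have [-> _] : g x = 0 /\ derive1 g x = 0 by apply: NP; lra.
by rewrite addr0.
Qed.

Lemma primitive_derive F f x : primitive F f -> continuous f -> is_derive x 1 F (f x).
Proof.
move=> [fi FE] cf.
have x1 : x < x + 1 by rewrite ltrDl.
have x2 : x - 1 < x by rewrite ltrBlDr.
have [dG GE] := continuous_FTC1_closed x1 (fi.2 (x - 1) (x + 1)) x2 (cf x).
have dG' : is_derive x 1 (fun y => F (x - 1) + \int[leb]_(t in `[x - 1, y]) f t) (f x).
  rewrite -[f x]add0r; apply: is_deriveD; rewrite -GE derive1E; exact/derivableP.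
apply: near_eq_is_derive dG'; near=> y.
rewrite -FE; first by rewrite addrC subrK.
by apply: ltW; near: y; exact: lt_nbhsr.
Unshelve. all: by end_near. Qed.

Lemma Rintegral_support (D : set (measurableTypeR R)) f : (forall x, ~ D x -> f x = 0) ->
  \int[leb]_x f x = \int[leb]_(x in D) f x.
Proof.
move=> f0; rewrite [RHS]Rintegral_mkcond; apply: eq_Rintegral => x _.
by rewrite patchE; case: ifPn => // /negP xD; rewrite f0// => Dx; apply: xD; rewrite inE.
Qed.

Lemma integrable_support (D : set (measurableTypeR R)) f : measurable D ->
  (forall x, ~ D x -> f x = 0) ->
  leb.-integrable D (EFin \o f) -> leb.-integrable setT (EFin \o f).
Proof.
move=> mD f0; rewrite integrable_mkcond//; apply: eq_integrable => // x _.
by rewrite patchE; case: ifPn => // /negP xD; rewrite /= f0// => Dx; apply: xD; rewrite inE.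
Qed.

Lemma not_itvN M x : ~ [set` `[- M, M]] x -> M <= `|x|.
Proof.
by move=> xM; rewrite leNgt; apply/negP => h; apply: xM; rewrite /= in_itv/= -ler_norml ltW.
Qed.

Lemma integrableM_support h f M : locint h -> continuous f ->
  (forall x, M <= `|x| -> f x = 0) -> leb.-integrable setT (EFin \o (fun x => h x * f x)).
Proof.
move=> hi cf f0; apply: (@integrable_support `[- M, M]); first exact: measurable_itv.
  by move=> x /not_itvN/f0 ->; rewrite mulr0.
exact: (locintM_continuous hi cf).2.
Qed.

Lemma test_function_continuous phi : test_function phi -> continuous phi.
Proof.
move=> /test_function_C1[dphi _] x.
by apply: differentiable_continuous; apply/derivable1_diffP; exact: dphi.
Qed.

Lemma integrableM_test h phi : locint h -> test_function phi ->
  leb.-integrable setT (EFin \o (fun x => h x * phi x)).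
Proof.
move=> hi tphi; have [M _ MP] := test_function_support tphi.
apply: (@integrableM_support _ _ M) => //; first exact: test_function_continuous.
by move=> x /MP[].
Qed.

Lemma integrableM_test' h phi : locint h -> test_function phi ->
  leb.-integrable setT (EFin \o (fun x => h x * derive1 phi x)).
Proof.
move=> hi tphi; have [M _ MP] := test_function_support tphi.
apply: (@integrableM_support _ _ M) => //; first by case: (test_function_C1 tphi).
by move=> x /MP[].
Qed.

(** The primitive that vanishes at - M is zero to the left of the support and, by the integral
    condition, zero again to its right. *)
Lemma test_function_primitive eta : test_function eta -> \int[leb]_x eta x = 0 ->
  exists2 phi, test_function phi & derive1 phi = eta.
Proof.
move=> teta eta0; have [M M0 MP] := test_function_support teta.
have ceta := test_function_continuous teta.
have [F Feta] := primitive_exists (continuous_locint ceta).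
have dF x : is_derive x 1 (fun x => F x - F (- M)) (eta x).
  by rewrite -[eta x]subr0; apply: is_deriveB; exact: primitive_derive.
have dFE : derive1 (fun x => F x - F (- M)) = eta.
  by apply/funext => x; rewrite derive1E (@derive_val _ _ _ _ _ _ _ (dF x)).
exists (fun x => F x - F (- M)) => //.
apply: (@test_functionI _ M) => [[//|n]|x].
  split; first by move=> x; case: (dF x).
  by rewrite dFE; move: n; apply/smoothP; case: teta.
have [_ FE] := Feta.
have [x0|x0] := leP 0 x => Mx.
  rewrite FE; last by lra.
  rewrite -(@Rintegral_support `[- M, x])// => y yM; apply: (MP y _).1.
  rewrite leNgt; apply/negP; rewrite ltr_norml => /andP[y1 y2].
  by apply: yM; rewrite /= in_itv/= (ltW y1)/= ltW// (lt_le_trans y2)// -(ger0_norm x0).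
rewrite ltr0_norm// in Mx; rewrite -opprB FE; last by lra.
rewrite (@eq_Rintegral _ _ _ _ _ (cst 0)) ?Rintegral_cst//= ?mul0r ?oppr0//.
move=> y; rewrite inE/= in_itv/= => /andP[_ yM]; apply: (MP y _).1.
by rewrite -normrN (le_trans _ (ler_norm _))// lerNr (le_trans yM)// lerNr.
Qed.

Let bump n a b x := flat 0 (n.+1%:R * (x - a)) * flat 0 (n.+1%:R * (b - x)).

Let flat_cvg1 c : 0 < c -> (fun n => flat 0 (n.+1%:R * c)) @ \oo --> (1 : R).
Proof.
move=> c0; have -> : (fun n => flat 0 (n.+1%:R * c)) = (fun n : nat => expR (- (c^-1 * n.+1%:R^-1))).
  by apply/funext => n; rewrite /flat mulr_gt0// expr0 mul1r invfM mulrC.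
rewrite -[X in _ --> X]expR0; apply: continuous_cvg; first exact: continuous_expR.
rewrite -[X in _ --> X]oppr0; apply: cvgN; rewrite -[X in _ --> X](mulr0 c^-1).
by apply: cvgMr; exact: cvg_harmonic.
Qed.

Lemma flat0_le1 x : flat 0 x <= 1.
Proof.
by rewrite /flat; case: ifP => // x0; rewrite expr0 mul1r expR_le1 oppr_le0 invr_ge0 ltW.
Qed.

Let bump_cvg h s t : locint h -> s < t ->
  (fun n => \int[leb]_x (h x * bump n s t x)) @ \oo --> \int[leb]_(x in `[s, t]) h x.
Proof.
move=> hi st.
have mst : measurable (`]s, t[ : set (measurableTypeR R)) by exact: measurable_itv.
have hst : leb.-integrable `]s, t[ (EFin \o h).
  by apply: integrableS (hi.2 s t) => //; exact: subset_itv_oo_cc.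
have -> : \int[leb]_(x in `[s, t]) h x = \int[leb]_(x in `]s, t[) h x.
  rewrite -Rintegral_itv_obnd_cbnd ?Rintegral_itv_bndo_bndc//.
  by apply: integrableS (hi.2 s t) => //; exact: subset_itv_oc_cc.
have b0 n x : ~ [set` `]s, t[] x -> bump n s t x = 0.
  move=> xst; have [xs|sx] := leP x s.
    by rewrite /bump {1}/flat ifN ?mul0r// -leNgt mulr_ge0_le0// subr_le0.
  have [tx|xt] := leP t x; last by exfalso; apply: xst; rewrite /= in_itv/= sx.
  by rewrite /bump {2}/flat ifN ?mulr0// -leNgt mulr_ge0_le0// subr_le0.
have -> : (fun n => \int[leb]_x (h x * bump n s t x)) =
    (fun n => \int[leb]_(x in `]s, t[) (h x * bump n s t x)).
  by apply/funext => n; apply: Rintegral_support => x /b0 ->; rewrite mulr0.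
apply: (@cvg_Rintegral _ _ _ leb _ _ h (fun x => `|h x|)) => //.
- move=> n; apply: measurable_funTS; apply: measurable_funM; first by case: hi.
  by apply: continuous_measurable_fun; apply: test_function_continuous; exact: test_function_bump.
- exact: integrable_norm.
- move=> x; rewrite /= in_itv/= => /andP[sx xt].
  rewrite -[X in _ --> X]mulr1; apply: cvgMr; rewrite -[X in _ --> X]mulr1.
  by apply: cvgM; apply: flat_cvg1; rewrite subr_gt0.
- move=> n x _; rewrite normrM ler_piMr// /bump normrM !ger0_norm ?flat_ge0//.
  by rewrite mulr_ile1 ?flat_ge0 ?flat0_le1.
Qed.

(** The bumps on [[s, t]] converge boundedly to an indicator, so the integral of [h] over every
    segment vanishes. *)
Lemma fundamental_lemma h : locint h ->
  (forall phi, test_function phi -> \int[leb]_x (h x * phi x) = 0) ->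
  {ae leb, forall x, h x = 0}.
Proof.
move=> hi h0; apply: locint_ae0 => // s t; rewrite le_eqVlt => /predU1P[->|st].
  by rewrite set_itv1 Rintegral_set1.
have := bump_cvg hi st.
have -> : (fun n => \int[leb]_x (h x * bump n s t x)) = cst 0.
  by apply/funext => n; apply: h0; exact: test_function_bump.
by move=> cv; rewrite -(cvg_lim (@Rhausdorff R) cv) lim_cst.
Qed.

Lemma test_function_integral1 : exists2 psi, test_function psi & \int[leb]_x psi x = 1.
Proof.
have [n bn] : exists n, \int[leb]_x (1 * bump n 0 1 x) != 0.
  apply: contrapT => nb.
  have := bump_cvg (locint_cst 1) (@ltr01 R).
  have -> : (fun n => \int[leb]_x (1 * bump n 0 1 x)) = cst 0.
    by apply/funext => n; apply/eqP/negPn/negP => bn; apply: nb; exists n.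
  move=> h; have : \int[leb]_(x in `[0, 1]) 1 = 0 by rewrite -(cvg_lim (@Rhausdorff R) h) lim_cst.
  rewrite Rintegral_cst//.
  rewrite mul1r (_ : fine _ = fine (lebesgue_measure (`[0, 1] : set R)))//.
  by rewrite lebesgue_measure_itv/= lte_fin ltr01/= subr0 => /eqP; rewrite oner_eq0.
have tb := test_function_bump n 0 1.
have ib : leb.-integrable setT (EFin \o bump n 0 1).
  by have := integrableM_test (locint_cst 1) tb; apply: eq_integrable => // x _; rewrite /= mul1r.
rewrite RintegralZl// mul1r in bn.
exists (fun x => (\int[leb]_x (bump n 0 1 x))^-1 * bump n 0 1 x).
  exact: test_functionZ.
by rewrite RintegralZl// mulVf.
Qed.

Lemma du_bois_reymond h : locint h ->
  (forall phi, test_function phi -> \int[leb]_x (h x * derive1 phi x) = 0) ->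
  exists c, {ae leb, forall x, h x = c}.
Proof.
move=> hi h0; have [psi tpsi psi1] := test_function_integral1.
pose c := \int[leb]_x (h x * psi x); exists c.
have hc : locint (fun x => h x - c) by apply: locintB => //; exact: locint_cst.
suff : {ae leb, forall x, h x - c = 0} by apply: filterS => x /eqP; rewrite subr_eq0 => /eqP.
apply: fundamental_lemma => // phi tphi; pose p := \int[leb]_x phi x.
have i1 phi' : test_function phi' -> leb.-integrable setT (EFin \o phi').
  move=> /(integrableM_test (locint_cst 1)); apply: eq_integrable => // x _.
  by rewrite /= mul1r.
(* Subtracting [p] times a test function of integral 1 leaves a test function of integral 0, hence
   the derivative of a test function, against which [h] integrates to 0. *)
have teta : test_function (fun x => phi x + (- p) * psi x).
  by apply: test_functionD => //; exact: test_functionZ.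
have [|Phi tPhi PhiE] := test_function_primitive teta.
  rewrite RintegralD//; [|exact: i1|by apply: i1; exact: test_functionZ].
  by rewrite RintegralZl//; [rewrite psi1 mulr1 subrr|exact: i1].
have := h0 _ tPhi; rewrite PhiE.
have -> : (fun x => h x * (phi x + (- p) * psi x)) = (fun x => h x * phi x + (- p) * (h x * psi x)).
  by apply/funext => x; ring.
have i2 := integrableM_test hi tpsi.
have i3 : leb.-integrable setT (EFin \o (fun x => (- p) * (h x * psi x))).
  by have := integrableZl measurableT (- p) i2; apply: eq_integrable.
rewrite RintegralD//; last exact: integrableM_test.
rewrite RintegralZl// -/c => hphi.
transitivity (\int[leb]_x (h x * phi x + (- c) * phi x)).
  by apply: eq_Rintegral => x _; ring.
have i4 : leb.-integrable setT (EFin \o (fun x => (- c) * phi x)).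
  by have := integrableZl measurableT (- c) (i1 _ tphi); apply: eq_integrable.
rewrite RintegralD//; last exact: integrableM_test.
by rewrite RintegralZl//; [rewrite -hphi -/p; ring|exact: i1].
Qed.

Lemma primitive_weak F f phi : primitive F f -> test_function phi ->
  \int[leb]_x (F x * derive1 phi x) = - \int[leb]_x (f x * phi x).
Proof.
move=> Ff tphi; have [M M0 MP] := test_function_support tphi.
have Fi := continuous_locint (primitive_continuous Ff).
apply/eqP; rewrite -addr_eq0 addrC -RintegralD//; last 2 first.
- by apply: integrableM_test => //; case: Ff.
- exact: integrableM_test'.
rewrite (@Rintegral_support `[- M, M]); last first.
  by move=> x /not_itvN /MP[-> ->]; rewrite !mulr0 addr0.
have [_ <-] := primitiveM Ff (primitive_C1 (test_function_C1 tphi)); last by lra.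
have [-> _] := MP M (ler_norm _).
have [-> _] : phi (- M) = 0 /\ derive1 phi (- M) = 0 by apply: MP; rewrite normrN ler_norm.
by rewrite !mulr0 subrr.
Qed.

(** The difference of [f] and a primitive of [g] has weak derivative zero, so it is constant. *)
Lemma weak_primitive f g : locint f -> locint g ->
  (forall phi, test_function phi ->
    \int[leb]_x (f x * derive1 phi x) = - \int[leb]_x (g x * phi x)) ->
  exists2 F, primitive F g & {ae leb, forall x, f x = F x}.
Proof.
move=> fi gi fg; have [G Gg] := primitive_exists gi.
have Gi := continuous_locint (primitive_continuous Gg).
have [|c hc] := @du_bois_reymond (fun x => f x - G x) (locintB fi Gi).
  move=> phi tphi; under eq_Rintegral do rewrite mulrBl.
  rewrite RintegralB//; [|exact: integrableM_test'|exact: integrableM_test'].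
  by rewrite fg// (primitive_weak Gg tphi) subrr.
exists (fun x => G x + c).
  by have := primitiveD Gg (primitive_cst c); under [X in primitive _ X -> _]eq_fun do rewrite addr0.
by apply: filterS hc => x <-; rewrite addrC subrK.
Qed.

End test_functions.

(** * Integration with respect to the zigzag measure *)

Section density.
Context d (T : measurableType d) (R : realType).
Variables (mu nu : {measure set T -> \bar R}) (w : T -> R).
Hypothesis mw : measurable_fun setT w.
Hypothesis w0 : forall x, 0 <= w x.
Hypothesis nuE : forall A, measurable A -> nu A = (\int[mu]_(x in A) (w x)%:E)%E.

Import HBNNSimple.

Lemma ge0_integral_density (f : T -> \bar R) : measurable_fun setT f ->
  (forall x, 0 <= f x)%E -> (\int[nu]_x f x = \int[mu]_x (f x * (w x)%:E))%E.
Proof.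
move=> mf f0; pose h := nnsfun_approx measurableT mf.
have mh n : measurable_fun setT (EFin \o h n) by exact/measurable_EFinP.
have hw n x : (0 <= (EFin \o h n) x * (w x)%:E)%E by rewrite mule_ge0 ?lee_fin.
have -> : (\int[nu]_x f x = lim (\int[nu]_x (EFin \o h n) x @[n --> \oo]))%E.
  have fE x : f x = lim ((EFin \o h n) x @[n --> \oo]).
    by apply/esym/cvg_lim => //; exact: cvg_nnsfun_approx.
  under eq_integral => x _ do rewrite fE.
  apply: monotone_convergence => //.
  - by move=> n x _ /=; rewrite lee_fin.
  - by move=> x _ a b ab; rewrite lee_fin; exact/lefP/nd_nnsfun_approx.
have -> : (\int[mu]_x (f x * (w x)%:E) =
    lim (\int[mu]_x ((EFin \o h n) x * (w x)%:E) @[n --> \oo]))%E.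
  have fE x : (f x * (w x)%:E = lim (((EFin \o h n) x * (w x)%:E) @[n --> \oo]))%E.
    by apply/esym/cvg_lim => //; apply: cvgeZr => //; exact: cvg_nnsfun_approx.
  under eq_integral => x _ do rewrite fE.
  apply: monotone_convergence => //.
  - by move=> n; apply: emeasurable_funM => //; exact/measurable_EFinP.
  - by move=> x _ a b ab; rewrite lee_wpmul2r ?lee_fin//; exact/lefP/nd_nnsfun_approx.
suff suf n : (\int[nu]_x (EFin \o h n) x = \int[mu]_x ((EFin \o h n) x * (w x)%:E))%E.
  by under eq_fun do rewrite suf.
have mi r : measurable (h n @^-1` [set r]) by exact: measurable_sfunP.
transitivity (\int[nu]_x (\sum_(y \in range (h n)) (y * \1_(h n @^-1` [set y]) x)%:E))%E.
  by apply: eq_integral => t _; rewrite /= fimfunE -fsumEFin.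
have indich r : measurable_fun setT (fun x => (r * \1_(h n @^-1` [set r]) x)%:E).
  by apply/measurable_EFinP; exact: measurable_funM.
have ind0 r x : (0 <= (r * \1_(h n @^-1` [set r]) x)%:E)%E by exact: nnfun_muleindic_ge0.
rewrite ge0_integral_fsum//.
transitivity (\int[mu]_x (\sum_(y \in range (h n))
    (y * \1_(h n @^-1` [set y]) x)%:E * (w x)%:E))%E; last first.
  apply: eq_integral => x _.
  rewrite -ge0_mule_fsuml => [|y]; last exact: ind0.
  by rewrite fsumEFin // -(fimfunE _ x).
rewrite ge0_integral_fsum//; last 2 first.
- by move=> r; apply: emeasurable_funM => //; exact/measurable_EFinP.
- by move=> r x _; rewrite mule_ge0 ?ind0 ?lee_fin.
apply: eq_fsbigr => r /[!inE] -[x0 _ <-]; set r' := h n x0.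
have r0 : 0 <= r' by [].
under eq_integral do rewrite EFinM.
rewrite ge0_integralZl//; last exact/measurable_EFinP.
rewrite integral_indic// setIT nuE//.
under [RHS]eq_integral do rewrite EFinM -muleA.
rewrite ge0_integralZl//; last 2 first.
- by apply: emeasurable_funM => //; exact/measurable_EFinP.
- by move=> x _; rewrite mule_ge0 ?lee_fin.
congr (_ * _)%E; rewrite integral_mkcond; apply: eq_integral => x _.
rewrite patchE indicE; case: (x \in _); first by rewrite mul1e.
by rewrite mul0e.
Qed.

Lemma negligible_density A : measurable A -> (forall x, 0 < w x) ->
  nu A = 0%E <-> mu A = 0%E.
Proof.
move=> mA wp; rewrite nuE//; split=> [A0|A0].
  have : (\int[mu]_(x in A) `|(w x)%:E| = 0)%E.
    by under eq_integral do rewrite gee0_abs ?lee_fin//.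
  have mwA : measurable_fun A (fun x => (w x)%:E).
    by apply/measurable_EFinP; exact: measurable_funTS.
  move/(ae_eq_integral_abs mu mA mwA) => wA0.
  apply/eqP; rewrite -measure_le0.
  have : mu.-negligible A.
    by apply: negligibleS wA0 => x Ax /= /(_ Ax) [] /eqP; rewrite gt_eqF.
  by move/negligibleP => ->.
by rewrite null_set_integral//; apply/measurable_EFinP; exact: measurable_funTS.
Qed.

End density.

(** * Integrals and null sets on the two slices of the state space *)

Section zz_measure_integral.
Context (R : realType) (U : R -> R) (hU : C1 U).
Local Notation leb := (@lebesgue_measure R).
Local Notation E := (measurableTypeR R * bool)%type.
Local Notation w x := (expR (- U x)).
Local Notation mu := (zz_measure hU).

Let mw : measurable_fun setT (fun x : measurableTypeR R => w x).
Proof.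
by apply: measurableT_comp => //; apply: measurableT_comp => //; exact: C1_measurable.
Qed.

Lemma measurable_slice d' (V : measurableType d') (k : E -> V) b :
  measurable_fun setT k -> measurable_fun setT (fun x => k (x, b)).
Proof.
by move=> mk; apply: (measurableT_comp mk); exact: pair2_measurable.
Qed.

Lemma measurable_slicesP d' (V : measurableType d') (k : E -> V) :
  (forall b, measurable_fun setT (fun x => k (x, b))) -> measurable_fun setT k.
Proof.
move=> mk; have -> : k = fun e => if e.2 then k (e.1, true) else k (e.1, false).
  by apply/funext => -[x []].
apply: measurable_fun_ifT => //.
- exact: (measurableT_comp (mk true) measurable_fst).
- exact: (measurableT_comp (mk false) measurable_fst).
Qed.

Lemma ge0_integral_zz (k : E -> \bar R) : measurable_fun setT k -> (forall e, 0 <= k e)%E ->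
  (\int[mu]_e k e = \int[leb]_x (k (x, true) * (w x)%:E) + \int[leb]_x (k (x, false) * (w x)%:E))%E.
Proof.
move=> mk k0.
pose slice b : {measure set E -> \bar R} :=
  measure_function_pushforward__canonical__measure_function_Measure
    (nu hU) (pair2_measurable b).
have -> : (\int[mu]_e k e = \int[measure_add (slice true) (slice false)]_e k e)%E.
  by apply: eq_measure_integral => A mA _; exact/esym/measure_addE.
rewrite ge0_integral_measure_add//.
have sliceE b : (\int[slice b]_e k e = \int[leb]_x (k (x, b) * (w x)%:E))%E.
  rewrite ge0_integral_pushforward//.
  rewrite preimage_setT -(@ge0_integral_density _ _ _ leb (nu hU))//.
  exact: measurable_slice.
by rewrite !sliceE.
Qed.

(** The density [expR (- U x)] is positive, so [nu] and Lebesgue measure have the same null sets.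
    Statements thus move between classes in [L2], taken modulo the zigzag measure, and weak
    derivatives, taken with respect to Lebesgue measure. *)
Lemma ae_zz (P : E -> Prop) :
  {ae mu, forall e, P e} <-> forall b, {ae leb, forall x, P (x, b)}.
Proof.
have nuP A : measurable A -> nu hU A = 0%E <-> leb A = 0%E.
  move=> mA; apply: (@negligible_density _ _ _ leb (nu hU) (fun x => w x)) => // x.
  exact: expR_gt0.
split=> [[N [mN N0 PN]] b|PN].
  have mNb : measurable [set x : measurableTypeR R | N (x, b)].
    have := @pair2_measurable _ _ (measurableTypeR R) bool b measurableT N mN.
    by rewrite setTI.
  exists [set x | N (x, b)]; split=> //.
    apply/nuP => //.
    move: N0; rewrite /zz_measure => /eqP; rewrite padde_eq0 ?measure_ge0// => /andP[/eqP h1 /eqP h2].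
    by case: b mNb.
  by move=> x /= nP; apply: PN.
have [A1 [mA1 A10 PA1]] := PN true; have [A2 [mA2 A20 PA2]] := PN false.
exists [set e | (if e.2 then A1 else A2) e.1]; split.
- have -> : [set e : E | (if e.2 then A1 else A2) e.1] = A1 `*` [set true] `|` A2 `*` [set false].
    apply/seteqP; split=> [[x []] /=|[x b] /= [[h ->]|[h ->]]//]; by [left|right].
  by apply: measurableU; apply: measurableX.
- rewrite /zz_measure /=; have -> : [set x | A1 x] = A1 by [].
  have -> : [set x | A2 x] = A2 by [].
  by rewrite (nuP A1 mA1).2// (nuP A2 mA2).2// adde0.
- by move=> [x []] /= nP; [apply: PA1|apply: PA2].
Qed.

Lemma integrable_zz (k : E -> R) : measurable_fun setT k ->
  mu.-integrable setT (EFin \o k) <->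
  forall b, leb.-integrable setT (EFin \o (fun x => k (x, b) * w x)).
Proof.
move=> mk.
have mkw b : measurable_fun setT (fun x : measurableTypeR R => k (x, b) * w x).
  by apply: measurable_funM => //; exact: measurable_slice.
have absE b x : (`|((k (x, b)) * w x)%:E| = `|(k (x, b))%:E| * (w x)%:E)%E.
  by rewrite EFinM abseM [X in (_ * X)%E]gee0_abs// lee_fin expR_ge0.
have mabs : measurable_fun setT (fun e => `|(k e)%:E|)%E.
  by apply: measurableT_comp => //; exact/measurable_EFinP.
split=> [/integrableP[_]|h].
  rewrite ge0_integral_zz// => kfin b; apply/integrableP; split; first exact/measurable_EFinP.
  rewrite (eq_integral (fun x => `|(k (x, b))%:E| * (w x)%:E))%E; last first.
    by move=> x _; exact: absE.
  have i0 b' : (0 <= \int[leb]_x (`|(k (x, b'))%:E| * (w x)%:E))%E.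
    by apply: integral_ge0 => x _; rewrite mule_ge0// lee_fin expR_ge0.
  apply: le_lt_trans kfin; case: b => /=.
    exact: leeDl (i0 false).
  exact: leeDr (i0 true).
apply/integrableP; split; first exact/measurable_EFinP.
rewrite ge0_integral_zz//; apply: lte_add_pinfty.
  have /integrableP[_] := h true; apply: le_lt_trans; rewrite le_eqVlt; apply/orP; left.
  by apply/eqP/eq_integral => x _; exact/esym/absE.
have /integrableP[_] := h false; apply: le_lt_trans; rewrite le_eqVlt; apply/orP; left.
by apply/eqP/eq_integral => x _; exact/esym/absE.
Qed.

Lemma Rintegral_zz (k : E -> R) : mu.-integrable setT (EFin \o k) ->
  \int[mu]_e k e = \int[leb]_x ((k (x, true) + k (x, false)) * w x).
Proof.
move=> ki; have mk : measurable_fun setT k.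
  by apply/measurable_EFinP; exact: measurable_int ki.
have ge0 (f : E -> R) : mu.-integrable setT (EFin \o f) -> (forall e, 0 <= f e) ->
    \int[mu]_e f e = \int[leb]_x (f (x, true) * w x) + \int[leb]_x (f (x, false) * w x).
  move=> fi f0; have mf : measurable_fun setT f.
    by apply/measurable_EFinP; exact: measurable_int fi.
  have fib := (integrable_zz mf).1 fi.
  rewrite /Rintegral ge0_integral_zz//=; last exact/measurable_EFinP.
  have fin b : (\int[leb]_x ((f (x, b))%:E * (w x)%:E))%E \is a fin_num.
    by have := integrable_fin_num measurableT (fib b).
  by rewrite fineD.
have ni : mu.-integrable setT (EFin \o (fun e => `|k e|)) by exact: integrable_norm.
have di : mu.-integrable setT (EFin \o (fun e => `|k e| - k e)).
  by have := integrableB measurableT ni ki; apply: eq_integrable.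
(* A signed integrand is the difference of the two nonnegative functions |k| and |k| - k, to which
   [ge0] applies. *)
have kE e : k e = `|k e| - (`|k e| - k e) by rewrite subKr.
transitivity (\int[mu]_e (`|k e| - (`|k e| - k e))).
  by apply: eq_Rintegral => e _; exact: kE.
rewrite RintegralB// !ge0//; last by move=> e; rewrite subr_ge0 ler_norm.
have int f : mu.-integrable setT (EFin \o f) -> forall b,
    leb.-integrable setT (EFin \o (fun x => f (x, b) * w x)).
  by move=> fi; apply/integrable_zz => //; apply/measurable_EFinP; exact: measurable_int fi.
have nib := int _ ni; have dib := int _ di.
rewrite opprD addrACA -!RintegralB// -RintegralD//; last 2 first.
- by have := integrableB measurableT (nib true) (dib true); apply: eq_integrable.
- by have := integrableB measurableT (nib false) (dib false); apply: eq_integrable.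
by apply: eq_Rintegral => x _; ring.
Qed.

End zz_measure_integral.

Section L2_misc.
Context d (T : measurableType d) (R : realType).
Variable mu : {measure set T -> \bar R}.

Lemma L2_eqP (u v : L2 mu) : {ae mu, forall x, u x = v x} -> u = v.
Proof.
move=> uv; rewrite -(L2_repK u) -(L2_repK v); apply/L2_classP.
by apply: filterS uv => x uv _; exact: uv.
Qed.

Lemma to_L2P (f : T -> R[i]) : sq_integrable mu f -> {ae mu, forall x, to_L2 mu f x = f x}.
Proof.
move=> fi; rewrite /to_L2; case: pselect => // fi'.
by have := L2_classK (L2Fun (mem_set fi')); apply: filterS => x; exact.
Qed.

Lemma sq_integrable_ae (f g : T -> R[i]) : measurable_funC g ->
  {ae mu, forall x, f x = g x} -> sq_integrable mu f -> sq_integrable mu g.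
Proof.
move=> mg fg /sq_integrableP[mf fi]; apply/sq_integrableP; split=> //.
apply: ae_eq_integrable fi => //; first exact: measurable_sqn.
by apply: filterS fg => x /= ->.
Qed.

End L2_misc.

(** * Weak derivatives and absolutely continuous representatives *)

Section weak.
Context (R : realType).
Local Notation leb := (@lebesgue_measure R).
Local Notation cRe := (@complex.Re R).
Local Notation cIm := (@complex.Im R).
Implicit Types (f g : R -> R[i]) (c : R -> R).

Lemma L2locP f : L2loc f <->
  measurable_funC (f : measurableTypeR R -> R[i]) /\ locint (fun x => sqn (f x)).
Proof.
split=> -[mf fi]; split=> //.
  split; first exact: measurable_sqn.
  move=> a b; apply/integrableP; split.
    by apply/measurable_EFinP/measurable_funTS; exact: measurable_sqn.
  have /fi : compact (`[a, b] : set R) by exact: segment_compact.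
  apply: le_lt_trans; rewrite le_eqVlt; apply/orP; left; apply/eqP.
  by apply: eq_integral => x _; rewrite gee0_abs// lee_fin sqn_ge0.
move=> K cK; have [_ _ /(_ K (@subsetT _ _) cK)] := locint_locally_integrable fi.
apply: le_lt_trans; rewrite le_eqVlt; apply/orP; left; apply/eqP.
by apply: eq_integral => x _; rewrite ger0_norm// sqn_ge0.
Qed.

Lemma L2locD f g : L2loc f -> L2loc g -> L2loc (fun x => f x + g x).
Proof.
move=> /L2locP[mf fi] /L2locP[mg gi]; apply/L2locP.
have mfg := measurable_funCD mf mg; split; first exact: mfg.
apply: (locint_le _ (locintD (locintZ 2 fi) (locintZ 2 gi))).
  exact: (measurable_sqn mfg).
move=> x; rewrite !ger0_norm ?sqn_ge0 ?sqnD//.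
by rewrite addr_ge0// mulr_ge0// sqn_ge0.
Qed.

Lemma sqn_real (a : R) : sqn a%:C = a ^+ 2.
Proof. by rewrite sqnE/= expr0n addr0. Qed.

Lemma continuous_sqr c : continuous c -> continuous (fun x => c x ^+ 2).
Proof. by move=> cc x; exact: (cvgM (cc x) (cc x)). Qed.

Lemma L2locM_continuous c f : continuous c -> L2loc f -> L2loc (fun x => (c x)%:C * f x).
Proof.
move=> cc /L2locP[mf fi]; apply/L2locP; split.
  apply: measurable_funCM => //; split.
    exact: continuous_measurable_fun.
  exact: measurable_cst.
have -> : (fun x => sqn ((c x)%:C * f x)) = (fun x => sqn (f x) * (c x) ^+ 2).
  by apply/funext => x; rewrite sqnM mulrC sqn_real.
by apply: locintM_continuous => //; exact: continuous_sqr.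
Qed.

Lemma L2locZ (a : R[i]) f : L2loc f -> L2loc (fun x => a * f x).
Proof.
move=> /L2locP[mf fi]; apply/L2locP; split.
  by apply: measurable_funCM => //; exact: measurable_funC_cst.
by under eq_fun do rewrite sqnM; exact: locintZ.
Qed.

(** From |h| <= 1 + h^2: on bounded intervals square integrability implies integrability. *)
Lemma sqr_locint (h : R -> R) : measurable_fun setT (h : measurableTypeR R -> R) ->
  forall k, locint k -> (forall x, h x ^+ 2 <= k x) -> locint h.
Proof.
move=> mh k ki hk; apply: (locint_le mh (locintD (locint_cst 1) ki)) => x.
have k0 : 0 <= k x := le_trans (sqr_ge0 _) (hk x).
rewrite [X in _ <= X]ger0_norm ?addr_ge0//.
apply: le_trans (_ : 1 + h x ^+ 2 <= _); last by rewrite lerD2l.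
rewrite -[h x ^+ 2]real_normK ?num_real//; have := sqr_ge0 (`|h x| - 1); move: (normr_ge0 (h x)).
by move: `|h x| => a a0; rewrite sqrrB expr1n mulr1; lra.
Qed.

Lemma L2loc_Re f : L2loc f -> locint (cRe \o f).
Proof.
move=> /L2locP[mf fi]; apply: (sqr_locint _ fi); first by case: mf.
by move=> x; exact: sqr_Re_le.
Qed.

Lemma L2loc_Im f : L2loc f -> locint (cIm \o f).
Proof.
move=> /L2locP[mf fi]; apply: (sqr_locint _ fi); first by case: mf.
by move=> x; exact: sqr_Im_le.
Qed.

Lemma weak_derivativeP f g : weak_derivative f g <-> forall phi, test_function phi ->
  (\int[leb]_x (cRe (f x) * derive1 phi x) = - \int[leb]_x (cRe (g x) * phi x)) /\
  (\int[leb]_x (cIm (f x) * derive1 phi x) = - \int[leb]_x (cIm (g x) * phi x)).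
Proof.
have CE (h : R -> R[i]) c : Cintegral leb setT (fun x => h x * (c x)%:C) =
    (\int[leb]_x (cRe (h x) * c x)) +i* (\int[leb]_x (cIm (h x) * c x)).
  rewrite /Cintegral; congr (_ +i* _); apply: eq_Rintegral => x _; case: (h x) => a b /=.
    by rewrite mulr0 subr0.
  by rewrite mulr0 add0r.
split=> fg phi /fg; rewrite !CE; first by case=> -> ->.
by move=> [-> ->].
Qed.

Definition weak_pair f g := [/\ L2loc f, L2loc g & weak_derivative f g].

(** Together with [weak_pair_intro], this replaces weak differentiability by the existence of
    locally absolutely continuous representatives of both parts, to which [primitiveM] applies. *)
Lemma weak_pair_rep f g : weak_pair f g -> exists Fr Fi : R -> R,
  [/\ primitive Fr (cRe \o g), primitive Fi (cIm \o g),
      {ae leb, forall x, cRe (f x) = Fr x} & {ae leb, forall x, cIm (f x) = Fi x}].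
Proof.
move=> [fi gi /weak_derivativeP fg].
have [Fr pr fr] := weak_primitive (L2loc_Re fi) (L2loc_Re gi) (fun phi t => (fg phi t).1).
have [Fi pi_ fi_] := weak_primitive (L2loc_Im fi) (L2loc_Im gi) (fun phi t => (fg phi t).2).
by exists Fr, Fi.
Qed.

Lemma weak_pair_intro f g (Fr Fi : R -> R) :
  measurable_funC (f : measurableTypeR R -> R[i]) -> L2loc g ->
  primitive Fr (cRe \o g) -> primitive Fi (cIm \o g) ->
  {ae leb, forall x, cRe (f x) = Fr x} -> {ae leb, forall x, cIm (f x) = Fi x} ->
  weak_pair f g.
Proof.
move=> mf gi pr pi_ fr fi; have [cr ci] := (primitive_continuous pr, primitive_continuous pi_).
split=> //.
  apply/L2locP; split=> //.
  have ci2 : continuous (fun x => Fr x ^+ 2 + Fi x ^+ 2).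
    by move=> x; apply: cvgD; apply: continuous_sqr.
  have [_ h] := continuous_locint ci2.
  have ms := measurable_sqn mf; split=> // a b.
  have := h a b; apply: ae_eq_integrable.
  - exact: measurable_itv.
  - exact: measurable_funTS.
  by apply: filterS2 fr fi => x fr fi _; rewrite sqnE fr fi.
apply/weak_derivativeP => phi tphi; rewrite -(primitive_weak pr tphi) -(primitive_weak pi_ tphi).
have [_ cphi'] := test_function_C1 tphi.
have mphi' := continuous_measurable_fun cphi'.
split; apply: ae_eq_Rintegral => //.
- by apply: measurable_funM => //; case: mf.
- by apply: measurable_funM => //; exact: continuous_measurable_fun.
- by apply: filterS fr => x ->.
- by apply: measurable_funM => //; case: mf.
- by apply: measurable_funM => //; exact: continuous_measurable_fun.
- by apply: filterS fi => x ->.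
Qed.

(** Since [wderiv] is an arbitrary choice, this is what allows any other weak derivative in its
    place. *)
Lemma weak_pair_unique f g1 g2 : weak_pair f g1 -> weak_pair f g2 ->
  {ae leb, forall x, g1 x = g2 x}.
Proof.
move=> [_ gi1 /weak_derivativeP fg1] [_ gi2 /weak_derivativeP fg2].
have real_unique (h1 h2 k : R -> R) : locint h1 -> locint h2 ->
    (forall phi, test_function phi ->
      \int[leb]_x (k x * derive1 phi x) = - \int[leb]_x (h1 x * phi x)) ->
    (forall phi, test_function phi ->
      \int[leb]_x (k x * derive1 phi x) = - \int[leb]_x (h2 x * phi x)) ->
    {ae leb, forall x, h1 x = h2 x}.
  move=> h1i h2i k1 k2.
  have : {ae leb, forall x, h1 x - h2 x = 0}.
    apply: fundamental_lemma; first exact: locintB.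
    move=> phi tphi; under eq_Rintegral do rewrite mulrBl.
    rewrite RintegralB//; [|exact: integrableM_test|exact: integrableM_test].
    by apply/eqP; rewrite subr_eq0 -eqr_opp -k1// -k2.
  by apply: filterS => x /eqP; rewrite subr_eq0 => /eqP.
have re := real_unique _ _ _ (L2loc_Re gi1) (L2loc_Re gi2)
  (fun phi t => (fg1 phi t).1) (fun phi t => (fg2 phi t).1).
have im := real_unique _ _ _ (L2loc_Im gi1) (L2loc_Im gi2)
  (fun phi t => (fg1 phi t).2) (fun phi t => (fg2 phi t).2).
by apply: filterS2 re im => x /=; case: (g1 x) (g2 x) => a b [a' b'] /= -> ->.
Qed.

Let Re_linear (a u v : R[i]) : cRe (a * u + v) = cRe a * cRe u - cIm a * cIm u + cRe v.
Proof. by case: a u v => a b [u u'] [v v']. Qed.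

Let Im_linear (a u v : R[i]) : cIm (a * u + v) = cRe a * cIm u + cIm a * cRe u + cIm v.
Proof. by case: a u v => a b [u u'] [v v']. Qed.

Lemma weak_pair_linear (a : R[i]) f f1 f2 g1 g2 :
  measurable_funC (f : measurableTypeR R -> R[i]) ->
  weak_pair f1 g1 -> weak_pair f2 g2 -> {ae leb, forall x, f x = a * f1 x + f2 x} ->
  weak_pair f (fun x => a * g1 x + g2 x).
Proof.
move=> mf fg1 fg2 fE.
have [F1r [F1i [p1r p1i f1r f1i]]] := weak_pair_rep fg1.
have [F2r [F2i [p2r p2i f2r f2i]]] := weak_pair_rep fg2.
have [[_ gi1 _] [_ gi2 _]] := (fg1, fg2).
apply: (@weak_pair_intro _ _ (fun x => cRe a * F1r x - cIm a * F1i x + F2r x)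
                            (fun x => cRe a * F1i x + cIm a * F1r x + F2i x)) => //.
- by apply: L2locD => //; exact: L2locZ.
- have := primitiveD (primitiveB (primitiveZ (cRe a) p1r) (primitiveZ (cIm a) p1i)) p2r.
  by congr primitive; apply/funext => x /=; rewrite Re_linear.
- have := primitiveD (primitiveD (primitiveZ (cRe a) p1i) (primitiveZ (cIm a) p1r)) p2i.
  by congr primitive; apply/funext => x /=; rewrite Im_linear.
- near=> x.
  have -> : f x = a * f1 x + f2 x by near: x.
  have <- : cRe (f1 x) = F1r x by near: x.
  have <- : cIm (f1 x) = F1i x by near: x.
  have <- : cRe (f2 x) = F2r x by near: x.
  exact: Re_linear.
- near=> x.
  have -> : f x = a * f1 x + f2 x by near: x.
  have <- : cRe (f1 x) = F1r x by near: x.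
  have <- : cIm (f1 x) = F1i x by near: x.
  have <- : cIm (f2 x) = F2i x by near: x.
  exact: Im_linear.
Unshelve. all: by end_near. Qed.

Lemma wderivP f : W12loc f -> weak_pair f (wderiv f).
Proof.
move=> [fi [g gi fg]]; rewrite /weak_pair /wderiv.
by case: xgetP => [h _ []|/(_ g)[]].
Qed.

Lemma weak_pair_W12loc f g : weak_pair f g -> W12loc f.
Proof. by move=> [fi gi fg]; split=> //; exists g. Qed.

End weak.

(** * The zigzag operator *)

Section zigzag_operator.
Context (R : realType) (U lrefr : R -> R) (hU : C1 U).
Hypothesis lrefr_continuous : continuous lrefr.
Hypothesis lrefr_ge0 : forall x, 0 <= lrefr x.
Local Notation leb := (@lebesgue_measure R).
Local Notation cRe := (@complex.Re R).
Local Notation cIm := (@complex.Im R).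
Local Notation E := (measurableTypeR R * bool)%type.
Local Notation w x := (expR (- U x)).
Local Notation mu := (zz_measure hU).
Local Notation L := (zigzag hU lrefr).
Local Notation F := (flip hU).
Local Notation dot := (L2_dot mu).
Local Notation rate := (rate U lrefr).

Let U_continuous : continuous U.
Proof.
by move=> x; apply: differentiable_continuous; apply/derivable1_diffP; case: hU.
Qed.

Let U'_continuous : continuous (derive1 U). Proof. by case: hU. Qed.

Lemma rate_continuous b : continuous (fun x => rate (x, b)).
Proof.
move=> x; apply: cvgD; last exact: lrefr_continuous.
apply: (@continuous_max _ _ (fun x => velocity R b * derive1 U x) (fun=> 0)).
  by apply: cvgMr; exact: U'_continuous.
exact: cvg_cst.
Qed.

Lemma rate_true x : rate (x, true) = rate (x, false) + derive1 U x.
Proof.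
rewrite /Defs.rate /velocity /= mul1r mulN1r.
by have [u0|u0] := leP (derive1 U x) 0; case: leP => h; lra.
Qed.

Lemma rate_ge0 e : 0 <= rate e.
Proof. by rewrite addr_ge0// le_max lexx orbT. Qed.

Lemma primitive_expR (V : R -> R) : C1 V ->
  primitive (fun x => expR (V x)) (fun x => expR (V x) * derive1 V x).
Proof.
move=> [dV cV].
have dE (x : R) : is_derive x 1 (fun x => expR (V x)) (expR (V x) * derive1 V x).
  apply: (is_derive1_comp (f := expR) (g := V)).
  by rewrite derive1E; exact/derivableP.
have dEE : derive1 (fun x => expR (V x)) = (fun x => expR (V x) * derive1 V x).
  by apply/funext => x; rewrite derive1E (@derive_val _ _ _ _ _ _ _ (dE x)).
rewrite -dEE; apply: primitive_C1; split; first by move=> x; case: (dE x).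
rewrite dEE => x; apply: cvgM; last exact: cV.
apply: (continuous_comp (f := V) (g := expR)); last exact: continuous_expR.
by apply: differentiable_continuous; apply/derivable1_diffP; exact: dV.
Qed.

Lemma primitive_w : primitive (fun x => w x) (fun x => - (w x * derive1 U x)).
Proof.
have dN x : derive1 (fun x => - U x) x = - derive1 U x.
  by rewrite !derive1E deriveN//; case: hU.
have CN : C1 (fun x => - U x).
  split; first by move=> x; apply: derivableN; case: hU.
  have -> : derive1 (fun x => - U x) = (fun x => - derive1 U x) by apply/funext => x; exact: dN.
  by move=> x; apply: cvgN; exact: U'_continuous.
have := primitive_expR CN; congr primitive.
by apply/funext => x; rewrite dN mulrN.
Qed.

Let w_continuous : continuous (fun x => w x).
Proof. exact: primitive_continuous primitive_w. Qed.

Let mw : measurable_fun setT (fun x : measurableTypeR R => w x).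
Proof. exact: continuous_measurable_fun. Qed.

Lemma measurable_funC_slice (f : E -> R[i]) b : measurable_funC f ->
  measurable_funC (fun x => f (x, b)).
Proof. by move=> [mr mi]; split; [exact: (measurable_slice b mr)|exact: (measurable_slice b mi)]. Qed.

Lemma measurable_funC_slicesP (f : E -> R[i]) :
  (forall b, measurable_funC (fun x => f (x, b))) -> measurable_funC f.
Proof. by move=> mf; split; apply: measurable_slicesP => b; case: (mf b). Qed.

Lemma sq_integrable_zz (f : E -> R[i]) : sq_integrable mu f <->
  measurable_funC f /\ forall b, leb.-integrable setT (EFin \o (fun x => sqn (f (x, b)) * w x)).
Proof.
split=> [/sq_integrableP[mf]|[mf fi]].
  by move/(integrable_zz _ (measurable_sqn mf)) => fi; split.
by apply/sq_integrableP; split=> //; apply/integrable_zz => //; exact: measurable_sqn.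
Qed.

(** The weight can be removed locally, because its inverse [expR (U x)] is continuous. *)
Lemma slice_L2loc (f : E -> R[i]) b : sq_integrable mu f -> L2loc (fun x => f (x, b)).
Proof.
move=> /sq_integrable_zz[mf fi]; apply/L2locP; split; first exact: measurable_funC_slice.
have h1 : locint (fun x => sqn (f (x, b)) * w x).
  split; first by apply/measurable_EFinP; exact: measurable_int (fi b).
  by move=> s t; apply: integrableS (fi b).
have cE : continuous (fun x => expR (U x)).
  by move=> x; apply: (continuous_comp (f := U) (g := expR)); [exact: U_continuous|exact: continuous_expR].
have := locintM_continuous h1 cE; congr locint; apply/funext => x.
by rewrite -mulrA -expRD addNr expR0 mulr1.
Qed.

(** The expression [zz_expr] with a free [g] in place of the chosen weak derivative. Through
    [zz_intro] and [zz_elim], the operator is handled with whichever weak derivative is at hand. *)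
Definition zz_op (f g : E -> R[i]) (e : E) : R[i] :=
  (velocity R e.2)%:C * g e + (rate e)%:C * (f (e.1, ~~ e.2) - f e).

Lemma zz_op_measurable (f g : E -> R[i]) : measurable_funC f -> measurable_funC g ->
  measurable_funC (zz_op f g).
Proof.
move=> mf mg; apply: measurable_funC_slicesP => b.
apply: (@measurable_funCD _ _ _ (fun x => (velocity R b)%:C * g (x, b))
          (fun x => (rate (x, b))%:C * (f (x, ~~ b) - f (x, b)))).
  apply: measurable_funCM; first exact: measurable_funC_cst.
  exact: measurable_funC_slice.
apply: measurable_funCM.
  split; first by apply: continuous_measurable_fun; exact: rate_continuous.
  exact: measurable_cst.
by apply: measurable_funCB; exact: measurable_funC_slice.
Qed.

Lemma zz_intro (f h : L2 mu) (g : E -> R[i]) :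
  (forall b, weak_pair (fun x => f (x, b)) (fun x => g (x, b))) ->
  {ae mu, forall e, zz_op f g e = h e} -> dom L f /\ L f = h.
Proof.
move=> fg fh.
have Wf b : W12loc (fun x => f (x, b)) by exact: weak_pair_W12loc (fg b).
have dg : {ae mu, forall e, zz_expr U lrefr f e = h e}.
  apply/ae_zz => b; have /ae_zz/(_ b) := fh.
  apply: filterS2 (weak_pair_unique (wderivP (Wf b)) (fg b)) => x dgx <-.
  by rewrite /zz_expr /zz_op /= dgx.
have md : measurable_funC (zz_expr U lrefr f).
  apply: (@zz_op_measurable f (fun e => wderiv (fun x => f (x, e.2)) e.1)).
    exact: L2_measurable.
  apply: measurable_funC_slicesP => b /=.
  by have [_ /L2locP[]] := wderivP (Wf b).
have hd : sq_integrable mu (zz_expr U lrefr f).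
  apply: (sq_integrable_ae md _ (L2fun_sq_integrable h)).
  by apply: filterS dg => x ->.
split; first by split.
apply: L2_eqP; apply: filterS2 dg (to_L2P hd) => x <- /= ->.
by [].
Qed.

Lemma zz_elim (f : L2 mu) : dom L f -> exists g : E -> R[i],
  (forall b, weak_pair (fun x => f (x, b)) (fun x => g (x, b))) /\
  {ae mu, forall e, L2_rep (L f) e = zz_op f g e}.
Proof.
move=> [Wf fi]; exists (fun e => wderiv (fun x => f (x, e.2)) e.1); split.
  by move=> b; exact: wderivP.
exact: to_L2P fi.
Qed.

Lemma zigzag_linear : linear_operator L.
Proof.
have lin (a : R[i]) (f g : L2 mu) : dom L f -> dom L g ->
    dom L (a *: f + g) /\ L (a *: f + g) = a *: L f + L g.
  move=> /zz_elim[f' [ff' Lf]] /zz_elim[g' [gg' Lg]].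
  have fgE : {ae mu, forall e, L2_rep (a *: f + g) e = a * f e + g e}.
    apply: filterS2 (L2_addP (a *: f) g) (L2_scaleP a f) => e /= h1 h2.
    by rewrite h1// h2.
  apply: (@zz_intro _ _ (fun e => a * f' e + g' e)).
    move=> b; apply: (weak_pair_linear _ (ff' b) (gg' b)).
      by apply: measurable_funC_slice; exact: L2_measurable.
    by have /ae_zz/(_ b) := fgE.
  have LfgE : {ae mu, forall e, L2_rep (a *: L f + L g) e = a * L2_rep (L f) e + L2_rep (L g) e}.
    apply: filterS2 (L2_addP (a *: L f) (L g)) (L2_scaleP a (L f)) => e /= h1 h2.
    by rewrite h1// h2.
  apply/ae_zz => b.
  have /ae_zz/(_ b) LfgE' := LfgE; have /ae_zz/(_ b) fgE' := fgE.
  have /ae_zz/(_ (~~ b)) fgE'' := fgE.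
  have /ae_zz/(_ b) Lf' := Lf; have /ae_zz/(_ b) Lg' := Lg.
  near=> x.
  have -> : L2_rep (a *: L f + L g) (x, b) = a * L2_rep (L f) (x, b) + L2_rep (L g) (x, b) by near: x.
  have -> : L2_rep (L f) (x, b) = zz_op f f' (x, b) by near: x.
  have -> : L2_rep (L g) (x, b) = zz_op g g' (x, b) by near: x.
  rewrite /zz_op /=.
  have -> : L2_rep (a *: f + g) (x, b) = a * f (x, b) + g (x, b) by near: x.
  have -> : L2_rep (a *: f + g) (x, ~~ b) = a * f (x, ~~ b) + g (x, ~~ b) by near: x.
  ring.
split.
- have : {ae mu, forall e, L2_rep (0 : L2 mu) e = 0}.
    have := L2_scaleP 0 (0 : L2 mu); rewrite scale0r.
    by apply: filterS => e h; rewrite h// mul0r.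
  move=> z0; suff [] : dom L 0 /\ L 0 = 0 by [].
  apply: (@zz_intro 0 0 (fun=> 0)).
    move=> b; have c0 : primitive (fun=> 0) (fun=> 0 : R) by exact: primitive_cst.
    apply: (@weak_pair_intro _ _ (fun=> 0) (fun=> 0) (fun=> 0)).
    - by apply: measurable_funC_slice; exact: L2_measurable.
    - apply/L2locP; split; first exact: measurable_funC_cst.
      by under eq_fun do rewrite sqn_real; exact: locint_cst.
    - exact: c0.
    - exact: c0.
    - by have /ae_zz/(_ b) := z0; apply: filterS => x ->.
    - by have /ae_zz/(_ b) := z0; apply: filterS => x ->.
  apply/ae_zz => b; have /ae_zz/(_ b) z1 := z0; have /ae_zz/(_ (~~ b)) z2 := z0.
  by apply: filterS2 z1 z2 => x z1 z2; rewrite /zz_op /= z1 z2 subrr !mulr0 addr0.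
- by move=> a f g df dg; case: (lin a f g df dg).
- by move=> a f g df dg; case: (lin a f g df dg).
Unshelve. all: by end_near. Qed.

(** The real part of [z] times the conjugate of [z']. *)
Definition Rdot (z z' : R[i]) : R := cRe z * cRe z' + cIm z * cIm z'.

Lemma Rdot_integrable (u v : L2 mu) b :
  leb.-integrable setT (EFin \o (fun x => Rdot (u (x, b)) (v (x, b)) * w x)).
Proof.
have [ri _] := L2_dot_integrable u v.
have mk : measurable_fun setT (fun e => Rdot (u e) (v e)).
  by apply: measurable_funD; apply: measurable_funM; case: (L2_measurable u); case: (L2_measurable v).
apply: ((integrable_zz hU mk).1 _ b).
apply: eq_integrable ri => // e _ /=; congr EFin.
by rewrite /Rdot; case: (u e) (v e) => a c [a' c'] /=; ring.
Qed.

Lemma Re_dotE (u v : L2 mu) : cRe (dot u v) =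
  \int[leb]_x (Rdot (u (x, true)) (v (x, true)) * w x + Rdot (u (x, false)) (v (x, false)) * w x).
Proof.
have [ri _] := L2_dot_integrable u v.
rewrite /L2_dot /Cintegral /= Rintegral_zz//; apply: eq_Rintegral => x _.
rewrite -mulrDl; congr (_ * _); rewrite /Rdot.
case: (u (x, true)) (v (x, true)) => a b [a' b'].
by case: (u (x, false)) (v (x, false)) => c d [c' d'] /=; ring.
Qed.

Lemma weak_pair_ae (f f1 g : R -> R[i]) : measurable_funC (f : measurableTypeR R -> R[i]) ->
  {ae leb, forall x, f x = f1 x} -> weak_pair f1 g -> weak_pair f g.
Proof.
move=> mf ff1 fg; have [Fr [Fi [pr pi_ fr fi]]] := weak_pair_rep fg.
have [_ gi _] := fg; apply: (weak_pair_intro mf gi pr pi_).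
  by apply: filterS2 ff1 fr => x ->.
by apply: filterS2 ff1 fi => x ->.
Qed.

(** The majorant of [a] is the expanded derivative of the flux (Rdot u^+ v^+ - Rdot u^- v^-) e^{-U},
    the term with U' coming from the weight; the flux is integrable because [u] and [v] are in L^2.
    The one-sided form lets dissipativity discard the jump term without showing it integrable, while
    the adjoint relation uses it with equality. *)
Lemma flux_integral_le0 (u v : L2 mu) (u' v' : E -> R[i]) (a : R -> R) :
  (forall b, weak_pair (fun x => u (x, b)) (fun x => u' (x, b))) ->
  (forall b, weak_pair (fun x => v (x, b)) (fun x => v' (x, b))) ->
  leb.-integrable setT (EFin \o a) ->
  {ae leb, forall x, a x <=
    (Rdot (u' (x, true)) (v (x, true)) + Rdot (u (x, true)) (v' (x, true)) -
     (Rdot (u' (x, false)) (v (x, false)) + Rdot (u (x, false)) (v' (x, false))) -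
     derive1 U x * (Rdot (u (x, true)) (v (x, true)) - Rdot (u (x, false)) (v (x, false)))) * w x} ->
  \int[leb]_x a x <= 0.
Proof.
move=> uu' vv' ai aq.
have [utr [uti [putr puti utrE utiE]]] := weak_pair_rep (uu' true).
have [ufr [ufi [pufr pufi ufrE ufiE]]] := weak_pair_rep (uu' false).
have [vtr [vti [pvtr pvti vtrE vtiE]]] := weak_pair_rep (vv' true).
have [vfr [vfi [pvfr pvfi vfrE vfiE]]] := weak_pair_rep (vv' false).
have pq := primitiveM (primitiveB
  (primitiveD (primitiveM putr pvtr) (primitiveM puti pvti))
  (primitiveD (primitiveM pufr pvfr) (primitiveM pufi pvfi))) primitive_w.
apply: (primitive_integral_le0 pq _ ai).
- have ii := integrableB measurableT (Rdot_integrable u v true) (Rdot_integrable u v false).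
  have ii' : leb.-integrable setT (EFin \o (fun x : measurableTypeR R =>
      Rdot (L2_rep u (x, true)) (L2_rep v (x, true)) * w x -
      Rdot (L2_rep u (x, false)) (L2_rep v (x, false)) * w x)).
    by have := ii; apply: eq_integrable.
  apply: ae_eq_integrable ii' => //.
    by apply: continuous_measurable_fun; exact: primitive_continuous pq.
  apply: filterS2 (filterI (filterI utrE utiE) (filterI ufrE ufiE))
    (filterI (filterI vtrE vtiE) (filterI vfrE vfiE)) => x /=.
  move=> [[<- <-] [<- <-]] [[<- <-] [<- <-]] _; rewrite /Rdot; ring.
- apply: filterS2 (filterI aq (filterI (filterI utrE utiE) (filterI ufrE ufiE)))
    (filterI (filterI vtrE vtiE) (filterI vfrE vfiE)) => x /=.
  move=> [ax [[<- <-] [<- <-]]] [[<- <-] [<- <-]]; apply: le_trans ax _.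
  by rewrite le_eqVlt; apply/orP; left; apply/eqP; rewrite /Rdot; ring.
Qed.

(** * Dissipativity and the adjoint relation under the flip *)

Lemma zigzag_dissipative : dissipative dot L.
Proof.
move=> f /zz_elim[g [fg Lf]].
have /ae_zz Lfb := Lf; have Lft := Lfb true; have Lff := Lfb false.
have ii : leb.-integrable setT (EFin \o (fun x : measurableTypeR R =>
    Rdot (L2_rep (L f) (x, true)) (L2_rep f (x, true)) * w x +
    Rdot (L2_rep (L f) (x, false)) (L2_rep f (x, false)) * w x)).
  have := integrableD measurableT (Rdot_integrable (L f) f true) (Rdot_integrable (L f) f false).
  by apply: eq_integrable.
(* The flux of [f] with itself is quadratic, so its derivative contains each pairing of [f] with its
   derivative twice. *)
rewrite Re_dotE -(@pmulr_rle0 _ 2)// -RintegralZl//.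
apply: (flux_integral_le0 fg fg); first by have := integrableZl measurableT 2 ii; apply: eq_integrable.
apply: filterS2 Lft Lff => x /= -> ->; rewrite /zz_op /Rdot /= rate_true.
have r0 : 0 <= rate (x, false) by exact: rate_ge0.
have r1 : 0 <= rate (x, false) + derive1 U x by rewrite -rate_true rate_ge0.
have w0 : 0 <= w x by exact: expR_ge0.
move: (rate (x, false)) (derive1 U x) (w x) r0 r1 w0 => l u W l0 lu W0.
case: (L2_rep f (x, true)) (L2_rep f (x, false)) (g (x, true)) (g (x, false)) => [a b] [c d] [a' b'] [c' d'] /=.
rewrite -subr_ge0.
rewrite (_ : _ - _ = (l + (l + u)) * ((a - c) ^+ 2 + (b - d) ^+ 2) * W); last by ring.
by apply: mulr_ge0 => //; apply: mulr_ge0; rewrite addr_ge0 ?sqr_ge0.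
Qed.

Lemma flip_measurable (f : E -> R[i]) : measurable_funC f ->
  measurable_funC (fun e : E => f (e.1, ~~ e.2)).
Proof. by move=> mf; apply: measurable_funC_slicesP => b; exact: (measurable_funC_slice (~~ b) mf). Qed.

Lemma flipP (f : L2 mu) : {ae mu, forall e, L2_rep (F f) e = f (e.1, ~~ e.2)}.
Proof.
apply: to_L2P; have /sq_integrable_zz[mf fi] := L2fun_sq_integrable f.
apply/sq_integrable_zz; split; first exact: flip_measurable.
by move=> b; exact: (fi (~~ b)).
Qed.

Lemma flipK : involutive F.
Proof.
move=> f; apply: L2_eqP; apply/ae_zz => b.
have /ae_zz/(_ b) h1 := flipP (F f); have /ae_zz/(_ (~~ b)) h2 := flipP f.
by apply: filterS2 h1 h2 => x -> /= ->; rewrite negbK.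
Qed.

Lemma dot_ae (u v : L2 mu) (f g : E -> R[i]) : measurable_funC f -> measurable_funC g ->
  {ae mu, forall e, L2_rep u e = f e} -> {ae mu, forall e, L2_rep v e = g e} ->
  dot u v = Cintegral mu setT (fun e => f e * (g e)^*).
Proof.
move=> mf mg uf vg; apply: eq_Cintegral.
- by apply: measurable_funCM; [|apply: measurable_funC_conj]; exact: L2_measurable.
- by apply: measurable_funCM => //; exact: measurable_funC_conj.
by apply: filterS2 uf vg => e -> ->.
Qed.

Lemma flip_symmetric (u v : L2 mu) : dot (F u) v = dot u (F v).
Proof.
have [mu_ mv] := (L2_measurable u, L2_measurable v).
have id_ae (h : L2 mu) : {ae mu, forall e, L2_rep h e = h e} by exact: aeW.
have [ir ij] : integrableC mu (fun e => u (e.1, ~~ e.2) * (v e)^*).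
  apply: (integrableCM _ (L2fun_sq_integrable v)).
  apply: (sq_integrable_ae (flip_measurable mu_) (flipP u)); exact: L2fun_sq_integrable.
have [jr ji] : integrableC mu (fun e => u e * (v (e.1, ~~ e.2))^*).
  apply: (integrableCM (L2fun_sq_integrable u)).
  apply: (sq_integrable_ae (flip_measurable mv) (flipP v)); exact: L2fun_sq_integrable.
rewrite (dot_ae (flip_measurable mu_) mv (flipP u) (id_ae v)).
rewrite (dot_ae mu_ (flip_measurable mv) (id_ae u) (flipP v)).
by rewrite /Cintegral !Rintegral_zz//; congr (_ +i* _); apply: eq_Rintegral => x _ /=;
  rewrite addrC.
Qed.

(** Take for [c] the conjugate of z - z'. This upgrades the one-sided bound of [flux_integral_le0],
    valid for all multiples of [f], to an equality of complex inner products. *)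
Lemma Re_le_eq (z z' : R[i]) : (forall c, cRe (c * z) <= cRe (c * z')) -> z = z'.
Proof.
case: z z' => [a b] [a' b'] zz'; have := zz' ((a - a') -i* (b - b')).
rewrite /= -subr_le0 (_ : _ - _ = (a - a') ^+ 2 + (b - b') ^+ 2); last by ring.
move=> le0; have : (a - a') ^+ 2 + (b - b') ^+ 2 == 0.
  by rewrite eq_le le0 addr_ge0 ?sqr_ge0.
by rewrite paddr_eq0 ?sqr_ge0// !sqrf_eq0 !subr_eq0 => /andP[/eqP -> /eqP ->].
Qed.

(** Suffixes [t] and [f] denote the velocities +1 and -1; [gt], [gf] and [vt], [vf] are the
    derivatives of [ft], [ff] and [Vt], [Vf], and [Lt], [Lf], [Kt], [Kf] the values of the operator.
    The second factor of the flux is the flipped function, which is why [Vf] is paired with [Lt].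
    The jump terms cancel up to lt - lf = u, which accounts for the derivative of the weight. *)
Lemma flux_identity (W lt lf u : R) (Lt Lf Vt Vf Kt Kf ft ff gt gf vt vf : R[i]) :
  lt = lf + u ->
  Lt = 1%:C * gt + lt%:C * (ff - ft) -> Lf = (- 1)%:C * gf + lf%:C * (ft - ff) ->
  Kt = 1%:C * vt + lt%:C * (Vf - Vt) -> Kf = (- 1)%:C * vf + lf%:C * (Vt - Vf) ->
  Rdot Lt Vf * W + Rdot Lf Vt * W - (Rdot ft Kf * W + Rdot ff Kt * W) =
  (Rdot gt Vf + Rdot ft vf - (Rdot gf Vt + Rdot ff vt) - u * (Rdot ft Vf - Rdot ff Vt)) * W.
Proof.
move=> -> -> -> -> ->; rewrite /Rdot.
case: ft ff gt gf => [a b] [c d] [a' b'] [c' d'].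
by case: Vt Vf vt vf => [p q] [r s] [p' q'] [r' s'] /=; ring.
Qed.

Lemma flip_adjoint (f v : L2 mu) : dom L f -> dom L v -> dot (L f) (F v) = dot f (F (L v)).
Proof.
move=> df dv.
have le f' : dom L f' -> cRe (dot (L f') (F v)) <= cRe (dot f' (F (L v))).
  move=> /zz_elim[g [fg Lf]]; have [vd [vvd Lv]] := zz_elim dv.
  have Fvd b : weak_pair (fun x => L2_rep (F v) (x, b)) (fun x => vd (x, ~~ b)).
    apply: (weak_pair_ae _ _ (vvd (~~ b))).
      by apply: measurable_funC_slice; exact: L2_measurable.
    by have /ae_zz/(_ b) := flipP v.
  have ii1 : leb.-integrable setT (EFin \o (fun x : measurableTypeR R =>
      Rdot (L2_rep (L f') (x, true)) (L2_rep (F v) (x, true)) * w x +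
      Rdot (L2_rep (L f') (x, false)) (L2_rep (F v) (x, false)) * w x)).
    have := integrableD measurableT (Rdot_integrable (L f') (F v) true)
      (Rdot_integrable (L f') (F v) false).
    by apply: eq_integrable.
  have ii2 : leb.-integrable setT (EFin \o (fun x : measurableTypeR R =>
      Rdot (L2_rep f' (x, true)) (L2_rep (F (L v)) (x, true)) * w x +
      Rdot (L2_rep f' (x, false)) (L2_rep (F (L v)) (x, false)) * w x)).
    have := integrableD measurableT (Rdot_integrable f' (F (L v)) true)
      (Rdot_integrable f' (F (L v)) false).
    by apply: eq_integrable.
  rewrite -subr_le0 [X in X - _ <= _]Re_dotE [X in _ - X <= _]Re_dotE.
  rewrite -(RintegralB measurableT ii1 ii2).
  apply: (@flux_integral_le0 f' (F v) g (fun e => vd (e.1, ~~ e.2)) _ fg Fvd).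
    by have := integrableB measurableT ii1 ii2; apply: eq_integrable.
  have /ae_zz Lf' := Lf; have /ae_zz Lv' := Lv; have /ae_zz Fv' := flipP v.
  have /ae_zz FLv' := flipP (L v).
  apply: filterS2 (filterI (filterI (Lf' true) (Lf' false)) (filterI (Lv' true) (Lv' false)))
    (filterI (filterI (Fv' true) (Fv' false)) (filterI (FLv' true) (FLv' false))) => x /=.
  move=> [[e1 e2] [e3 e4]] [[e5 e6] [e7 e8]].
  have e := flux_identity (w x) (rate_true x) e1 e2 e3 e4.
  by rewrite e5 e6 e7 e8 /=; rewrite -[leRHS]e lexx.
have [d0 dlin Llin] := zigzag_linear.
have L0 : L 0 = 0.
  have := Llin 1 _ _ d0 d0; rewrite !scale1r addr0 => /esym/eqP.
  by rewrite -subr_eq0 addrK => /eqP.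
apply: Re_le_eq => c; have := le _ (dlin c _ _ df d0).
have -> : L (c *: f + 0) = c *: L f + L 0 by exact: Llin.
rewrite L0 !addr0.
have dotZ (u v' : L2 mu) : dot (c *: u) v' = c * dot u v' by rewrite linearZl_LR.
by rewrite [X in cRe X <= _]dotZ [X in _ <= cRe X]dotZ.
Qed.

(** * Testing the operator on smooth functions carried by one velocity *)

Lemma sq_integrable_support (k : E -> R) :
  (forall b, continuous (fun x : R => k (x, b))) ->
  (forall b, exists M, forall x, M <= `|x| -> k (x, b) = 0) ->
  sq_integrable mu (fun e => (k e)%:C).
Proof.
move=> ck kM; apply/sq_integrable_zz; split.
  apply: measurable_funC_slicesP => b; split; last exact: measurable_cst.
  exact: (continuous_measurable_fun (ck b)).
move=> b; have [M MP] := kM b.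
have cw : continuous (fun x => k (x, b) * w x).
  by move=> x; apply: cvgM; [exact: ck|exact: w_continuous].
have := integrableM_support (continuous_locint cw) (ck b) MP.
by apply: eq_integrable => // x _ /=; rewrite sqn_real; congr EFin; ring.
Qed.

Lemma dot_real (k : E -> R) (v : L2 mu) : sq_integrable mu (fun e => (k e)%:C) ->
  dot (to_L2 mu (fun e => (k e)%:C)) v =
  (\int[leb]_x ((k (x, true) * cRe (v (x, true)) + k (x, false) * cRe (v (x, false))) * w x)) -i*
  (\int[leb]_x ((k (x, true) * cIm (v (x, true)) + k (x, false) * cIm (v (x, false))) * w x)).
Proof.
move=> ki; have [mk _] := ki.
have [ir ii] := integrableCM ki (L2fun_sq_integrable v).
rewrite (dot_ae mk (L2_measurable v) (to_L2P ki) (aeW _ (fun=> erefl))).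
have jj : mu.-integrable setT (EFin \o (fun e => k e * cIm (v e))).
  have := integrableZl measurableT (-1) ii; apply: eq_integrable => // e _ /=.
  by rewrite -EFinM; congr EFin; case: (v e) => a b /=; ring.
rewrite /Cintegral; congr (_ +i* _).
  rewrite Rintegral_zz//; apply: eq_Rintegral => x _.
  by case: (v (x, true)) (v (x, false)) => a b [a' b'] /=; ring.
rewrite -(Rintegral_zz jj) -mulN1r -RintegralZl//.
by apply: eq_Rintegral => e _; case: (v e) => a b /=; ring.
Qed.

Definition test_element (phi : R -> R) b (e : E) : R := if e.2 == b then phi e.1 else 0.

(** The value of the operator on [test_element phi b], with the classical derivative of [phi]. It is
    real-valued, continuous and compactly supported on each slice, hence square integrable. *)
Definition test_image (phi : R -> R) b (e : E) : R :=
  velocity R e.2 * test_element (derive1 phi) b e +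
  rate e * (test_element phi b (e.1, ~~ e.2) - test_element phi b e).

Lemma test_elementP (phi : R -> R) b : test_function phi ->
  [/\ sq_integrable mu (fun e => (test_element phi b e)%:C),
      sq_integrable mu (fun e => (test_image phi b e)%:C),
      dom L (to_L2 mu (fun e => (test_element phi b e)%:C)) &
      L (to_L2 mu (fun e => (test_element phi b e)%:C)) =
        to_L2 mu (fun e => (test_image phi b e)%:C)].
Proof.
move=> tphi; have cphi := test_function_continuous tphi.
have [dphi cphi'] := test_function_C1 tphi.
have [M M0 MP] := test_function_support tphi.
have ct b' : continuous (fun x : R => test_element phi b (x, b')).
  by rewrite /test_element /=; case: (b' == b) => // x; exact: cvg_cst.
have ct' b' : continuous (fun x : R => test_element (derive1 phi) b (x, b')).
  by rewrite /test_element /=; case: (b' == b) => // x; exact: cvg_cst.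
have t0 e : M <= `|e.1| -> test_element phi b e = 0.
  by rewrite /test_element => /MP[-> _]; rewrite if_same.
have t'0 e : M <= `|e.1| -> test_element (derive1 phi) b e = 0.
  by rewrite /test_element => /MP[_ ->]; rewrite if_same.
have ti : sq_integrable mu (fun e => (test_element phi b e)%:C).
  by apply: sq_integrable_support => // b'; exists M => x; exact: (t0 (x, b')).
have t'i : sq_integrable mu (fun e => (test_element (derive1 phi) b e)%:C).
  by apply: sq_integrable_support => // b'; exists M => x; exact: (t'0 (x, b')).
have ii : sq_integrable mu (fun e => (test_image phi b e)%:C).
  apply: sq_integrable_support => b'.
    move=> x; apply: cvgD; first by apply: cvgMr; exact: ct'.
    apply: cvgM; first exact: rate_continuous.
    by apply: cvgB; exact: ct.
  exists M => x Mx; rewrite /test_image (t'0 (x, b'))// (t0 (x, ~~ b'))// (t0 (x, b'))//.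
  by rewrite subrr !mulr0 addr0.
have tae := to_L2P ti; have [mt _] := ti.
suff [] : dom L (to_L2 mu (fun e => (test_element phi b e)%:C)) /\
    L (to_L2 mu (fun e => (test_element phi b e)%:C)) = to_L2 mu (fun e => (test_image phi b e)%:C).
  by [].
apply: (@zz_intro _ _ (fun e => (test_element (derive1 phi) b e)%:C)).
  move=> b'; have c0 : primitive (fun=> 0) (fun=> 0 : R) by exact: primitive_cst.
  have pt : primitive (fun x => test_element phi b (x, b'))
      (fun x => test_element (derive1 phi) b (x, b')).
    have pphi : primitive phi (derive1 phi) by exact: primitive_C1.
    by rewrite /test_element /=; case: (b' == b); [exact: pphi|exact: c0].
  apply: (@weak_pair_intro _ _ _ (fun x => test_element phi b (x, b')) (fun=> 0)).
  - by apply: measurable_funC_slice; exact: L2_measurable.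
  - exact: (slice_L2loc b' t'i).
  - exact: pt.
  - exact: c0.
  - by have /ae_zz/(_ b') := tae; apply: filterS => x ->.
  - by have /ae_zz/(_ b') := tae; apply: filterS => x ->.
apply/ae_zz => b'; have /ae_zz tae' := tae; have /ae_zz/(_ b') iae := to_L2P ii.
apply: filterS2 (filterI (tae' b') (tae' (~~ b'))) iae => x [h1 h2] ->.
rewrite /zz_op h1 /= h2 /test_image /=.
move: (rate (x, b')) (test_element (derive1 phi) b (x, b')) => l t'.
by rewrite [in RHS]rmorphD !rmorphM rmorphB.
Qed.

(** Test elements carried by one velocity isolate each slice of [g], and the fundamental lemma
    applies to the real and imaginary parts of the slice times e^{-U}. *)
Lemma zigzag_nondegenerate (g : L2 mu) : (forall f, dom L f -> dot f g = 0) -> g = 0.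
Proof.
move=> g0.
have ri b : locint (fun x => cRe (g (x, b)) * w x).
  apply: locintM_continuous => //.
  exact: (L2loc_Re (slice_L2loc b (L2fun_sq_integrable g))).
have ii b : locint (fun x => cIm (g (x, b)) * w x).
  apply: locintM_continuous => //.
  exact: (L2loc_Im (slice_L2loc b (L2fun_sq_integrable g))).
have z b : {ae leb, forall x, L2_rep g (x, b) = 0}.
  have h1 : {ae leb, forall x, cRe (g (x, b)) * w x = 0}.
    apply: fundamental_lemma => // phi tphi.
    have [ti _ df _] := test_elementP b tphi.
    have := g0 _ df; rewrite dot_real// => -[+ _]; apply: etrans.
    by apply: eq_Rintegral => x _; rewrite /test_element; case: b {ti df}; rewrite /=; ring.
  have h2 : {ae leb, forall x, cIm (g (x, b)) * w x = 0}.
    apply: fundamental_lemma => // phi tphi.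
    have [ti _ df _] := test_elementP b tphi.
    have := g0 _ df; rewrite dot_real// => -[_ /eqP]; rewrite oppr_eq0 => /eqP; apply: etrans.
    by apply: eq_Rintegral => x _; rewrite /test_element; case: b {ti df h1}; rewrite /=; ring.
  apply: filterS2 h1 h2 => x.
  have /gt_eqF w0 : 0 < w x by exact: expR_gt0.
  move=> /eqP; rewrite mulf_eq0 w0 orbF => /eqP re /eqP; rewrite mulf_eq0 w0 orbF => /eqP.
  by move: re; case: (L2_rep g (x, b)) => a b' /= -> ->.
have : {ae mu, forall e, L2_rep g e = 0} by apply/ae_zz.
move=> gae; apply: L2_eqP; have := L2_scaleP 0 (0 : L2 mu); rewrite scale0r.
by apply: filterS2 gae => e -> h; rewrite h// mul0r.
Qed.

Lemma primitive_ae (f g G : R -> R) : measurable_fun setT (g : measurableTypeR R -> R) ->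
  {ae leb, forall x, f x = g x} -> primitive G f -> primitive G g.
Proof.
move=> mg fg [[mf fi] GE]; split.
  split=> // a b; apply: (ae_eq_integrable _ _ _ (fi a b)) => //.
    exact: measurable_funTS.
  by apply: filterS fg => x ->.
move=> a b ab; rewrite GE//; apply: ae_eq_Rintegral => //.
- exact: measurable_funTS.
- exact: measurable_funTS.
- by apply: filterS fg => x ->.
Qed.

(** Testing with phi at velocity theta gives, for the slices g, h at theta and the slice g' at
    -theta, (g e^{-U})' = - theta (h + lambda_theta g - lambda_{-theta} g') e^{-U} weakly, since 1 /
    theta = theta. Multiplying by e^U adds the term U' g. *)
Lemma weak_pair_adjoint (g h : L2 mu) b :
  (forall f, dom L f -> dot (L f) g = dot f h) ->
  weak_pair (fun x => g (x, b)) (fun x =>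
    (- velocity R b)%:C * (h (x, b) + (rate (x, b))%:C * g (x, b)
                           + (- rate (x, ~~ b))%:C * g (x, ~~ b))
    + (derive1 U x)%:C * g (x, b)).
Proof.
move=> gh.
pose D x := (- velocity R b)%:C * (h (x, b) + (rate (x, b))%:C * g (x, b)
                           + (- rate (x, ~~ b))%:C * g (x, ~~ b)).
have gi b' := slice_L2loc b' (L2fun_sq_integrable g).
have hi b' := slice_L2loc b' (L2fun_sq_integrable h).
have Di : L2loc D.
  apply: L2locZ; apply: L2locD.
    by apply: L2locD => //; apply: L2locM_continuous => //; exact: rate_continuous.
  apply: L2locM_continuous => // x; apply: cvgN; exact: rate_continuous.
have U'gi : L2loc (fun x => (derive1 U x)%:C * g (x, b)) by apply: L2locM_continuous.
have DUi := L2locD Di U'gi.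
(* [p] stands for the real or the imaginary part. Test functions are real, so the relation between
   complex inner products splits into one relation for each part. *)
have part (p : R[i] -> R) : (forall z z', p (z + z') = p z + p z') ->
    (forall a z, p (a%:C * z) = a * p z) -> (forall f, L2loc f -> locint (p \o f)) ->
    (forall phi b, test_function phi ->
      \int[leb]_x ((test_image phi b (x, true) * p (g (x, true)) +
                    test_image phi b (x, false) * p (g (x, false))) * w x) =
      \int[leb]_x ((test_element phi b (x, true) * p (h (x, true)) +
                    test_element phi b (x, false) * p (h (x, false))) * w x)) ->
    exists2 G, primitive G (fun x => p (D x + (derive1 U x)%:C * g (x, b))) &
      {ae leb, forall x, p (g (x, b)) = G x}.
  move=> pD pZ pL pgh.
  have pgw : locint (fun x => p (g (x, b)) * w x).
    by apply: locintM_continuous => //; exact: (pL _ (gi b)).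
  have pDw : locint (fun x => p (D x) * w x).
    by apply: locintM_continuous => //; exact: (pL _ Di).
  have [G GD Gg] : exists2 G, primitive G (fun x => p (D x) * w x) &
      {ae leb, forall x, p (g (x, b)) * w x = G x}.
    apply: weak_primitive => // phi tphi.
    have phw : locint (fun x => p (h (x, b)) * w x).
      by apply: locintM_continuous => //; exact: (pL _ (hi b)).
    have v0 : velocity R b != 0 by rewrite /velocity; case: (b); rewrite ?oppr_eq0 oner_eq0.
    have i1 := integrableM_test' pgw tphi.
    have i2 := integrableM_test phw tphi.
    have i3 := integrableM_test pDw tphi.
    have i1' : leb.-integrable setT (EFin \o (fun x : measurableTypeR R =>
        velocity R b * (p (g (x, b)) * w x * derive1 phi x))).
      by have := integrableZl measurableT (velocity R b) i1; apply: eq_integrable.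
    have i3' : leb.-integrable setT (EFin \o (fun x : measurableTypeR R =>
        velocity R b * (p (D x) * w x * phi x))).
      by have := integrableZl measurableT (velocity R b) i3; apply: eq_integrable.
    have i23 : leb.-integrable setT (EFin \o (fun x : measurableTypeR R =>
        p (h (x, b)) * w x * phi x + velocity R b * (p (D x) * w x * phi x))).
      by have := integrableD measurableT i2 i3'; apply: eq_integrable.
    have eL : \int[leb]_x ((test_image phi b (x, true) * p (g (x, true)) +
                    test_image phi b (x, false) * p (g (x, false))) * w x) =
        velocity R b * \int[leb]_x (p (g (x, b)) * w x * derive1 phi x) +
        (\int[leb]_x (p (h (x, b)) * w x * phi x) +
         velocity R b * \int[leb]_x (p (D x) * w x * phi x)).
      rewrite -!RintegralZl// -!RintegralD//; apply: eq_Rintegral => x _.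
      rewrite /D pZ !pD !pZ /test_image /test_element /velocity.
      by case: (b) => /=; ring.
    have eR : \int[leb]_x ((test_element phi b (x, true) * p (h (x, true)) +
                    test_element phi b (x, false) * p (h (x, false))) * w x) =
        \int[leb]_x (p (h (x, b)) * w x * phi x).
      by apply: eq_Rintegral => x _; rewrite /test_element; case: (b) => /=; ring.
    have := pgh phi b tphi; rewrite eL eR addrCA -[RHS]addr0 => /addrI/eqP.
    by rewrite -mulrDr mulf_eq0 (negbTE v0) /= addr_eq0 => /eqP.
  (* [G] represents the slice times e^{-U}; the product rule with e^U recovers the slice itself. *)
  exists (fun x => G x * expR (U x)); last first.
    by apply: filterS Gg => x <-; rewrite -mulrA -expRD addNr expR0 mulr1.
  apply: primitive_ae (primitiveM GD (primitive_expR hU)).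
    by have [] := pL _ DUi.
  apply: filterS Gg => x <-; have : w x * expR (U x) = 1 by rewrite -expRD addNr expR0.
  rewrite pD (pZ (derive1 U x)); move: (w x) (expR (U x)) => a c ac.
  by rewrite -[RHS]mulr1 -ac; ring.
have test_eq phi b' : test_function phi ->
    dot (to_L2 mu (fun e => (test_image phi b' e)%:C)) g =
    dot (to_L2 mu (fun e => (test_element phi b' e)%:C)) h.
  by move=> /(test_elementP b')[_ _ df <-]; exact: gh.
have [Gr pGr gGr] : exists2 G, primitive G (fun x => cRe (D x + (derive1 U x)%:C * g (x, b))) &
      {ae leb, forall x, cRe (g (x, b)) = G x}.
  apply: (part cRe) => [z z'|a z|f|phi b' tphi].
  - by case: z z' => ? ? [].
  - by case: z => ? ? /=; rewrite mul0r subr0.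
  - exact: L2loc_Re.
  - have [ti ii _ _] := test_elementP b' tphi.
    by have := test_eq phi b' tphi; rewrite (dot_real g ii) (dot_real h ti) => -[].
have [Gi pGi gGi] : exists2 G, primitive G (fun x => cIm (D x + (derive1 U x)%:C * g (x, b))) &
      {ae leb, forall x, cIm (g (x, b)) = G x}.
  apply: (part cIm) => [z z'|a z|f|phi b' tphi].
  - by case: z z' => ? ? [].
  - by case: z => ? ? /=; rewrite mul0r addr0.
  - exact: L2loc_Im.
  - have [ti ii _ _] := test_elementP b' tphi.
    by have := test_eq phi b' tphi; rewrite (dot_real g ii) (dot_real h ti) => -[_ /oppr_inj].
have mg := measurable_funC_slice b (L2_measurable g).
exact: (weak_pair_intro mg DUi pGr pGi gGr gGi).
Qed.

Lemma zigzag_adjoint (g h : L2 mu) : (dom L (F g) /\ F (L (F g)) = h) <->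
  (forall f, dom L f -> dot (L f) g = dot f h).
Proof.
split=> [[dFg <-] f df|gh]; first by have := flip_adjoint df dFg; rewrite flipK.
suff [dFg LFg] : dom L (F g) /\ L (F g) = F h by split=> //; rewrite LFg flipK.
have gFg := flipP g; have hFh := flipP h.
apply: (@zz_intro _ _ (fun e => (- velocity R (~~ e.2))%:C *
    (h (e.1, ~~ e.2) + (rate (e.1, ~~ e.2))%:C * g (e.1, ~~ e.2)
       + (- rate (e.1, ~~ ~~ e.2))%:C * g (e.1, ~~ ~~ e.2))
    + (derive1 U e.1)%:C * g (e.1, ~~ e.2))).
  move=> b; apply: (weak_pair_ae _ _ (weak_pair_adjoint (~~ b) gh)).
    by apply: measurable_funC_slice; exact: L2_measurable.
  by have /ae_zz/(_ b) := gFg.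
apply/ae_zz => b; have /ae_zz gFg' := gFg; have /ae_zz/(_ b) hFh' := hFh.
apply: filterS2 (filterI (gFg' b) (gFg' (~~ b))) hFh' => x [h1 h2] ->.
(* At velocity theta, the terms other than [h] add up to (lambda_{-theta} - lambda_theta + theta U')
   times [g] at velocity -theta, which vanishes by [rate_true]. *)
rewrite /zz_op h1 h2 /= negbK /velocity.
case: b {h1 h2} => /=; rewrite rate_true.
  case: (L2_rep g (x, true)) (L2_rep g (x, false)) (L2_rep h (x, false)) => [a b] [a' b'] [a'' b''].
  by apply/eqP; rewrite eq_complex /=; apply/andP; split; apply/eqP; ring.
case: (L2_rep g (x, true)) (L2_rep g (x, false)) (L2_rep h (x, true)) => [a b] [a' b'] [a'' b''].
by apply/eqP; rewrite eq_complex /=; apply/andP; split; apply/eqP; ring.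
Qed.

End zigzag_operator.

Theorem theorem3p6 (R : realType) (U lrefr : R -> R) (hU : C1 U)
    (lrefr_continuous : continuous lrefr) (lrefr_ge0 : forall x, 0 <= lrefr x) :
  let L := zigzag hU lrefr in
  let F := flip hU in
  let dot := L2_dot (zz_measure hU) in
  [/\ closed_operator L,
      dissipative dot L,
      is_adjoint dot L (Operator (F @` dom L) (fun g => F (L (F g)))) &
      exists2 P : R -> L2 (zz_measure hU) -> L2 (zz_measure hU),
        generates L P &
        forall t, 0 <= t ->
          is_adjoint dot (Operator setT (P t))
                         (Operator setT (fun f => F (P t (F f))))].
Proof.
move=> L F dot.
have norm_dot (u : L2 (zz_measure hU)) : `|u| = dot_norm dot u by [].
have L_dissipative : dissipative dot L by exact: zigzag_dissipative.
have L_linear : linear_operator L by exact: zigzag_linear.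
have L_nondegenerate g : (forall f, dom L f -> dot f g = 0) -> g = 0.
  exact: zigzag_nondegenerate.
have L_adjoint g h : (dom L (F g) /\ F (L (F g)) = h) <->
    (forall f, dom L f -> dot (L f) g = dot f h) by exact: zigzag_adjoint.
have [L_closed adjointL generatesL] := contraction_semigroup_adjoint norm_dot
  (@L2_complete _ _ _ (zz_measure hU)) L_linear L_dissipative
  (@flip_symmetric _ _ hU) (@flipK _ _ hU) L_nondegenerate L_adjoint.
by split.
Qed.
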